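(* Suppose that $k\ge 3$ and $n_i>1$ for all $i\in\{1,\dots,k\}$. Then for every automorphism $f$ of the graph $\Gamma(\sigma,d)$ there are a unitary or anti-unitary operator $U$ on $H$ and a permutation $\delta\in S(d)$ such that $$f(A)=U\delta(A)U^{*}\quad\text{for all } A\in\mathcal{G}(\sigma,d).$$ In particular, every automorphism of $\Gamma(\sigma,d)$ preserving each type of adjacency is induced by a unitary or anti-unitary operator on $H$, i.e. is of the form $A\mapsto UAU^{*}$ for some unitary or anti-unitary operator $U$ on $H$.
   Context: Let $H$ be a complex Hilbert space. For a closed subspace $X\subset H$ let $P_X$ be the orthogonal projection on $X$. Let $\sigma=\{a_1,\dots,a_k\}$, where $a_1,\dots,a_k$ are mutually distinct real numbers, and $d=\{n_1,\dots,n_k\}$, where $n_1,\dots,n_k\in\mathbb{N}\cup\{\infty\}$ are positive and not necessarily distinct ($n_i$ is attached to $a_i$); only an $n_i$ with $a_i=0$ may be $\infty$; $\dim H=n_1+\dots+n_k$. The $(\sigma,d)$-Grassmannian $\mathcal{G}(\sigma,d)$ is the set (a unitary conjugacy class) of all finite-rank self-adjoint operators on $H$ whose spectrum is $\sigma$ and such that for every $i$ the eigenspace corresponding to $a_i$ has dimension $n_i$; equivalently, the operators $A=\sum_{i=1}^k a_iP_{X_i}$ with mutually orthogonal closed subspaces $X_i$ satisfying $\dim X_i=n_i$ and whose sum is $H$. Adjacency: operators $A,B\in\mathcal{G}(\sigma,d)$ are adjacent if (A1) the rank of $B-A$ is equal to $2$, and (A2) $\mathrm{Im}(B-A)$ and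 $\mathrm{Ker}(B-A)$ are invariant to both $A$ and $B$. The graph $\Gamma(\sigma,d)$ is the simple graph with vertex set $\mathcal{G}(\sigma,d)$ in which two operators are joined by an edge if and only if they are adjacent. Types of adjacency: two closed subspaces $X,Y$ of the same dimension are adjacent if $X\cap Y$ is a hyperplane (subspace of codimension $1$) in both $X$ and $Y$. For distinct $i,j\in\{1,\dots,k\}$, operators $A,B\in\mathcal{G}(\sigma,d)$ with eigenspaces $X_t,Y_t$ (respectively) corresponding to $a_t$ are $(i,j)$-adjacent if $X_t,Y_t$ are adjacent for $t\in\{i,j\}$ and $X_t=Y_t$ for $t\notin\{i,j\}$. Each unordered pair $\{i,j\}$ is a type of adjacency; $f$ preserves each type of adjacency if it sends $(i,j)$-adjacent operators to $(i,j)$-adjacent operators for all distinct $i,j$. $S(d)$ is the group of all permutations $\delta$ of $\{1,\dots,k\}$ satisfying $n_{\delta(i)}=n_i$ for all $i$. For $\delta\in S(d)$ and $A=\sum_{i=1}^k a_iP_{X_i}\in\mathcal{G}(\sigma,d)$, put $\delta(A)=\sum_{i=1}^k a_iP_{X_{\delta(i)}}\in\mathcal{G}(\sigma,d)$. *)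

(* Defs.v *)
From mathcomp Require Import all_boot all_order all_algebra all_fingroup.
From mathcomp Require Import sesquilinear complex.
From mathcomp Require Import all_classical all_reals all_analysis.

Set Implicit Arguments.
Unset Strict Implicit.
Unset Printing Implicit Defensive.

Import Order.TTheory GRing.Theory Num.Theory Num.Def.
Import numFieldNormedType.Exports.

Local Open Scope classical_set_scope.
Local Open Scope complex_scope.
Local Open Scope ring_scope.

(* Extended naturals: [Some m] is the number m and [None] is infinity. *)
Definition enat := option nat.

Definition eaddn (m n : enat) : enat :=
  if (m, n) is (Some p, Some q) then Some (p + q)%N else None.

(* For a simple graph on V : set T, an automorphism is represented by a function
   on T whose values outside V are irrelevant. *)
Definition graph_automorphism (T : Type) (V : set T) (E : T -> T -> Prop)
    (f : T -> T) : Prop :=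
  set_bij V V f /\ forall x y, V x -> V y -> (E x y <-> E (f x) (f y)).

(* A complex Hilbert space is a complete normed space H over R[i] whose norm is
   that of the inner product dot, i.e. `|x| ^+ 2 = dot x x; this equation is
   assumed where it is needed. dot is linear in its first argument. *)
Section Hilbert.
Context {R : realType} {H : completeNormedModType R[i]}.
Implicit Types (X Y Z : set H) (A B T U V : H -> H).

Definition subspace_basis X (m : nat) (e : 'I_m -> H) : Prop :=
  (forall c : 'I_m -> R[i], \sum_i c i *: e i = 0 -> forall i, c i = 0) /\
  X = [set \sum_i c i *: e i | c in [set: 'I_m -> R[i]]].

(* Infinite dimensions are not distinguished from each other. *)
Definition hdim X : enat :=
  xget None [set d | exists m (e : 'I_m -> H), d = Some m /\ subspace_basis X e].

Definition operator_rank T : enat := hdim (range T).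

Definition ker T : set H := [set x | T x = 0].

Definition invariant_under T X : Prop := T @` X `<=` X.

Definition bounded_operator T : Prop := linear T /\ continuous T.

Definition spectrum T : set R[i] :=
  [set z | ~ exists2 S : H -> H, bounded_operator S &
      cancel (fun x => T x - z *: x) S /\ cancel S (fun x => T x - z *: x)].

Definition eigensubspace T (z : R[i]) : set H := [set x | T x = z *: x].

Definition hyperplane Z X : Prop :=
  Z `<=` X /\ exists v, [/\ X v, ~ Z v &
    forall x, X x -> exists2 z, Z z & exists c : R[i], x = z + c *: v].

Definition adjacent_subspaces X Y : Prop :=
  [/\ hdim X = hdim Y, hyperplane (X `&` Y) X & hyperplane (X `&` Y) Y].

Definition adjacent_operators A B : Prop :=
  [/\ operator_rank (B \- A) = Some 2%N,
      invariant_under A (range (B \- A)), invariant_under B (range (B \- A)),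
      invariant_under A (ker (B \- A)) & invariant_under B (ker (B \- A))].

Definition antilinear U : Prop := linear_for (conjC \; *:%R) U.

Variable dot : {dot H for conjC}.

Definition self_adjoint T : Prop := forall x y, dot (T x) y = dot x (T y).

(* The orthogonal projection on a closed subspace X. *)
Definition oproj X (x : H) : H :=
  xget 0 [set y | X y /\ forall z, X z -> dot (x - y) z = 0].

Definition unitary_operator U : Prop :=
  [/\ linear U, bijective U & forall x y, dot (U x) (U y) = dot x y].

Definition antiunitary_operator U : Prop :=
  [/\ antilinear U, bijective U & forall x y, dot (U x) (U y) = (dot x y)^*].

(* The adjoint U^*, for linear as well as for antilinear U. *)
Definition adjoint U (y : H) : H :=
  xget 0 [set v |
    (linear U /\ forall x, dot (U x) y = dot x v) \/
    (antilinear U /\ forall x, dot (U x) y = (dot x v)^*)].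

Section Grassmannian.
Variables (k : nat) (a : 'I_k -> R) (n : 'I_k -> enat).

Definition grassmannian : set (H -> H) :=
  [set A | [/\ bounded_operator A, self_adjoint A, operator_rank A <> None,
               spectrum A = [set (a i)%:C | i in [set: 'I_k]] &
               forall i, hdim (eigensubspace A (a i)%:C) = n i]].

Definition ij_adjacent (i j : 'I_k) A B : Prop :=
  forall t, if (t == i) || (t == j)
    then adjacent_subspaces (eigensubspace A (a t)%:C) (eigensubspace B (a t)%:C)
    else eigensubspace A (a t)%:C = eigensubspace B (a t)%:C.

Definition preserves_types (f : (H -> H) -> (H -> H)) : Prop :=
  forall i j, i != j -> forall A B, grassmannian A -> grassmannian B ->
    ij_adjacent i j A B -> ij_adjacent i j (f A) (f B).

Definition dim_preserving (delta : {perm 'I_k}) : Prop :=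
  forall i, n (delta i) = n i.

Definition permute (delta : {perm 'I_k}) A : H -> H :=
  fun x => \sum_i (a i)%:C *: oproj (eigensubspace A (a (delta i))%:C) x.

End Grassmannian.
End Hilbert.

(* Main.v *)
(** Operators in the Grassmannian correspond to orthogonal decompositions [H = X_1 + ... + X_k] with
    [dim X_i = n_i], and adjacent operators to decompositions that differ by a rotation of the plane
    spanned by some nonzero [x] in [X_i] and [y] in [X_j]. Two neighbours of [A] are adjacent only
    if they share the pair [{i, j}] and one of the two lines [C x], [C y]; hence the cliques that are
    common neighbourhoods of triangles through [A] are the stars [(i, j, x)] of all rotations with
    [i], [j] and [x] fixed. Any two neighbours of [A] taken from two stars complete to a square when
    the types are disjoint or the stars are [(i, j, x)] and [(i, l, z)] with [x] orthogonal to [z];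
    this fails for all other pairs of stars of different types. So an automorphism respects
    types up to a permutation of the indices at each vertex, which is the same at all vertices
    because the graph is connected.

    After this permutation the [i]-th eigenspace of [f A] depends only on that of [A], again by
    connectivity, this time of the decompositions with a fixed [i]-th space, and the maps obtained
    on [n_i]-dimensional subspaces preserve orthogonality between different indices. Such maps
    descend to smaller subspaces, finally to lines, where the maps for different indices agree.
    A bijection of lines that preserves orthogonality is induced by a semilinear map [U] up to
    scaling; preservation of [dot] makes its field endomorphism commute with conjugation, so that it
    maps the reals to themselves and is the identity or the conjugation. *)

Require Import Defs.
From mathcomp Require Import all_boot all_order all_algebra all_fingroup.
From mathcomp Require Import sesquilinear complex ring lra.
From mathcomp Require Import all_classical all_reals all_analysis.

Set Implicit Arguments.
Unset Strict Implicit.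
Unset Printing Implicit Defensive.

Import Order.TTheory GRing.Theory Num.Theory Num.Def.
Import numFieldNormedType.Exports.

Local Open Scope classical_set_scope.
Local Open Scope complex_scope.
Local Open Scope ring_scope.

(** * Finite-dimensional subspaces of an inner product space *)

(** [n i > 1] gives every eigenspace a nonzero vector orthogonal to a prescribed one. A star
    therefore contains rotations towards non-parallel vectors, which distinguishes it from the
    opposite stars. [k > 2] gives an index outside any two, used to separate types and to leave room
    in the descent. At most one index is infinite-dimensional, and its space is the orthogonal
    complement of all the others, so dimensions are counted at a finite index and the result is
    carried over.

    Before operators return, everything is algebraic: subspaces of a module with an inner product.
    Continuity comes back only to bound unitary conjugates, and an operator with a prescribed
    decomposition is obtained by conjugating a given one.

    The semilinear map is built by hand. In the chart [e + v] with [v] orthogonal to [e],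
    orthogonality of two lines becomes the equation [dot v w = -1]; this gives access to scalars and
    to values of [dot], not only to its zeros. *)

Section InnerProduct.
Context {C : numClosedFieldType} {H : lmodType C} (dot : {dot H for conjC}).
Implicit Types (X Y Z M : set H) (x y z u v w : H) (us : seq H).

Lemma dotC x y : dot y x = (dot x y)^*.
Proof. by rewrite (hermC dot y x) expr0 mul1r. Qed.

Lemma dotZl a x y : dot (a *: x) y = a * dot x y.
Proof. by rewrite linearZl_LR. Qed.

Lemma dotZr a x y : dot x (a *: y) = a^* * dot x y.
Proof. by rewrite linearZr_LR. Qed.

Lemma dotDl x y z : dot (y + z) x = dot y x + dot z x.
Proof. exact: linearDl. Qed.

Lemma dotDr x y z : dot x (y + z) = dot x y + dot x z.
Proof. exact: linearDr. Qed.

Lemma dotNl x y : dot (- x) y = - dot x y.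
Proof. exact: linearNl. Qed.

Lemma dotNr x y : dot x (- y) = - dot x y.
Proof. exact: linearNr. Qed.

Lemma dot0l x : dot 0 x = 0.
Proof. exact: linear0l. Qed.

Lemma dot0r x : dot x 0 = 0.
Proof. exact: linear0r. Qed.

Lemma dot_suml (I : finType) (P : pred I) (F : I -> H) y :
  dot (\sum_(i | P i) F i) y = \sum_(i | P i) dot (F i) y.
Proof. exact: (linear_sumlz dot). Qed.

Definition dotE := (dotDl, dotDr, dotNl, dotNr, dotZl, dotZr, dot0l, dot0r).

Lemma dot_eq0 x : (dot x x == 0) = (x == 0).
Proof. exact: dnorm_eq0. Qed.

Lemma dot_conjxx x : (dot x x)^* = dot x x.
Proof. by rewrite -dotC. Qed.

Lemma dotxx0 x : dot x x = 0 -> x = 0.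
Proof. by move=> /eqP; rewrite dot_eq0 => /eqP. Qed.

Lemma dot_neq0 x : x != 0 -> dot x x != 0.
Proof. by rewrite dot_eq0. Qed.

Lemma dot_sym0 x y : dot x y = 0 -> dot y x = 0.
Proof. by move=> h; rewrite dotC h conjC0. Qed.

(** Vector identities below are proved through this: paired with an arbitrary [z], they become
    scalar identities for [ring]. *)
Lemma dot_ext x y : (forall z, dot x z = dot y z) -> x = y.
Proof.
move=> h; apply/eqP; rewrite -subr_eq0; apply/eqP; apply: dotxx0.
by rewrite {1}dotDl dotNl h subrr.
Qed.

Definition submod X := X 0 /\ forall a x y, X x -> X y -> X (a *: x + y).

Lemma submod0 X : submod X -> X 0. Proof. by case. Qed.

Lemma submodZ X a x : submod X -> X x -> X (a *: x).
Proof. by move=> [X0 hX] Xx; rewrite -[_ *: _]addr0; apply: hX. Qed.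

Lemma submodD X x y : submod X -> X x -> X y -> X (x + y).
Proof. by move=> [X0 hX] Xx Xy; rewrite -[x]scale1r; apply: hX. Qed.

Lemma submodN X x : submod X -> X x -> X (- x).
Proof. by move=> lX Xx; rewrite -scaleN1r; apply: submodZ. Qed.

Lemma submodB X x y : submod X -> X x -> X y -> X (x - y).
Proof. by move=> lX Xx Xy; apply: submodD => //; apply: submodN. Qed.

Lemma submod_sum X (I : finType) (P : pred I) (F : I -> H) :
  submod X -> (forall i, P i -> X (F i)) -> X (\sum_(i | P i) F i).
Proof.
by move=> lX h; apply: (big_ind X) => // [|x y]; [exact: submod0|exact: submodD].
Qed.

Lemma submodZV X a x : submod X -> a != 0 -> X (a *: x) -> X x.
Proof. by move=> lX a0 /(submodZ a^-1 lX); rewrite scalerA mulVf // scale1r. Qed.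

Definition perp X x : set H := [set v | X v /\ dot v x = 0].

Lemma submod_perp X x : submod X -> submod (perp X x).
Proof.
move=> lX; split; first by split; [exact: submod0|rewrite dot0l].
move=> a u v [Xu u0] [Xv v0]; split; first by case: lX => _; apply.
by rewrite !dotE u0 v0 mulr0 addr0.
Qed.

Lemma perp_sub X x : perp X x `<=` X. Proof. by move=> v []. Qed.

Lemma perpS X Y x : X `<=` Y -> perp X x `<=` perp Y x.
Proof. by move=> XY v [/XY]. Qed.

Lemma perpZ X x a : a != 0 -> perp X (a *: x) = perp X x.
Proof.
move=> a0; apply/seteqP; split=> v [Xv]; rewrite /perp /= ?dotZr => h; split=> //.
  by move/eqP: h; rewrite mulf_eq0 conjC_eq0 (negPf a0) => /eqP.
by rewrite h mulr0.
Qed.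

Definition line_proj x v := (dot v x / dot x x) *: x.

Lemma line_proj_perp x v : x != 0 -> dot (v - line_proj x v) x = 0.
Proof. by move=> x0; rewrite !dotE divfK ?subrr // dot_neq0. Qed.

Lemma perpP X x v : submod X -> X x -> x != 0 -> X v ->
  exists2 w, perp X x w & v = line_proj x v + w.
Proof.
move=> lX Xx x0 Xv; exists (v - line_proj x v); last by rewrite addrC subrK.
by split; [apply: submodB => //; apply: submodZ|apply: line_proj_perp].
Qed.

(** Dimension by splitting off a line and passing to its orthogonal complement, so that inductions
    need no coordinates. Independence of the chosen line is [fdim_perp]. *)
Fixpoint fdim m X : Prop :=
  if m is m'.+1 then submod X /\ exists x, [/\ X x, x != 0 & fdim m' (perp X x)]
  else X = [set 0].

Lemma submod_set0 : submod [set 0].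
Proof. by split=> // a x y -> ->; rewrite scaler0 addr0. Qed.

Lemma submod_fdim m X : fdim m X -> submod X.
Proof. by case: m => [->|m []//]; exact: submod_set0. Qed.

(** If [x] is not parallel to the vector [x0] given by the definition, let [w] be its part
    orthogonal to [x0]. Removing [x] and then [z] leaves the same space as removing [x0] and then
    [w]: both are the complement of one plane. *)
Lemma fdim_perp m X x : fdim m.+1 X -> X x -> x != 0 -> fdim m (perp X x).
Proof.
elim: m X x => [|m IH] X x /= [lX [x0 [Xx0 x00 fX]]] Xx xn0;
  have [w [Xw wx0] xE] := perpP lX Xx0 x00 Xx.
  have w0 : w = 0 by have : perp X x0 w by []; rewrite fX.
  rewrite w0 addr0 in xE; rewrite xE perpZ //.
  by apply: contraNneq xn0 => c0; rewrite xE /line_proj c0 scale0r.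
set c := dot x x0 / dot x0 x0 in xE.
have [w0|w0] := eqVneq w 0.
  rewrite w0 addr0 in xE; rewrite xE /line_proj -/c perpZ //.
  by apply: contraNneq xn0 => c0; rewrite xE /line_proj -/c c0 scale0r.
split; first exact: submod_perp.
have fw := IH _ _ fX (conj Xw wx0) w0.
(* [z] spans the orthogonal of [x] in the plane of [x0] and [w] *)
pose z := (dot w w) *: x0 - (c^* * dot x0 x0) *: w.
have x0w := dot_sym0 wx0.
have zx : dot z x = 0 by rewrite xE /line_proj -/c /z !dotE wx0 x0w; ring.
have zn0 : z != 0.
  apply/negP => /eqP /(congr1 (fun v => dot v x0)); rewrite /z !dotE wx0 mulr0 subr0.
  by apply/eqP; rewrite mulf_eq0 !dot_eq0 (negPf w0) (negPf x00).
exists z; split=> //; first by split=> //; apply: submodB => //; apply: submodZ.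
rewrite (_ : perp _ _ = perp (perp X x0) w) //.
have fact v : dot v x = c^* * dot v x0 + dot v w by rewrite {1}xE /line_proj -/c !dotE.
have fact2 v : dot v z = dot w w * dot v x0 - (c * dot x0 x0) * dot v w.
  by rewrite /z !dotE rmorphM /= conjCK !dot_conjxx.
apply/seteqP; split=> v [[Xv h1] h2].
  rewrite fact in h1; rewrite fact2 in h2.
  have hw : dot v w = - (c^* * dot v x0) by apply/eqP; rewrite -addr_eq0 addrC h1.
  have hx : dot v x0 = 0.
    have xx : dot x x = c * c^* * dot x0 x0 + dot w w.
      by rewrite xE /line_proj -/c !dotE x0w wx0; ring.
    have : dot v x0 * dot x x = 0 by rewrite xx -h2 hw; ring.
    by move/eqP; rewrite mulf_eq0 dot_eq0 (negPf xn0) orbF => /eqP.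
  by split; [split|rewrite hw hx mulr0 oppr0].
by split; [split|]; rewrite ?fact ?fact2 // h1 h2; ring.
Qed.

Lemma fdim_uniq m p X : fdim m X -> fdim p X -> m = p.
Proof.
elim: m p X => [|m IH] [|p] X //.
- by move=> /= -> [_ [x [-> /eqP]]].
- by move=> [_ [x [+ + _]]] /= h; rewrite h => -> /eqP.
- by move=> [lX [x [Xx x0 fX]]] fX'; rewrite (IH p _ fX) //; apply: fdim_perp.
Qed.

Lemma fdim_sub m X Y : fdim m Y -> submod X -> X `<=` Y -> exists2 p, (p <= m)%N & fdim p X.
Proof.
elim: m X Y => [|m IH] X Y fY lX XY.
  by exists 0%N => //; apply/seteqP; split=> [x /XY|x ->]; rewrite ?fY //; exact: submod0.
have [h|/existsNP[x /not_implyP[Xx /eqP x0]]] := pselect (forall x, X x -> x = 0).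
  by exists 0%N => //; apply/seteqP; split=> [x /h|x ->] //; exact: submod0.
have [p pm fp] := IH _ _ (fdim_perp fY (XY _ Xx) x0) (submod_perp x lX) (perpS XY).
by exists p.+1 => //; split=> //; exists x.
Qed.

Lemma fdim_sub_eq m X Y : fdim m X -> fdim m Y -> X `<=` Y -> X = Y.
Proof.
elim: m X Y => [|m IH] X Y fX fY XY; first by rewrite fX fY.
apply/seteqP; split=> // y Yy; case: (fX) => lX [x [Xx x0 fXx]].
have e := IH _ _ fXx (fdim_perp fY (XY _ Xx) x0) (perpS XY).
have [w Yw ->] := perpP (submod_fdim fY) (XY _ Xx) x0 Yy.
by rewrite -e in Yw; case: Yw => Xw _; apply: submodD => //; apply: submodZ.
Qed.

Lemma fdim_sub_le p m X Y : fdim p X -> fdim m Y -> X `<=` Y -> (p <= m)%N.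
Proof.
move=> fX fY XY; have [q qm fq] := fdim_sub fY (submod_fdim fX) XY.
by rewrite (fdim_uniq fX fq).
Qed.

Lemma fdim_proj m M x : fdim m M ->
  exists2 p, M p & forall z, M z -> dot (x - p) z = 0.
Proof.
elim: m M x => [|m IH] M x fM.
  by rewrite fM; exists 0 => // z ->; rewrite dot0r.
case: (fM) => lM [e [Me e0 fMe]]; have [p [Mp pe] hp] := IH _ (x - line_proj e x) fMe.
exists (line_proj e x + p); first by apply: submodD => //; apply: submodZ.
move=> z Mz; have [w Mw ->] := perpP lM Me e0 Mz.
rewrite opprD addrA dotDr (hp _ Mw) addr0 /line_proj dotZr dotDl line_proj_perp //.
by rewrite dotNl pe oppr0 addr0 mulr0.
Qed.

Definition add_line X v : set H := [set z | exists u c, X u /\ z = u + c *: v].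

Lemma submod_add_line X v : submod X -> submod (add_line X v).
Proof.
move=> lX; split; first by exists 0, 0; split; [exact: submod0|rewrite scale0r addr0].
move=> a _ _ [u [c [Xu ->]]] [u' [c' [Xu' ->]]].
exists (a *: u + u'), (a * c + c'); split; first by case: lX => _; apply.
by rewrite scalerDr scalerA addrACA -scalerDl.
Qed.

Lemma sub_add_line X v : X `<=` add_line X v.
Proof. by move=> u Xu; exists u, 0; rewrite scale0r addr0. Qed.

Lemma mem_add_line X v : submod X -> add_line X v v.
Proof. by move=> lX; exists 0, 1; rewrite scale1r add0r; split=> //; exact: submod0. Qed.

Lemma add_line_min X Y v : submod Y -> X `<=` Y -> Y v -> add_line X v `<=` Y.
Proof. by move=> lY XY Yv _ [u [c [/XY Xu ->]]]; apply: submodD => //; apply: submodZ. Qed.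

Lemma fdim_add_line m X v : fdim m X -> ~ X v -> fdim m.+1 (add_line X v).
Proof.
move=> fX nXv; have lX := submod_fdim fX; split; first exact: submod_add_line.
have [p Xp hp] := fdim_proj v fX.
have vp0 : v - p != 0.
  by apply/negP; rewrite subr_eq0 => /eqP e; apply: nXv; rewrite e.
exists (v - p); split=> //.
  by exists (- p), 1; split; [exact: submodN|rewrite scale1r addrC].
rewrite (_ : perp _ _ = X) //; apply/seteqP; split=> [_ [[u [c [Xu ->]]]]|u Xu]; last first.
  by split; [exact: sub_add_line|apply: dot_sym0; exact: hp].
have -> : u + c *: v = (u + c *: p) + c *: (v - p) by apply: dot_ext => z; rewrite !dotE; ring.
have Xup : X (u + c *: p) by apply: submodD => //; apply: submodZ.
rewrite dotDl (dot_sym0 (hp _ Xup)) add0r dotZl => /eqP.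
by rewrite mulf_eq0 dot_eq0 (negPf vp0) orbF => /eqP ->; rewrite !scale0r !addr0.
Qed.

(** The vectors of [us] separate the points of [X], and passing to the kernel of one functional
    [dot _ u] lowers the dimension by at most one. *)
Lemma fdim_of_sep X us : submod X ->
  (forall x, X x -> (forall u, u \in us -> dot x u = 0) -> x = 0) ->
  exists2 m, (m <= size us)%N & fdim m X.
Proof.
elim: us X => [|u us IH] X lX h.
  exists 0%N => //; apply/seteqP; split=> [x Xx|x ->]; last exact: submod0.
  by rewrite (h x).
have [x [Xx xu]|m mus fm] := IH _ (submod_perp u lX).
  move=> hx; apply: h => // v; rewrite inE => /orP[/eqP ->|] //; exact: hx.
have [XE|/existsNP[x /not_implyP[Xx xu]]] := pselect (forall x, X x -> dot x u = 0).
  exists m; first exact: leqW.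
  by rewrite (_ : X = perp X u) //; apply/seteqP; split=> [x Xx|x []//]; split=> //; apply: XE.
have -> : X = add_line (perp X u) x.
  apply/seteqP; split=> [v Xv|]; last by apply: add_line_min => //; exact: perp_sub.
  exists (v - (dot v u / dot x u) *: x), (dot v u / dot x u); split; last by rewrite subrK.
  split; first by apply: submodB => //; apply: submodZ.
  by rewrite !dotE divfK ?subrr //; apply/eqP.
by exists m.+1 => //; apply: fdim_add_line => // -[].
Qed.

(** The hypothesis is phrased so that it holds vacuously for an infinite-dimensional [X]. *)
Lemma ex_perp X us : submod X -> (forall m, fdim m X -> (size us < m)%N) ->
  exists x, [/\ X x, x != 0 & forall u, u \in us -> dot x u = 0].
Proof.
move=> lX h; apply: contrapT => nex.
have [x Xx hx|m mus fm] := @fdim_of_sep X us lX.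
  by apply: contrapT => /eqP x0; apply: nex; exists x.
by have := h _ fm; rewrite ltnNge mus.
Qed.

(** Of a basis only this is used later: orthogonality to [X] is tested on finitely many vectors. *)
Lemma fdim_basis m X : fdim m X -> exists us, [/\ size us = m, forall u, u \in us -> X u &
  forall v, (forall u, u \in us -> dot v u = 0) -> forall x, X x -> dot v x = 0].
Proof.
elim: m X => [|m IH] X fX.
  by exists [::]; split=> // v _ x; rewrite fX => ->; rewrite dot0r.
case: (fX) => lX [e [Xe e0 fe]]; have [us [<- usX hus]] := IH _ fe.
exists (e :: us); split=> // [u|v hv x Xx].
  by rewrite inE => /orP[/eqP ->|/usX []].
have [w Xw ->] := perpP lX Xe e0 Xx.
rewrite dotDr (hus v _ w) // => [|u uu]; last by apply: hv; rewrite inE uu orbT.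
by rewrite addr0 dotZr hv ?mulr0 ?mem_head.
Qed.

Lemma fdim1P X : fdim 1 X -> exists2 x, x != 0 & X = [set a *: x | a in [set: C]].
Proof.
move=> [lX [x [Xx x0 /= fx]]]; exists x => //; apply/seteqP; split=> [v Xv|_ [a _ <-]]; last exact: submodZ.
have [w] := perpP lX Xx x0 Xv; rewrite fx => -> ->.
by exists (dot v x / dot x x) => //; rewrite addr0.
Qed.

Lemma fdim_line x : x != 0 -> fdim 1 [set a *: x | a in [set: C]].
Proof.
move=> x0; split.
  split; first by exists 0 => //; rewrite scale0r.
  by move=> a _ _ [b _ <-] [c _ <-]; exists (a * b + c) => //; rewrite scalerDl scalerA.
exists x; split=> //; first by exists 1 => //; rewrite scale1r.
apply/seteqP; split=> [_ [[a _ <-]]|_ ->]; last first.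
  by split; [exists 0; rewrite ?scale0r|rewrite dot0l].
by rewrite dotZl => /eqP; rewrite mulf_eq0 dot_eq0 (negPf x0) orbF => /eqP ->; rewrite scale0r.
Qed.

End InnerProduct.

(** * Unitary maps and rotations of a plane *)

Section Unitary.
Context {C : numClosedFieldType} {H : lmodType C} (dot : {dot H for conjC}).
Implicit Types (X Y Z M : set H) (x y z u v w : H).

Definition unitary (U : H -> H) :=
  [/\ linear U, bijective U & forall x y, dot (U x) (U y) = dot x y].

Section Basic.
Variables (U : H -> H) (hU : unitary U).

Lemma unitary_lin : linear U. Proof. by case: hU. Qed.

Lemma unitaryE : (forall x y, U (x + y) = U x + U y) /\ (forall a x, U (a *: x) = a *: U x).
Proof.
have lU := unitary_lin; have UD x y : U (x + y) = U x + U y by have := lU 1 x y; rewrite !scale1r.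
split=> // a x; have := lU a x 0; rewrite !addr0 => ->.
have /eqP := UD 0 0; rewrite addr0 -subr_eq subrr => /eqP <-; exact: addr0.
Qed.

Lemma unitary_eq0 x : (U x == 0) = (x == 0).
Proof. by case: hU => _ _ e; rewrite -(dot_eq0 dot) e dot_eq0. Qed.

Lemma unitary_inj : injective U.
Proof. by case: hU => _ /bij_inj. Qed.

Lemma unitary_inv : exists V, [/\ unitary V, cancel U V & cancel V U].
Proof.
case: (hU) => lU [V UV VU] e; exists V; split=> //; split.
- by move=> a x y; apply: unitary_inj; rewrite lU !VU.
- by exists U.
- by move=> x y; rewrite -e !VU.
Qed.

Lemma submod_img X : submod X -> submod (U @` X).
Proof.
case: unitaryE => UD UZ [X0 hX]; split.
  by exists 0 => //; apply/eqP; rewrite unitary_eq0.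
by move=> a _ _ [x Xx <-] [y Xy <-]; exists (a *: x + y); rewrite ?UD ?UZ //; apply: hX.
Qed.

Lemma img_perp X x : U @` perp dot X x = perp dot (U @` X) (U x).
Proof.
case: hU => _ _ e; apply/seteqP; split=> [_ [v [Xv h] <-]|_ [[v Xv <-]]].
  by split; [exists v|rewrite e].
by rewrite e => h; exists v.
Qed.

Lemma img_fdim m X : fdim dot m X -> fdim dot m (U @` X).
Proof.
elim: m X => [|m IH] X.
  move=> -> /=; apply/seteqP; split=> [_ [x -> <-]|_ ->].
    by apply/eqP; rewrite unitary_eq0.
  by exists 0 => //; apply/eqP; rewrite unitary_eq0.
move=> [lX [x [Xx x0 fx]]]; split; first exact: submod_img.
by exists (U x); split; [exists x|rewrite unitary_eq0|rewrite -img_perp; apply: IH].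
Qed.

End Basic.

Lemma unitary_comp U V : unitary U -> unitary V -> unitary (U \o V).
Proof.
move=> [lU bU eU] [lV bV eV]; split; [|exact: bij_comp|by move=> x y; rewrite /= eU eV].
by move=> a x y; rewrite /= lV lU.
Qed.

Lemma unitary_id : unitary idfun.
Proof. by split=> //; exists idfun. Qed.

Lemma normalize x : x != 0 -> exists2 c, c != 0 & dot (c *: x) (c *: x) = 1.
Proof.
move=> x0; have p : 0 < dot x x by rewrite dnorm_gt0.
exists (sqrtC (dot x x))^-1; first by rewrite invr_neq0 // sqrtC_eq0 dot_eq0.
rewrite !dotE -[_^*]/(conjC _) geC0_conj ?invr_ge0 ?sqrtC_ge0 ?ltW //.
by rewrite mulrA -invfM -expr2 sqrtCK mulVf // dot_eq0.
Qed.

(** For orthonormal [x], [y] and parameters with squared moduli of sum 1, this is the special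
    unitary map of their plane with first column [a], [b], extended by the identity on the
    orthogonal complement. *)
Definition rot x y (a b : C) v :=
  v + (a * dot v x - b^* * dot v y - dot v x) *: x
    + (b * dot v x + a^* * dot v y - dot v y) *: y.

Section Rot.
Variables (x y : H) (a b : C).
Hypotheses (xx : dot x x = 1) (yy : dot y y = 1) (xy : dot x y = 0)
  (ab : a * a^* + b * b^* = 1).

Let yx : dot y x = 0. Proof. exact: dot_sym0. Qed.

Lemma rotx v : dot (rot x y a b v) x = a * dot v x - b^* * dot v y.
Proof. by rewrite /rot !dotE xx yx; ring. Qed.

Lemma roty v : dot (rot x y a b v) y = b * dot v x + a^* * dot v y.
Proof. by rewrite /rot !dotE yy xy; ring. Qed.

Lemma rot_fix v : dot v x = 0 -> dot v y = 0 -> rot x y a b v = v.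
Proof. by rewrite /rot => -> ->; rewrite !mulr0 !subr0 addr0 !scale0r !addr0. Qed.

Lemma rot_x : rot x y a b x = a *: x + b *: y.
Proof. by apply: (@dot_ext _ _ dot) => z; rewrite /rot xx xy !dotE; ring. Qed.

Lemma rot_y : rot x y a b y = - b^* *: x + a^* *: y.
Proof. by apply: (@dot_ext _ _ dot) => z; rewrite /rot yy yx !dotE; ring. Qed.

Lemma rot_dot v w : dot (rot x y a b v) (rot x y a b w) = dot v w.
Proof.
set r := rot x y a b w; rewrite {1}/rot !dotDl !dotZl /r.
have e u : dot u (rot x y a b w) = dot u w
    + (a^* * (dot w x)^* - b * (dot w y)^* - (dot w x)^*) * dot u x
    + (b^* * (dot w x)^* + a * (dot w y)^* - (dot w y)^*) * dot u y.
  by rewrite /rot !dotE !(rmorphB, rmorphD, rmorphM) /= !conjCK.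
rewrite !e xx yy xy yx [dot x w](dotC dot w x) [dot y w](dotC dot w y).
set p := dot v x; set q := dot v y; set s := (dot w x)^*; set t := (dot w y)^*.
set a' := a^*; set b' := b^*.
apply/eqP; rewrite -subr_eq0; apply/eqP.
(* The two sides differ by a multiple of the relation [ab]. *)
transitivity ((a * a' + b * b' - 1) * (p * s + q * t)); first by ring.
by rewrite ab subrr mul0r.
Qed.

End Rot.

Lemma rotK x y a b : dot x x = 1 -> dot y y = 1 -> dot x y = 0 -> a * a^* + b * b^* = 1 ->
  cancel (rot x y a b) (rot x y a^* (- b)).
Proof.
move=> xx yy xy ab v; have yx := dot_sym0 xy.
rewrite {1}/rot rotx // roty // rmorphN /= conjCK.
apply: (@dot_ext _ _ dot) => z; rewrite /rot !dotE.
set p := dot v x; set q := dot v y; set a' := a^*; set b' := b^*.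
apply/eqP; rewrite -subr_eq0; apply/eqP.
transitivity ((a * a' + b * b' - 1) * (p * dot x z + q * dot y z)); first by ring.
by rewrite ab subrr mul0r.
Qed.

Lemma rot_unitary x y a b :
  dot x x = 1 -> dot y y = 1 -> dot x y = 0 -> a * a^* + b * b^* = 1 -> unitary (rot x y a b).
Proof.
move=> xx yy xy ab; split; last exact: rot_dot.
  move=> c u v; apply: (@dot_ext _ _ dot) => z; rewrite /rot !dotE; ring.
exists (rot x y a^* (- b)); first exact: rotK.
have ab' : a^* * a^*^* + - b * (- b)^* = 1 by rewrite rmorphN mulrNN /= conjCK mulrC.
by have := rotK xx yy xy ab'; rewrite conjCK opprK.
Qed.

(** Lets a description found at the second index be rewritten at the first, for the case that only
    the second has finite dimension. *)
Lemma rotC x y a b : rot y x a b = rot x y a^* (- b^*).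
Proof.
apply: funext => v; apply: (@dot_ext _ _ dot) => z.
rewrite /rot !dotE rmorphN /= !conjCK; ring.
Qed.

End Unitary.

(** * Orthogonal decompositions and plane rotations *)

Lemma ex_third k (i j : 'I_k) : (2 < k)%N -> exists l : 'I_k, l != i /\ l != j.
Proof.
move=> k3; apply: contrapT => nex.
have : (#|'I_k| <= #|[:: i; j]|)%N.
  apply: subset_leq_card; apply/fintype.subsetP => l _; rewrite !inE; apply: contraT.
  by rewrite negb_or => /andP[li lj]; case: nex; exists l.
by rewrite card_ord leqNgt (leq_ltn_trans (card_size _)).
Qed.

Section Decompositions.
Context {C : numClosedFieldType} {H : lmodType C} (dot : {dot H for conjC}).
Context {k : nat} (n : 'I_k -> option nat).
Hypothesis n_inf : forall i j, n i = None -> n j = None -> i = j.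
Hypothesis n_gt1 : forall i m, n i = Some m -> (1 < m)%N.
Hypothesis k_gt2 : (2 < k)%N.
Implicit Types (X Y Z M : set H) (x y z u v w : H) (A B D E : 'I_k -> set H) (i j l p q t : 'I_k).
Local Notation perp := (perp dot).
Local Notation rot := (rot dot).
Local Notation unitary := (unitary dot).
Local Notation fdim := (fdim dot).

Definition has_dim (d : option nat) X :=
  if d is Some m then fdim m X else forall m, ~ fdim m X.

Definition is_decomp D :=
  [/\ forall t, submod (D t),
      forall s t x y, s != t -> D s x -> D t y -> dot x y = 0,
      forall x, exists2 c : 'I_k -> H, (forall t, D t (c t)) & x = \sum_t c t &
      forall t, has_dim (n t) (D t)].

Definition pr D x t : H :=
  xget (fun=> 0) [set c : 'I_k -> H | (forall t, D t (c t)) /\ x = \sum_t c t] t.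

Section OneDec.
Variables (D : 'I_k -> set H) (hD : is_decomp D).

Lemma submod_dec t : submod (D t). Proof. by case: hD. Qed.

Lemma dec_orth s t x y : s != t -> D s x -> D t y -> dot x y = 0.
Proof. by case: hD => _ + _ _; apply. Qed.

Lemma prP x : (forall t, D t (pr D x t)) /\ x = \sum_t pr D x t.
Proof.
case: hD => _ _ /(_ x)[c h1 h2] _; rewrite /pr; case: xgetP => [c' -> //|/(_ c)].
by case.
Qed.

Lemma pr_in x t : D t (pr D x t). Proof. by case: (prP x). Qed.

Lemma pr_sum x : x = \sum_t pr D x t. Proof. by case: (prP x). Qed.

Lemma dot_pr x t y : D t y -> dot x y = dot (pr D x t) y.
Proof.
move=> Dy; rewrite {1}(pr_sum x) dot_suml (bigD1 t) //= big1 ?addr0 // => s st.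
by apply: (dec_orth st) => //; exact: pr_in.
Qed.

Lemma pr_eq0 x t : (forall y, D t y -> dot x y = 0) -> pr D x t = 0.
Proof. by move=> h; apply: (dotxx0 (dot := dot)); rewrite -dot_pr ?h //; apply: pr_in. Qed.

Lemma pr_uniq x t u : D t u -> (forall y, D t y -> dot (x - u) y = 0) -> pr D x t = u.
Proof.
move=> Du h; apply/eqP; rewrite -subr_eq0; apply/eqP; apply: (dotxx0 (dot := dot)).
have Dp : D t (pr D x t - u) by apply: submodB => //; [exact: submod_dec|exact: pr_in].
by rewrite {1}dotDl -(dot_pr _ Dp) dotNl -dotNl -dotDl h.
Qed.

Lemma dec_mem x t : (forall s y, s != t -> D s y -> dot x y = 0) -> D t x.
Proof.
move=> h; rewrite (pr_sum x) (bigD1 t) //= big1 ?addr0; first exact: pr_in.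
by move=> s st; apply: pr_eq0 => y; apply: h.
Qed.

Lemma dec_mem2 x i j : i != j ->
  (forall s y, s != i -> s != j -> D s y -> dot x y = 0) -> x = pr D x i + pr D x j.
Proof.
move=> ij h; rewrite {1}(pr_sum x) (bigD1 i) //= (bigD1 j) /= 1?eq_sym //.
by rewrite big1 ?addr0 // => s /andP[si sj]; apply: pr_eq0 => y; apply: h.
Qed.

Lemma dec_dim t : has_dim (n t) (D t). Proof. by case: hD. Qed.

(** One linear condition cannot exhaust a space of dimension at least 2; this is where [n_gt1]
    enters. *)
Lemma dec_ex t us : (size us <= 1)%N ->
  exists x, [/\ D t x, x != 0 & forall u, u \in us -> dot x u = 0].
Proof.
move=> us1; apply: ex_perp => [|m fm]; first exact: submod_dec.
have := dec_dim t; rewrite /has_dim; case E: (n t) => [p|] hp; last by case: (hp m).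
by rewrite (fdim_uniq fm hp) (leq_ltn_trans us1) // (n_gt1 E).
Qed.

Lemma dec_neq0 t : exists2 x, D t x & x != 0.
Proof. by have [x [? ? _]] := @dec_ex t [::] isT; exists x. Qed.

Lemma dec_ex1 t u : exists x, [/\ D t x, x != 0 & dot x u = 0].
Proof. by have [x [? ? h]] := @dec_ex t [:: u] isT; exists x; split=> //; rewrite h ?mem_head. Qed.

Lemma dec_disj s t x : s != t -> D s x -> D t x -> x = 0.
Proof. by move=> st Dx Dx'; apply: (dotxx0 (dot := dot)); apply: dec_orth Dx Dx'. Qed.

End OneDec.

(** Each space is the orthogonal complement of the others, so one index, typically the infinite one,
    may be left out. *)
Lemma dec_eq j A B : is_decomp A -> is_decomp B -> (forall t, t != j -> A t = B t) -> A = B.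
Proof.
move=> hA hB h; apply: funext => t; have [->|/h //] := eqVneq t j.
apply/seteqP; split=> x hx; apply: dec_mem => // s y sj.
  by rewrite -h // => Ay; rewrite (dec_orth hA _ hx Ay) // eq_sym.
by rewrite h // => Ay; rewrite (dec_orth hB _ hx Ay) // eq_sym.
Qed.

Definition act U D : 'I_k -> set H := fun t => U @` D t.

Lemma act_dec U D : unitary U -> is_decomp D -> is_decomp (act U D).
Proof.
move=> hU hD; have [V [hV UV VU]] := unitary_inv hU; have [UD UZ] := unitaryE hU.
have VUi X : V @` (U @` X) = X.
  apply/seteqP; split=> [_ [_ [x Xx <-] <-]|x Xx]; first by rewrite UV.
  by exists (U x); rewrite ?UV //; exists x.
split.
- by move=> t; exact: (submod_img hU (submod_dec hD t)).
- move=> s t _ _ st [x Dx <-] [y Dy <-]; case: hU => _ _ ->; exact: dec_orth Dx Dy.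
- move=> x; exists (fun t => U (pr D (V x) t)).
    by move=> t; exists (pr D (V x) t) => //; apply: pr_in.
  rewrite -{1}[x]VU {1}(pr_sum hD (V x)).
  by apply: (big_ind2 (fun a b => U a = b)) => [|a _ b _ <- <-|//]; [apply/eqP; rewrite (unitary_eq0 hU)|].
- move=> t; have := dec_dim hD t; rewrite /has_dim; case: (n t) => [m|h m /(img_fdim hV)].
    exact: img_fdim.
  by rewrite VUi; apply: h.
Qed.

Lemma actK U V D : cancel U V -> act V (act U D) = D.
Proof.
move=> UV; apply: funext => t; apply/seteqP; split=> [_ [_ [x Xx <-] <-]|x Xx].
  by rewrite UV.
by exists (U x); rewrite ?UV //; exists x.
Qed.

Section RotAct.
Variables (A : 'I_k -> set H) (i j : 'I_k) (x y : H) (a b : C).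
Hypotheses (hA : is_decomp A) (ij : i != j) (Ax : A i x) (Ay : A j y).
Hypotheses (xx : dot x x = 1) (yy : dot y y = 1) (ab : a * a^* + b * b^* = 1).

Lemma rot_orth : dot x y = 0. Proof. exact: dec_orth Ax Ay. Qed.
Let xy := rot_orth.

Lemma rotA : unitary (rot x y a b). Proof. exact: rot_unitary. Qed.

Lemma rotA_dec : is_decomp (act (rot x y a b) A). Proof. by apply: act_dec => //; exact: rotA. Qed.

Lemma rotA_out t : t != i -> t != j -> act (rot x y a b) A t = A t.
Proof.
move=> ti tj; have e v : A t v -> rot x y a b v = v.
  by move=> Av; apply: rot_fix; [apply: dec_orth Av Ax|apply: dec_orth Av Ay].
apply/seteqP; split=> [_ [v Av <-]|v Av]; first by rewrite e.
by exists v => //; rewrite e.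
Qed.

Lemma rotA_perpi : perp (A i) x `<=` act (rot x y a b) A i.
Proof. by move=> v [Av vx]; exists v => //; rewrite rot_fix //; exact: dec_orth Av Ay. Qed.

Lemma rotA_perpj : perp (A j) y `<=` act (rot x y a b) A j.
Proof.
move=> v [Av vx]; exists v => //; rewrite rot_fix //.
by apply: dec_orth Av Ax => //; rewrite eq_sym.
Qed.

Lemma rotA_x : act (rot x y a b) A i (a *: x + b *: y).
Proof. by exists x => //; rewrite rot_x. Qed.

Lemma rotA_y : act (rot x y a b) A j (- b^* *: x + a^* *: y).
Proof. by exists y => //; rewrite rot_y. Qed.

End RotAct.

(* [B] arises from [A] by turning the plane of [x] and [y]; everything orthogonal to this plane is
   kept in place. The vectors are determined by [A] and [B] up to a scalar. *)
Definition exchange i j A B x y :=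
  [/\ [/\ is_decomp A, is_decomp B, i != j & A <> B],
      [/\ A i x, A j y, x != 0 & y != 0],
      forall t, t != i -> t != j -> B t = A t,
      perp (A i) x `<=` B i & perp (A j) y `<=` B j].

Lemma exchange_sym i j A B x y : exchange i j A B x y -> exchange j i A B y x.
Proof. by move=> [[? ? ? ?] [? ? ? ?] h ? ?]; split=> //; [split=> //; rewrite eq_sym|move=> t tj ti; apply: h]. Qed.

Lemma exchange_scale i j A B x y c d : c != 0 -> d != 0 -> exchange i j A B x y -> exchange i j A B (c *: x) (d *: y).
Proof.
move=> c0 d0 [[hA hB ij nAB] [Ax Ay x0 y0] h hx hy].
by split; rewrite ?perpZ //; split; rewrite ?scaler_eq0 ?negb_or ?c0 ?d0 //; apply: submodZ => //; apply: submod_dec.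
Qed.

Lemma exchange_rot i j A x y a b : is_decomp A -> i != j -> A i x -> A j y -> dot x x = 1 -> dot y y = 1 ->
  a * a^* + b * b^* = 1 -> b != 0 -> exchange i j A (act (rot x y a b) A) x y.
Proof.
move=> hA ij Ax Ay xx yy ab b0.
have x0 : x != 0 by rewrite -(dot_eq0 dot) xx oner_eq0.
have y0 : y != 0 by rewrite -(dot_eq0 dot) yy oner_eq0.
split; [split=> //| |exact: (rotA_out a b hA Ax Ay)|exact: (rotA_perpi a b hA ij Ay)|exact: (rotA_perpj a b hA ij Ax)] => //.
  exact: (rotA_dec hA ij Ax Ay xx yy ab).
move=> e; have := rotA_x a b hA ij Ax Ay xx; rewrite -e => h.
have : A i (b *: y).
  rewrite (_ : b *: y = (a *: x + b *: y) - a *: x); last by rewrite addrC addKr.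
  by apply: submodB => //; [exact: submod_dec|apply: submodZ => //; exact: submod_dec].
move=> /(submodZV (submod_dec hA i) b0) /(dec_disj hA ij)/(_ Ay) /eqP; exact/negP.
Qed.

(** [B i] contains the hyperplane [perp (A i) x] of [A i], and one more vector of it can be chosen
    in the plane of [x] and [y]. Its normalised coordinates are the parameters of the rotation;
    finite dimension turns the inclusions between [B i] and the rotated space into equality. *)
Lemma exchange_half i j A B x y m : exchange i j A B x y -> dot x x = 1 -> dot y y = 1 -> n i = Some m ->
  exists a b : C, [/\ a * a^* + b * b^* = 1, b != 0 & B = act (rot x y a b) A].
Proof.
move=> [[hA hB ij nAB] [Ax Ay x0 y0] h hx hy] xx yy ni.
have fA : fdim m (A i) by have := dec_dim hA i; rewrite ni.
have fB : fdim m (B i) by have := dec_dim hB i; rewrite ni.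
case: m fA fB {ni} => [|m] fA fB; first by move: Ax; rewrite fA => x0'; move: x0; rewrite x0' eqxx.
have fp := fdim_perp fA Ax x0.
(* Vectors of [B i] have components at [i] and [j] only. The part [w] of the [j]-component
   orthogonal to [y] lies in [B j], hence is orthogonal to [v] and vanishes. *)
have key v : B i v -> exists s a b, perp (A i) x s /\ v = s + (a *: x + b *: y).
  move=> Bv; have vE : v = pr A v i + pr A v j.
    apply: dec_mem2 => // t w ti tj; rewrite -h // => Bw; apply: (dec_orth hB _ Bv Bw); by rewrite eq_sym.
  have [s ps si] := perpP dot (submod_dec hA i) Ax x0 (pr_in hA v i).
  have [w pw sj] := perpP dot (submod_dec hA j) Ay y0 (pr_in hA v j).
  have w0 : w = 0.
    apply: (dotxx0 (dot := dot)); have := dec_orth hB ij Bv (hy _ pw).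
    rewrite (dot_pr hA _ (proj1 pw)) sj dotDl dotZl [dot y w](dot_sym0 (proj2 pw)).
    by rewrite mulr0 add0r.
  exists s, (dot (pr A v i) x / dot x x), (dot (pr A v j) y / dot y y); split=> //.
  by rewrite {1}vE {1}si {1}sj w0; apply: (@dot_ext _ _ dot) => z; rewrite /line_proj !dotE; ring.
have [v Bv nv] : exists2 v, B i v & ~ perp (A i) x v.
  apply: contrapT => nex; have : B i = perp (A i) x.
    by apply/seteqP; split=> [v Bv|//]; apply: contrapT => nv; apply: nex; exists v.
  by move=> e; move: fB; rewrite e => /(fdim_uniq fp)/eqP; rewrite eqn_leq ltnn andbF.
have [s [a [b [ps vE]]]] := key _ Bv.
set p := a *: x + b *: y in vE.
have xy := dec_orth hA ij Ax Ay; have yx := dot_sym0 xy.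
have p0 : p != 0 by apply: contra_notN nv => /eqP pp; rewrite vE pp addr0.
have Bp : B i p.
  rewrite (_ : p = v - s); last by rewrite vE addrC addKr.
  by apply: submodB => //; [exact: submod_dec|exact: hx].
have [c c0 hc] := normalize dot p0.
have cpE : c *: p = (c * a) *: x + (c * b) *: y by rewrite scalerDr !scalerA.
have ab : (c * a) * (c * a)^* + (c * b) * (c * b)^* = 1.
  by rewrite -hc cpE !dotE xx yy xy yx !rmorphM; ring.
have np : ~ perp (A i) x p.
  move=> h'; apply: nv; rewrite vE; apply: submodD => //; apply: submod_perp; exact: submod_dec.
have Bi : act (rot x y (c * a) (c * b)) A i = B i.
  have fa : fdim m.+1 (act (rot x y (c * a) (c * b)) A i) by apply: (img_fdim (rotA hA ij Ax Ay xx yy ab)).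
  have e1 := fdim_sub_eq (fdim_add_line fp np).
  rewrite -(e1 _ fB); last by apply: add_line_min => //; exact: submod_dec.
  rewrite -(e1 _ fa) //; apply: add_line_min.
  - apply: submod_dec; exact: (rotA_dec hA ij Ax Ay xx yy ab).
  - exact: (rotA_perpi _ _ hA ij Ay).
  - apply: (submodZV (submod_dec (rotA_dec hA ij Ax Ay xx yy ab) i) c0).
    rewrite cpE; exact: (rotA_x _ _ hA ij Ax Ay xx).
have E : B = act (rot x y (c * a) (c * b)) A.
  apply: (@dec_eq j) => //; first exact: (rotA_dec hA ij Ax Ay xx yy ab).
  by move=> t tj; have [->|ti] := eqVneq t i; rewrite ?Bi // (rotA_out _ _ hA Ax Ay ti tj) h.
exists (c * a), (c * b); split=> //.
apply/negP => /eqP cb0; apply: nAB; apply/esym; apply: (@dec_eq j) => // t tj.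
have [->|ti] := eqVneq t i; last exact: h.
apply: (fdim_sub_eq fB fA) => w Bw.
rewrite E in Bw; case: Bw => w' Aw <-; rewrite /rot cb0 conjC0 !mul0r add0r subr0.
rewrite (dec_orth hA ij Aw Ay) mulr0 subr0 scale0r addr0.
by apply: submodD => //; [exact: submod_dec|apply: submodZ => //; exact: submod_dec].
Qed.

(** One of [i] and [j] is finite-dimensional; [exchange_half] is applied there and [rotC] restores
    the order. *)
Lemma exchangeP i j A B x y : exchange i j A B x y -> dot x x = 1 -> dot y y = 1 ->
  exists a b : C, [/\ a * a^* + b * b^* = 1, b != 0 & B = act (rot x y a b) A].
Proof.
move=> hr xx yy; case: (hr) => [[_ _ ij _] _ _ _ _].
case ni: (n i) => [m|]; first exact: exchange_half hr xx yy ni.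
case nj: (n j) => [m|]; last by rewrite (n_inf ni nj) eqxx in ij.
have [a [b [ab b0 ->]]] := exchange_half (exchange_sym hr) yy xx nj.
exists (a^*), (- b^*); rewrite rotC; split=> //; last by rewrite oppr_eq0 conjC_eq0.
by rewrite rmorphN /= !conjCK mulrNN mulrC [b^* * b]mulrC.
Qed.

Lemma exchange_unit i j A B x y : exchange i j A B x y ->
  exists c d, [/\ c != 0, d != 0, dot (c *: x) (c *: x) = 1 & dot (d *: y) (d *: y) = 1].
Proof.
move=> [_ [_ _ x0 y0] _ _ _]; have [c c0 hc] := normalize dot x0.
by have [d d0 hd] := normalize dot y0; exists c, d.
Qed.

(** * Adjacent decompositions *)

Definition parallel x y := exists2 c : C, c != 0 & y = c *: x.

Lemma parallel_sym x y : parallel x y -> parallel y x.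
Proof. by move=> [c c0 ->]; exists c^-1; rewrite ?invr_neq0 // scalerA mulVf // scale1r. Qed.

Lemma not_parallel x y : x != 0 -> y != 0 -> ~ parallel x y -> y - line_proj dot x y != 0.
Proof.
move=> x0 y0 nxy; apply/negP; rewrite subr_eq0 => /eqP e; apply: nxy.
exists (dot y x / dot x x) => //; apply: contraNneq y0 => c0.
by rewrite e /line_proj c0 scale0r.
Qed.

Lemma perp_not_parallel x y : x != 0 -> y != 0 -> dot x y = 0 -> ~ parallel x y.
Proof.
move=> x0 y0 xy [c c0 e]; move: xy; rewrite e dotZr => /eqP.
by rewrite mulf_eq0 conjC_eq0 (negPf c0) dot_eq0 (negPf x0).
Qed.

Lemma exchange_dec i j A B x y : exchange i j A B x y -> is_decomp A /\ is_decomp B.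
Proof. by case=> [[]]. Qed.

Lemma exchange_space i j A B x y : exchange i j A B x y ->
  exists a b : C, [/\ b != 0 , B i (a *: x + b *: y) & B i = add_line (perp (A i) x) (a *: x + b *: y)].
Proof.
move=> hr; have [c [d [c0 d0 cc dd]]] := exchange_unit hr.
have hr' := exchange_scale c0 d0 hr; have [a [b [ab b0 E]]] := exchangeP hr' cc dd.
case: hr' => [[hA hB ij nAB] [Ax Ay x0 y0] h hx hy].
have e : (a * c) *: x + (b * d) *: y = a *: (c *: x) + b *: (d *: y) by rewrite !scalerA.
exists (a * c), (b * d); rewrite e mulf_eq0 negb_or b0 d0; split=> //.
  by rewrite E; exact: (rotA_x _ _ hA ij Ax Ay cc).
apply/seteqP; split; last first.
  apply: add_line_min; [exact: submod_dec hB i|by rewrite -(perpZ _ _ _ c0)|].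
  by rewrite E; exact: (rotA_x _ _ hA ij Ax Ay cc).
rewrite E => _ [v Av <-]; have [s [As sx] ve] := perpP dot (submod_dec hA i) Ax x0 Av.
exists s, (dot v (c *: x) / dot (c *: x) (c *: x)); split.
  by rewrite -(perpZ _ _ _ c0).
have [UD UZ] := unitaryE (rotA hA ij Ax Ay cc dd ab).
rewrite {1}ve UD /line_proj UZ rot_x ?(dec_orth hA ij Ax Ay) // (rot_fix a b sx (dec_orth hA ij As Ay)).
by rewrite addrC.
Qed.

(** [B i] is the hyperplane [perp (A i) x] plus a vector with nonzero [y]-coordinate, and a multiple
    of the latter leaves [A i] unless it is zero. *)
Lemma exchange_meet i j A B x y v : exchange i j A B x y -> A i v -> B i v -> perp (A i) x v.
Proof.
move=> hr Av; have [a [b [b0 _ ->]]] := exchange_space hr.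
case: hr => [[hA hB ij nAB] [Ax Ay x0 y0] _ _ _] [s [c [[As sx] vE]]].
suff cb : c * b = 0.
  have c0 : c = 0 by apply/eqP; move/eqP: cb; rewrite mulf_eq0 (negPf b0) orbF.
  by rewrite vE c0 scale0r addr0.
have : A i ((c * b) *: y).
  rewrite (_ : _ *: y = v - s - (c * a) *: x).
    have lA := submod_dec hA i; by apply: (submodB lA); [exact: (submodB lA)|exact: (submodZ _ lA)].
  by rewrite vE; apply: (@dot_ext _ _ dot) => z; rewrite !dotE; ring.
move=> h; apply/eqP; apply: contraT => cb; move: y0.
by rewrite (dec_disj hA ij (submodZV (submod_dec hA i) cb h) Ay) eqxx.
Qed.

Lemma exchange_neqi i j A B x y : exchange i j A B x y -> A i <> B i.
Proof.
move=> hr e; case: (hr) => [_ [Ax _ x0 _] _ _ _].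
have := exchange_meet hr Ax; rewrite -e => /(_ Ax)[_ /eqP].
by rewrite dot_eq0 (negPf x0).
Qed.

Lemma exchange_neqj i j A B x y : exchange i j A B x y -> A j <> B j.
Proof. by move/exchange_sym/exchange_neqi. Qed.

Lemma exchange_type i j A B x y t : exchange i j A B x y -> A t <> B t <-> t = i \/ t = j.
Proof.
move=> hr; split=> [ne|[]->]; [|exact: exchange_neqi hr|exact: exchange_neqj hr].
have [->|ti] := eqVneq t i; first by left.
have [->|tj] := eqVneq t j; first by right.
by case: ne; case: hr => _ _ h _ _; rewrite h.
Qed.

Lemma exchange_out i j A B x y t : exchange i j A B x y -> t != i -> t != j -> B t = A t.
Proof. by case=> _ _ h _ _; apply: h. Qed.

Lemma exchange_neq i j A B x y : exchange i j A B x y -> i != j.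
Proof. by case=> [[]]. Qed.

(** By [exchange_meet], [x] spans the orthogonal complement of the intersection of [A i] and [B i]
    within [A i]. *)
Lemma exchange_uniq i j A B x y x' y' : exchange i j A B x y -> exchange i j A B x' y' -> parallel x x'.
Proof.
move=> h [_ [Ax' _ x'0 _] _ hx _]; case: (h) => [_ [Ax _ x0 _] _ _ _].
have [hA _] := exchange_dec h; have [s ps e] := perpP dot (submod_dec hA i) Ax' x'0 Ax.
have := exchange_meet h (proj1 ps) (hx _ ps) => -[_ sx].
have s0 : s = 0.
  apply: (dotxx0 (dot := dot)); move: sx; rewrite {1}e dotDr dotZr (proj2 ps) mulr0 add0r //.
apply: parallel_sym; exists (dot x x' / dot x' x'); last by rewrite {1}e s0 addr0.
by apply: contraNneq x0 => c0; rewrite e s0 addr0 /line_proj c0 scale0r.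
Qed.

(** The way back turns the images of [x] and [y] under the rotation. The equality of hyperplanes is
    what identifies the star at [B] with the star at [A]. *)
Lemma exchange_back i j A B x y : exchange i j A B x y ->
  exists x' y', exchange i j B A x' y' /\ perp (B i) x' = perp (A i) x.
Proof.
move=> hr; have [c [d [c0 d0 cc dd]]] := exchange_unit hr.
have hr' := exchange_scale c0 d0 hr; have [a [b [ab b0 E]]] := exchangeP hr' cc dd.
case: hr' => [[hA hB ij nAB] [Ax Ay x0 y0] h hx hy].
have hU := rotA hA ij Ax Ay cc dd ab.
have p1 : perp (B i) (rot (c *: x) (d *: y) a b (c *: x)) = perp (A i) x.
  rewrite -(perpZ dot (A i) x c0)  E /act -(img_perp hU); apply/seteqP; split=> [_ [v [Av vx] <-]|v [Av vx]].
    by rewrite rot_fix // (dec_orth hA ij Av Ay).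
  by exists v => //; rewrite rot_fix // (dec_orth hA ij Av Ay).
have p2 : perp (B j) (rot (c *: x) (d *: y) a b (d *: y)) = perp (A j) (d *: y).
  have ji : j != i by rewrite eq_sym.
  rewrite  E /act -(img_perp hU); apply/seteqP; split=> [_ [v [Av vx] <-]|v [Av vx]].
    by rewrite rot_fix // (dec_orth hA ji Av Ax).
  by exists v => //; rewrite rot_fix // (dec_orth hA ji Av Ax).
exists (rot (c *: x) (d *: y) a b (c *: x)), (rot (c *: x) (d *: y) a b (d *: y)).
split=> //; split.
- by split=> // /esym.
- by rewrite !(unitary_eq0 hU) x0 y0; split=> //; rewrite E; [exists (c *: x)|exists (d *: y)].
- by move=> t ti tj; rewrite h.
- by rewrite p1; exact: perp_sub.
- by rewrite p2; exact: perp_sub.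
Qed.

Definition adj A B := exists i j x y, exchange i j A B x y.

Lemma adj_sym A B : adj A B -> adj B A.
Proof. by move=> [i [j [x [y /exchange_back[x' [y' [hr _]]]]]]]; exists i, j, x', y'. Qed.

Lemma adj_dec A B : adj A B -> is_decomp A /\ is_decomp B.
Proof. by move=> [i [j [x [y /exchange_dec]]]]. Qed.

Lemma exchange_act U i j A B x y : unitary U -> exchange i j A B x y ->
  exchange i j (act U A) (act U B) (U x) (U y).
Proof.
move=> hU [[hA hB ij nAB] [Ax Ay x0 y0] h hx hy]; have [V [_ UV _]] := unitary_inv hU.
split; rewrite /act -?(img_perp hU).
- split=> //; [exact: act_dec|exact: act_dec|].
  by move=> e; apply: nAB; rewrite -(actK A UV) -(actK B UV) /act; apply: funext => t; rewrite (congr1 (fun f => f t) e).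
- by rewrite !(unitary_eq0 hU) x0 y0; split.
- by move=> t ti tj; rewrite h.
- by move=> _ [v /hx Bv <-]; exists v.
- by move=> _ [v /hy Bv <-]; exists v.
Qed.

Lemma adj_act U A B : unitary U -> adj A B -> adj (act U A) (act U B).
Proof. by move=> hU [i [j [x [y /(exchange_act hU) h]]]]; exists i, j, (U x), (U y). Qed.

(** [B i] and [D i] share the hyperplane [perp (A i) x], and [D i] adds one vector [v] to it.
    Relative to [B], this [v] is a multiple of [x'] plus a vector [w] of [B j], which is the other
    vector of the exchange. *)
Lemma star_adj i j A B D x y z x' : exchange i j A B x y -> exchange i j A D x z -> B <> D ->
  B i x' -> x' != 0 -> perp (B i) x' = perp (A i) x -> exists w, exchange i j B D x' w.
Proof.
move=> hB hD nBD Bx' x'0 pE; have [a [b [b0 Dv Di]]] := exchange_space hD.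
have [[[_ dB ij _] _ hBt _ _] [[dA dD _ _] _ hDt hDi _]] := (hB, hD).
set v := a *: x + b *: z in Dv Di.
have px : dot v x' = dot (pr B v i) x' by exact: (dot_pr dB).
have vE : v = pr B v i + pr B v j.
  apply: (dec_mem2 dB ij) => t w ti tj; rewrite hBt // -(hDt _ ti tj) => Dw.
  by apply: (dec_orth dD _ Dv Dw); rewrite eq_sym.
have vp s : perp (A i) x s -> dot v s = 0.
  move=> [As sx]; rewrite dotDl !dotZl (dot_sym0 sx) mulr0 add0r.
  by case: hD => [_ [_ Az _ _] _ _ _]; rewrite (dot_sym0 (dec_orth dA ij As Az)) mulr0.
have [s ps vi] := perpP dot (submod_dec dB i) Bx' x'0 (pr_in dB v i).
have s0 : s = 0.
  apply: (dotxx0 (dot := dot)); have := ps; rewrite pE => /vp.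
  rewrite (dot_pr dB _ (proj1 ps)) {1}vi dotDl dotZl.
  by rewrite [dot x' s](dot_sym0 (proj2 ps)) mulr0 add0r.
rewrite s0 addr0 in vi; set w := pr B v j in vE.
have Bw : B j w by exact: (pr_in dB).
(* Otherwise [v] is a multiple of [x'], so that [D i = B i] and then [D = B]. *)
have w0 : w != 0.
  apply: contra_notN nBD => /eqP w0; rewrite w0 addr0 vi in vE.
  apply: (dec_eq (j := j) dB dD) => t tj; have [->|ti] := eqVneq t i; last by rewrite (hBt _ ti tj) (hDt _ ti tj).
  have c0 : dot (pr B v i) x' / dot x' x' != 0.
    apply: contraTneq b0 => c0; have := congr1 (fun u => dot u z) vE.
    case: (hD) => [_ [Ax Az _ z0] _ _ _].
    rewrite /line_proj c0 scale0r dot0l /v dotDl !dotZl (dec_orth dA ij Ax Az) mulr0 add0r => /eqP.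
    by rewrite mulf_eq0 dot_eq0 (negPf z0) orbF => /eqP ->; rewrite eqxx.
  have Bv : B i v by rewrite vE; exact: (submodZ _ (submod_dec dB i)).
  apply/seteqP; split.
    move=> u /(perpP dot (submod_dec dB i) Bx' x'0)[r pr ->].
    apply: (submodD (submod_dec dD i)); [apply: (submodZ _ (submod_dec dD i))|by apply: hDi; rewrite -pE].
    by apply: (submodZV (submod_dec dD i) c0); rewrite -[_ *: x']/(line_proj dot x' _) -vE.
  rewrite Di; apply: (add_line_min (submod_dec dB i)) => //.
  by rewrite -pE; exact: perp_sub.
exists w; split=> //; first by move=> t ti tj; rewrite hBt // hDt.
  by rewrite pE.
move=> u [Bu uw]; apply: (dec_mem dD) => t r tj; have [->|ti] := eqVneq t i.
  rewrite Di => -[s' [c [ps' ->]]]; rewrite -pE in ps'.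
  have ji : j != i by rewrite eq_sym.
  rewrite dotDr (dec_orth dB ji Bu (proj1 ps')) add0r dotZr vE dotDr uw addr0.
  by rewrite (dec_orth dB ji Bu (pr_in dB v i)) mulr0.
rewrite hDt // -hBt // => Br; by apply: (dec_orth dB _ Bu Br); rewrite eq_sym.
Qed.

Lemma exchange_adj i j A B D x y z : exchange i j A B x y -> exchange i j A D x z -> B <> D -> adj B D.
Proof.
move=> hB hD nBD; have [x' [y' [h e]]] := exchange_back hB.
case: (h) => [_ [Bx' _ x'0 _] _ _ _].
by have [w hw] := star_adj hB hD nBD Bx' x'0 e; exists i, j, x', w.
Qed.

Lemma exchange_of_type i j p q A B x y : exchange p q A B x y ->
  (forall t, A t <> B t -> t = i \/ t = j) -> i != j -> exists x' y', exchange i j A B x' y'.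
Proof.
move=> hr h ij; have pq := exchange_neq hr.
case: (h _ (exchange_neqi hr)) (h _ (exchange_neqj hr)) => pE [] qE; rewrite pE qE in hr pq.
- by rewrite eqxx in pq.
- by exists x, y.
- by exists y, x; apply: exchange_sym.
- by rewrite eqxx in pq.
Qed.

Lemma adj_type B D r s t : adj B D -> r != s -> r != t -> s != t ->
  B r <> D r -> B s <> D s -> B t = D t.
Proof.
move=> [i [j [x [y hr]]]] rs rt st /(exchange_type _ hr) r' /(exchange_type _ hr) s'.
apply: contrapT => /(exchange_type _ hr) t'; move: r' s' t' rs rt st.
by move=> [] -> [] -> [] ->; rewrite ?eqxx.
Qed.

(** [B i] contains a vector with nonzero component in [A j], whereas [D i] lies in [A i + A p]. *)
Lemma exchange_common i j p A B D x y z w : exchange i j A B x y -> exchange i p A D z w -> p != j -> B i <> D i.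
Proof.
move=> hB hD pj e; have [a [b [b0 Bv _]]] := exchange_space hB.
have [a' [b' [_ _ Di]]] := exchange_space hD.
case: hB hD => [[dA _ ij _] [Ax Ay x0 y0] _ _ _] [[_ _ ip _] [Az Aw _ _] _ _ _].
rewrite e Di in Bv; case: Bv => s [c [[As _] /(congr1 (fun v => dot v y))]].
rewrite !dotE (dec_orth dA ij Ax Ay) (dec_orth dA ij As Ay) (dec_orth dA ij Az Ay) (dec_orth dA pj Aw Ay).
move/eqP; rewrite !mulr0 !add0r mulr0 mulf_eq0 dot_eq0.
by rewrite (negPf b0) (negPf y0).
Qed.

(** If [D] changed an index [p] outside [i] and [j], then [B] and [D] would differ at the three
    indices [p], [i], [j], one more than adjacency allows. *)
Lemma exchange_same_type i j p q A B D x y z w : exchange i j A B x y -> exchange p q A D z w ->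
  adj B D -> exists z' w', exchange i j A D z' w'.
Proof.
move=> hB hD hBD; apply: (exchange_of_type hD) => [t|]; last exact: exchange_neq hB.
wlog tp : p q z w hD / t = p.
  move=> h At; case/(exchange_type _ hD): (At) => tE; first exact: (h _ _ _ _ hD tE At).
  exact: (h _ _ _ _ (exchange_sym hD) tE At).
subst t => ADp; apply: contrapT => /not_orP[/eqP pi /eqP pj].
have BDp : B p <> D p by rewrite (exchange_out hB pi pj).
wlog qi : i j x y hB pi pj / q != j.
  move=> h; have [qj|qj] := eqVneq q j; last exact: (h _ _ _ _ hB pi pj qj).
  by apply: (h _ _ _ _ (exchange_sym hB) pj pi); rewrite qj eq_sym (exchange_neq hB).
have BDj : B j <> D j.
  rewrite (exchange_out hD (t := j)) 1?eq_sym // => /esym; exact: (exchange_neqj hB).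
have [qE|ni] := eqVneq q i.
  subst q; apply: (exchange_common hB (exchange_sym hD) pj).
  by apply: (adj_type hBD _ _ _ BDp BDj) => //; rewrite eq_sym (exchange_neq hB).
apply: (exchange_neqi hB); rewrite -(exchange_out hD (t := i)) 1?eq_sym //.
by apply/esym; apply: (adj_type hBD _ _ _ BDp BDj); rewrite // eq_sym (exchange_neq hB).
Qed.

(** The vectors of [B i] orthogonal to [u] lie in [D i]. If [x] and [z] are not parallel, a
    combination of [a x + b y] and of the part [s] of [z] orthogonal to [x] provides such a vector
    whose component in [A j] is a nonzero multiple of [y]; in [D i] such components are multiples of
    [w]. *)
Lemma adj_parallel i j A B D x y z w : exchange i j A B x y -> exchange i j A D z w -> adj B D ->
  parallel x z \/ parallel y w.
Proof.
move=> hB hD hBD; have [a [b [b0 Bv _]]] := exchange_space hB.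
have [a' [b' [b'0 _ Di]]] := exchange_space hD.
have ij := exchange_neq hB.
have [u [u' hu]] : exists u u', exchange i j B D u u'.
  case: hBD => p [q [u [u' hu]]]; apply: (exchange_of_type hu) => // t ne.
  apply: contrapT => /not_orP[/eqP ti /eqP tj].
  by apply: ne; rewrite (exchange_out hB ti tj) (exchange_out hD ti tj).
case: (hB) (hD) (hu) => [[dA dB _ _] [Ax Ay x0 y0] _ hxB _] [[_ dD _ _] [Az Aw z0 w0] _ _ _] [_ [Bu _ u0 _] _ huD _].
(* Comparing the components in [A j] of the two descriptions of a vector of [D i]. *)
have fact v0 e : e != 0 -> A i v0 -> D i (v0 + e *: y) -> parallel y w.
  move=> e0 Av0; rewrite Di => -[s [c [[As _] E]]].
  have E' : e *: y = (c * b') *: w.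
    apply/eqP; rewrite -subr_eq0; apply/eqP; apply: (dec_disj dA ij); last first.
      by apply: (submodB (submod_dec dA j)); apply: (submodZ _ (submod_dec dA j)).
    rewrite (_ : _ - _ = s + (c * a') *: z - v0).
      apply: (submodB (submod_dec dA i)) => //; apply: (submodD (submod_dec dA i)) => //.
      exact: (submodZ _ (submod_dec dA i)).
    by apply: (addrI v0); rewrite addrA E; apply: (@dot_ext _ _ dot) => t; rewrite !dotE; ring.
  exists (e / (c * b')).
    rewrite mulf_neq0 // invr_neq0 //; apply/negP => /eqP cb0; move: E'.
    by rewrite cb0 scale0r => /eqP; rewrite scaler_eq0 (negPf e0) (negPf y0).
  have cb : c * b' != 0.
    apply/negP => /eqP cb0; move: E'.
    by rewrite cb0 scale0r => /eqP; rewrite scaler_eq0 (negPf e0) (negPf y0).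
  by rewrite mulrC -scalerA E' scalerA mulVf // scale1r.
have [/eqP gu|gu] := boolP (dot (a *: x + b *: y) u == 0).
  right; apply: (fact (a *: x) b) => //; first exact: (submodZ _ (submod_dec dA i)).
  exact: huD.
have [pxz|npx] := pselect (parallel x z); first by left.
right; set s := z - line_proj dot x z.
have sx : perp (A i) x s.
  split; last exact: line_proj_perp.
  by apply: (submodB (submod_dec dA i)) => //; apply: (submodZ _ (submod_dec dA i)).
(* The coefficients cancel the inner product with [u]. If [s] itself is orthogonal to [u], then [s]
   lies in both [A i] and [D i], hence is orthogonal to [z], which forces [s = 0]. *)
have Ds : D i (dot (a *: x + b *: y) u *: s - dot s u *: (a *: x + b *: y)).
  apply: huD; split.
    apply: (submodB (submod_dec dB i)); apply: (submodZ _ (submod_dec dB i)) => //; exact: hxB.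
  by set v := a *: x + b *: y; rewrite dotDl dotNl !dotZl mulrC subrr.
have [su|su] := eqVneq (dot s u) 0; last first.
  apply: (fact (dot (a *: x + b *: y) u *: s - (dot s u * a) *: x) (- (dot s u * b))).
  - by rewrite oppr_eq0 mulf_neq0.
  - apply: (submodB (submod_dec dA i)); apply: (submodZ _ (submod_dec dA i)) => //; exact: proj1 sx.
  - move: Ds; set e := dot (_ + _) u; set e' := dot s u; congr (D i _).
    by apply: (@dot_ext _ _ dot) => t; rewrite !dotE; ring.
rewrite su scale0r subr0 in Ds; have := submodZV (submod_dec dD i) gu Ds.
move=> /(exchange_meet hD (proj1 sx)) [_ sz].
case/negP: (not_parallel x0 z0 npx); rewrite -/s; apply/eqP; apply: (dotxx0 (dot := dot)).
by rewrite {2}/s dotDr sz add0r dotNr dotZr (proj2 sx) mulr0 oppr0.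
Qed.

Definition adj_eq B D := B = D \/ adj B D.

Definition star A i j x : set ('I_k -> set H) := [set B | B = A \/ exists y, exchange i j A B x y].

(** The additional clauses, that every vector of [A i] or [A j] is the component of a vector of the
    rotated space, hold because the rotation is not a quarter turn; [no_square] depends on them. *)
Lemma ex_exchange i j A x y : is_decomp A -> i != j -> A i x -> A j y -> x != 0 -> y != 0 ->
  exists2 B, exchange i j A B x y &
    (forall u, A i u -> exists2 v, B i v & A j (v - u)) /\
    (forall u, A j u -> exists2 v, B j v & A i (v - u)).
Proof.
move=> dA ij Ax Ay x0 y0; have [c c0 cc] := normalize dot x0; have [d d0 dd] := normalize dot y0.
have lA t := submod_dec dA t.
have Acx := submodZ c (lA i) Ax; have Ady := submodZ d (lA j) Ay.
have n5 : 5%:R != 0 :> C by rewrite pnatr_eq0.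
(* A rational point of the unit circle with both coordinates nonzero: [b] moves [A], and [a] can be
   divided by. *)
pose a : C := 3%:R / 5%:R; pose b : C := 4%:R / 5%:R.
have aR : a^* = a by rewrite fmorph_div !rmorph_nat.
have bR : b^* = b by rewrite fmorph_div !rmorph_nat.
have a0 : a != 0 by rewrite mulf_neq0 ?invr_neq0 // pnatr_eq0.
have b0 : b != 0 by rewrite mulf_neq0 ?invr_neq0 // pnatr_eq0.
have ab : a * a^* + b * b^* = 1 by rewrite aR bR /a /b; field.
exists (act (rot (c *: x) (d *: y) a b) A).
  have := exchange_scale (invr_neq0 c0) (invr_neq0 d0) (exchange_rot dA ij Acx Ady cc dd ab b0).
  by rewrite !scalerA !mulVf // !scale1r.
have cx0 : c *: x != 0 by rewrite scaler_eq0 negb_or c0.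
have dy0 : d *: y != 0 by rewrite scaler_eq0 negb_or d0.
have dB := rotA_dec dA ij Acx Ady cc dd ab.
split=> u Au.
  have [s ps uE] := perpP dot (lA i) Acx cx0 Au.
  set e := dot u (c *: x) / dot (c *: x) (c *: x).
  exists (s + (e / a) *: (a *: (c *: x) + b *: (d *: y))).
    apply: (submodD (submod_dec dB i)); first exact: (rotA_perpi a b dA ij Ady).
    exact: (submodZ _ (submod_dec dB i) (rotA_x a b dA ij Acx Ady cc)).
  rewrite (_ : _ - u = (e / a * b) *: (d *: y)); first exact: (submodZ _ (lA j)).
  rewrite {1}uE /line_proj -/e; apply: (@dot_ext _ _ dot) => t; rewrite !dotE.
  by field.
have [s ps uE] := perpP dot (lA j) Ady dy0 Au.
set e := dot u (d *: y) / dot (d *: y) (d *: y).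
exists (s + (e / a) *: (- b^* *: (c *: x) + a^* *: (d *: y))).
  apply: (submodD (submod_dec dB j)); first exact: (rotA_perpj a b dA ij Acx).
  exact: (submodZ _ (submod_dec dB j) (rotA_y a b dA ij Acx Ady dd)).
rewrite (_ : _ - u = (- (e / a) * b) *: (c *: x)); first exact: (submodZ _ (lA i)).
rewrite {1}uE /line_proj -/e aR bR; apply: (@dot_ext _ _ dot) => t; rewrite !dotE.
by field.
Qed.

(** * Cliques and squares *)

Lemma exchange_parallel i j A B x u v : exchange i j A B u v -> parallel x u -> exchange i j A B x v.
Proof.
move=> h /parallel_sym[c c0 ->]; rewrite -[v]scale1r; apply: exchange_scale => //; exact: oner_neq0.
Qed.

Lemma star_adj_eq i j A x B D : star A i j x B -> star A i j x D -> adj_eq B D.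
Proof.
move=> [->|[y hB]] [->|[z hD]]; first by left.
- by right; exists i, j, x, z.
- by right; apply: (adj_sym); exists i, j, x, y.
- have [->|ne] := pselect (B = D); first by left.
  by right; apply: (exchange_adj hB hD).
Qed.

Lemma star_parallel A i j x x' : parallel x x' -> star A i j x = star A i j x'.
Proof.
move=> hx; apply/seteqP; split=> D [->|[y h]]; try by left.
  by right; exists y; apply: exchange_parallel h (parallel_sym hx).
by right; exists y; apply: exchange_parallel h hx.
Qed.

(** Any member of a star can serve as its base point. *)
Lemma star_move i j A B x y : exchange i j A B x y ->
  exists x', [/\ B i x', x' != 0 & star B i j x' = star A i j x].
Proof.
move=> hB; have [x' [y' [h e]]] := exchange_back hB.
case: (h) => [_ [Bx' _ x'0 _] _ _ _]; case: (hB) => [_ [Ax _ x0 _] _ _ _].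
exists x'; split=> //; apply/seteqP; split=> D [->|[z hD]].
- by right; exists y.
- have [->|ne] := pselect (A = D); first by left.
  by have [w hw] := star_adj h hD ne Ax x0 (esym e); right; exists w.
- by right; exists y'.
- have [->|ne] := pselect (B = D); first by left.
  by have [w hw] := star_adj hB hD ne Bx' x'0 e; right; exists w.
Qed.

Definition common_nbhd A B D : set ('I_k -> set H) := [set E | [/\ is_decomp E, adj_eq E A, adj_eq E B & adj_eq E D]].

(** A common neighbour shares the line of [x] or of [y] with [B], and that of [x] or of [z] with
    [D]. Avoiding [x] both times would make [y] and [z] parallel. *)
Lemma common_nbhd_star i j A B D x y z : exchange i j A B x y -> exchange i j A D x z -> ~ parallel y z ->
  common_nbhd A B D = star A i j x.
Proof.
move=> hB hD nyz; apply/seteqP; split=> E.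
  move=> [dE]; case=> [->|hA]; first by left.
  case=> [->|hEB]; first by right; exists y.
  case=> [->|hED]; first by right; exists z.
  case: (adj_sym hA) => p [q [u [v hE]]].
  have [u' [v' hE']] := exchange_same_type hB hE (adj_sym hEB).
  case: (adj_parallel hB hE' (adj_sym hEB)) => [h|h1]; first by right; exists v'; apply: exchange_parallel hE' h.
  case: (adj_parallel hD hE' (adj_sym hED)) => [h|h2]; first by right; exists v'; apply: exchange_parallel hE' h.
  by case: nyz; case: h1 => c c0 E1; case: h2 => c' c'0 E2; exists (c'^-1 * c);
    rewrite ?mulf_neq0 ?invr_neq0 // -scalerA -E1 E2 scalerA mulVf // scale1r.
move=> hE; have [dA dB] := exchange_dec hB.
have A1 : star A i j x A by left.
have B1 : star A i j x B by right; exists y.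
have D1 : star A i j x D by right; exists z.
split; [|exact: star_adj_eq hE A1|exact: star_adj_eq hE B1|exact: star_adj_eq hE D1].
by case: hE => [->//|[w /exchange_dec[]]].
Qed.

Lemma ex_star i j A x : is_decomp A -> i != j -> A i x -> x != 0 ->
  exists B D y z, [/\ exchange i j A B x y, exchange i j A D x z & ~ parallel y z].
Proof.
move=> dA ij Ax x0; have [y Ay y0] := dec_neq0 dA j.
have [z [Az z0 zy]] := dec_ex1 dA j y.
have [B hB _] := ex_exchange dA ij Ax Ay x0 y0; have [D hD _] := ex_exchange dA ij Ax Az x0 z0.
exists B, D, y, z; split=> //; exact: perp_not_parallel y0 z0 (dot_sym0 zy).
Qed.

(** Expressed through vertices and adjacency, so that isomorphisms preserve it; [star_clique] and
    [clique_star] show that these sets are exactly the stars. *)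
Definition clique Q := exists A B D,
  [/\ adj A B, adj A D, adj B D, Q = common_nbhd A B D & forall E E', Q E -> Q E' -> adj_eq E E'].

Lemma star_clique i j A x : is_decomp A -> i != j -> A i x -> x != 0 -> clique (star A i j x).
Proof.
move=> dA ij Ax x0; have [B [D [y [z [hB hD nyz]]]]] := ex_star dA ij Ax x0.
exists A, B, D; split.
- by exists i, j, x, y.
- by exists i, j, x, z.
- apply: (exchange_adj hB hD) => e; subst D; apply: nyz.
  by apply: (exchange_uniq (exchange_sym hB) (exchange_sym hD)).
- by rewrite (common_nbhd_star hB hD nyz).
- by move=> E E'; apply: star_adj_eq.
Qed.

(** The exchanges to [B] and [D] share the first or the second line. If they share exactly one,
    [common_nbhd_star] applies, possibly with [i] and [j] swapped. *)
Lemma clique_star0 A B D : adj A B -> adj A D -> adj B D ->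
  (forall E E', common_nbhd A B D E -> common_nbhd A B D E' -> adj_eq E E') ->
  exists i j x, [/\ i != j, A i x, x != 0 & common_nbhd A B D = star A i j x].
Proof.
move=> [i [j [x [y hB]]]] [p [q [u [v hD']]]] hBD hcl.
have [z [w hD]] := exchange_same_type hB hD' hBD.
have ij := exchange_neq hB; have [dA dB] := exchange_dec hB; have [_ dD] := exchange_dec hD.
case: (hB) => [_ [Ax Ay x0 y0] _ _ _]; case: (hD) => [_ [Az Aw z0 w0] _ _ _].
have [xz|nxz] := pselect (parallel x z); last first.
  case: (adj_parallel hB hD hBD) => // yw.
  exists j, i, y; split=> //; first by rewrite eq_sym.
  by apply: (common_nbhd_star (exchange_sym hB) (exchange_parallel (exchange_sym hD) yw)).
have hDx := exchange_parallel hD xz.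
have [yw|nyw] := pselect (parallel y w); last first.
  by exists i, j, x; split=> //; apply: common_nbhd_star nyw.
have hDxy := exchange_sym (exchange_parallel (exchange_sym hDx) yw).
(* [A], [B] and [D] are collinear: their common neighbourhood is not a clique *)
have [y2 [Ay2 y20 yy2]] := dec_ex1 dA j y; have [x2 [Ax2 x20 xx2]] := dec_ex1 dA i x.
have [E hE _] := ex_exchange dA ij Ax Ay2 x0 y20; have [E' hE' _] := ex_exchange dA ij Ax2 Ay x20 y0.
have nx := perp_not_parallel x20 x0 xx2; have ny := perp_not_parallel y20 y0 yy2.
have cE : common_nbhd A B D E.
  by split; [exact: (proj2 (exchange_dec hE))| | |]; apply: (@star_adj_eq i j A x);
    [right; exists y2|left|right; exists y2|right; exists y|right; exists y2|right; exists y].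
have cE' : common_nbhd A B D E'.
  by split; [exact: (proj2 (exchange_dec hE'))| | |]; apply: (@star_adj_eq j i A y);
    [right; exists x2|by left|right; exists x2|right; exists x|right; exists x2|right; exists x]; apply: exchange_sym.
case: (hcl _ _ cE cE') => [e|/(adj_parallel hE hE')[/parallel_sym|]] //.
by subst E'; case: nx; exact: (exchange_uniq hE' hE).
Qed.

Lemma clique_star Q A : clique Q -> is_decomp A -> Q A ->
  exists i j x, [/\ i != j, A i x, x != 0 & Q = star A i j x].
Proof.
move=> [A' [B [D [h1 h2 h3 -> hcl]]]] dA; have [i [j [x [ij Ax x0 ->]]]] := clique_star0 h1 h2 h3 hcl.
move=> [->|[y /star_move[x' [Bx' x'0 <-]]]]; first by exists i, j, x.
by exists i, j, x'.
Qed.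

Lemma star_cap i j p q A B x u : star A i j x B -> star A p q u B -> B <> A ->
  [/\ i = p, j = q & parallel x u] \/ (i = q /\ j = p).
Proof.
move=> [->//|[y h]] [->//|[v h']] _; have ij := exchange_neq h.
have pq := exchange_neq h'.
have /(exchange_type _ h) pE := exchange_neqi h'.
have /(exchange_type _ h) qE := exchange_neqj h'.
case: pE qE => [pE|pE] [qE|qE]; rewrite pE qE ?eqxx in pq h' *; try done.
  left; split=> //; exact: (exchange_uniq h h').
by right.
Qed.

(** The type could only be reversed, but then all members would turn one line of [A j], while the
    star contains rotations towards the non-parallel [y] and [z]. *)
Lemma star_inj i j p q A x u : is_decomp A -> i != j -> A i x -> x != 0 ->
  star A i j x = star A p q u -> [/\ i = p, j = q & parallel x u].
Proof.
move=> dA ij Ax x0 E; have [B [D [y [z [hB hD nyz]]]]] := ex_star dA ij Ax x0.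
have SB : star A p q u B by rewrite -E; right; exists y.
have SD : star A p q u D by rewrite -E; right; exists z.
have nBA : B <> A by case: hB => [[_ _ _ h] _ _ _ _] /esym.
have nDA : D <> A by case: hD => [[_ _ _ h] _ _ _ _] /esym.
have SB' : star A i j x B by right; exists y.
case: (star_cap SB' SB nBA) => // -[iq jp]; subst p q; case: nyz.
case: SB => // -[v h1]; case: SD => // -[v' h2].
have h3 := exchange_uniq (exchange_sym hB) h1; have h4 := exchange_uniq (exchange_sym hD) h2.
case: h3 => c c0 E1; case: (parallel_sym h4) => c' c'0 ->.
by exists (c' * c); rewrite ?mulf_neq0 // E1 scalerA.
Qed.

Lemma star_meet i j A x y : is_decomp A -> i != j -> A i x -> A j y -> x != 0 -> y != 0 ->
  exists B, [/\ B <> A, star A i j x B & star A j i y B].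
Proof.
move=> dA ij Ax Ay x0 y0; have [B hB _] := ex_exchange dA ij Ax Ay x0 y0.
exists B; split; [|by right; exists y|by right; exists x; apply: exchange_sym].
by case: hB => [[_ _ _ h] _ _ _ _] /esym.
Qed.

Definition has_square A B D := exists E, [/\ is_decomp E, E <> A, adj B E & adj D E].

(** The rotation taking [A] to [B] is applied to [D], which still has [x] and [y] in the same
    spaces. It leaves [D q] alone, so the fourth corner differs from [A] at [q]. *)
Lemma has_square_exchange i j p q A B D x y z w : exchange i j A B x y -> exchange p q A D z w ->
  D i x -> D j y -> q != i -> q != j -> has_square A B D.
Proof.
move=> hB hD Dx Dy qi qj; have [c [d [c0 d0 cc dd]]] := exchange_unit hB.
have hB' := exchange_scale c0 d0 hB; have [a [b [ab b0 E]]] := exchangeP hB' cc dd.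
case: hB' => [[dA dB ij _] [Ax Ay x0 y0] _ _ _].
have [_ dD] := exchange_dec hD.
have Dcx := submodZ c (submod_dec dD i) Dx; have Ddy := submodZ d (submod_dec dD j) Dy.
have hU := rotA dA ij Ax Ay cc dd ab.
exists (act (rot (c *: x) (d *: y) a b) D); split; first exact: act_dec.
- move=> e; have := rotA_out a b dD Dcx Ddy qi qj; rewrite e.
  exact: (exchange_neqj hD).
- by rewrite E; apply: adj_act => //; exists p, q, z, w.
- by exists i, j, (c *: x), (d *: y); apply: exchange_rot.
Qed.

Lemma has_square_perp i j l A B D x y z w : exchange i j A B x y -> exchange i l A D z w -> j != l ->
  dot x z = 0 -> has_square A B D.
Proof.
move=> hB hD jl xz; case: (hB) => [[_ _ ij _] [Ax Ay x0 y0] _ _ _].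
case: (hD) => [[_ _ il _] _ h hz _]; apply: (has_square_exchange hB hD).
- by apply: hz.
- by rewrite h // eq_sym.
- by rewrite eq_sym.
- by rewrite eq_sym.
Qed.

Lemma has_square_disj i j p q A B D x y z w : exchange i j A B x y -> exchange p q A D z w ->
  p != i -> p != j -> q != i -> q != j -> has_square A B D.
Proof.
move=> hB hD pi pj qi qj; case: (hB) => [[_ _ ij _] [Ax Ay x0 y0] _ _ _].
apply: (has_square_exchange hB hD) => //.
  by rewrite (exchange_out hD) // eq_sym.
by rewrite (exchange_out hD) // eq_sym.
Qed.

(** [B] and [D] differ at [p], [j] and [l], but each of them differs from a fourth corner [E] at two
    indices only. So each shares one of these three spaces with [E], and the two shared spaces must
    be compatible inside [E]. *)
Lemma no_square p j l A B D x y z w : exchange p j A B x y -> exchange p l A D z w -> j != l -> dot x z != 0 ->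
  (forall u, A p u -> exists2 v, B p v & A j (v - u)) ->
  (forall u, A p u -> exists2 v, D p v & A l (v - u)) ->
  ~ has_square A B D.
Proof.
move=> hB hD jl xz nsB nsD [E [dE nEA [g [g' [s [s' hg]]]] [e [e' [r [r' he]]]]]].
have [a [b [b0 Bv _]]] := exchange_space hB; have [a' [b' [b'0 Dv _]]] := exchange_space hD.
have [a1 [b1 [b10 Bw _]]] := exchange_space (exchange_sym hB).
have [a2 [b2 [b20 Dw _]]] := exchange_space (exchange_sym hD).
case: (hB) (hD) => [[dA dB pj _] [Ax Ay x0 y0] _ _ _] [[_ dD pl _] [Az Aw z0 w0] _ _ _].
have BDp : B p <> D p by apply: (exchange_common hB hD); rewrite eq_sym.
have jp : j != p by rewrite eq_sym. have lp : l != p by rewrite eq_sym.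
have lj : l != j by rewrite eq_sym.
have Bl : B l = A l := exchange_out hB lp lj. have Dj : D j = A j := exchange_out hD jp jl.
have BDj : B j <> D j by rewrite Dj => h; apply: (exchange_neqj hB).
have BDl : B l <> D l by rewrite Bl => h; apply: (exchange_neqj hD).
have xy := dec_orth dA pj Ax Ay; have zw := dec_orth dA pl Az Aw.
have hgt t : B t <> E t <-> t = g \/ t = g' := exchange_type t hg.
have het t : D t <> E t <-> t = e \/ t = e' := exchange_type t he.
have gg := exchange_neq hg; have ee := exchange_neq he.
have one t : B t <> D t -> (t = g \/ t = g') \/ (t = e \/ t = e').
  move=> BD; rewrite -hgt -het; apply: contrapT => /not_orP[/contrapT h1 /contrapT h2].
  by apply: BD; rewrite h1.
(* A further index [t] would use up one change on each side and leave two changes for the three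
   indices [p], [j], [l]. *)
have out t : t != p -> t != j -> t != l -> E t = A t.
  move=> tp tj tl; apply: contrapT => nt.
  have h1 : B t <> E t by rewrite (exchange_out hB tp tj) => /esym.
  have h2 : D t <> E t by rewrite (exchange_out hD tp tl) => /esym.
  have := (one _ BDp, one _ BDj, one _ BDl).
  move/hgt: h1 => h1; move/het: h2 => h2.
  move: tp tj tl pj pl jl.
  case: h1 h2 => -> [] <- tp tj tl pj pl jl [[hp hj] hl];
  case: hp hj hl => -[] hp [] [] hj [] [] hl; subst; by rewrite ?eqxx in tp tj tl pj pl jl.
have ag (F : 'I_k -> set H) f f' : (forall t, F t <> E t <-> t = f \/ t = f') ->
    [\/ F p = E p, F j = E j | F l = E l].
  move=> hF; apply: contrapT => nF.
  have np : F p <> E p by move=> h; apply: nF; constructor 1.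
  have nj : F j <> E j by move=> h; apply: nF; constructor 2.
  have nl : F l <> E l by move=> h; apply: nF; constructor 3.
  move: pj pl jl; case/hF: np => ->; case/hF: nj => ->; case/hF: nl => ->; by rewrite ?eqxx.
(* Nine cases. Equal indices contradict that [B] and [D] differ there; [B l = E l] with [D j = E j]
   gives [E = A]; the others violate orthogonality of two spaces of [E], and the case of [B j] and
   [D l] is the one that uses [xz]. *)
case: (ag _ _ _ hgt) => hB'; case: (ag _ _ _ het) => hD'.
- by apply: BDp; rewrite hB' hD'.
- have := dec_orth dE pj; rewrite -hB' -hD' Dj => /(_ _ _ Bv Ay) /eqP.
  by rewrite dotDl !dotZl xy mulr0 add0r mulf_eq0 dot_eq0 (negPf b0) (negPf y0).
- have [v Bv' vz] := nsB _ Az.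
  have := dec_orth dE pl; rewrite -hB' -hD' => /(_ _ _ Bv' Dw).
  rewrite -[v](subrK z) dotDl !dotDr !dotZr zw.
  rewrite (dec_orth dA jl vz Aw) (dec_orth dA jp vz Az) !mulr0 !add0r => /eqP.
  by rewrite mulf_eq0 conjC_eq0 dot_eq0 (negPf b20) (negPf z0).
- have [v Dv' vx] := nsD _ Ax.
  have := dec_orth dE pj; rewrite -hB' -hD' => /(_ _ _ Dv' Bw).
  rewrite -[v](subrK x) dotDl !dotDr !dotZr xy.
  rewrite (dec_orth dA lj vx Ay) (dec_orth dA lp vx Ax) !mulr0 !add0r => /eqP.
  by rewrite mulf_eq0 conjC_eq0 dot_eq0 (negPf b10) (negPf x0).
- by apply: BDj; rewrite hB' hD'.
- have := dec_orth dE jl; rewrite -hB' -hD' => /(_ _ _ Bw Dw).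
  rewrite !dotE (dec_orth dA jl Ay Aw) (dec_orth dA jp Ay Az) (dec_orth dA pl Ax Aw).
  move/eqP; rewrite !mulr0 !add0r !mulf_eq0 conjC_eq0.
  by rewrite (negPf b10) (negPf b20) (negPf xz).
- have := dec_orth dE pl; rewrite -hB' -hD' Bl => /(_ _ _ Dv Aw) /eqP.
  by rewrite dotDl !dotZl zw mulr0 add0r mulf_eq0 dot_eq0 (negPf b'0) (negPf w0).
- apply: nEA; apply: (dec_eq (j := p) dE dA) => t tp.
  have [->|tj] := eqVneq t j; first by rewrite -hD' Dj.
  have [->|tl] := eqVneq t l; first by rewrite -hB' Bl.
  exact: out.
- by apply: BDl; rewrite hB' hD'.
Qed.

(** The second alternative lists the positions of two stars that [no_square] leaves open. It is the
    means of reading types off the existence of squares. *)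
Lemma star_no_square i j p q A x z : is_decomp A -> i != j -> p != q -> A i x -> A p z -> x != 0 -> z != 0 ->
  ~ (forall B D, star A i j x B -> star A p q z D -> B <> A -> D <> A -> has_square A B D) \/
  [\/ [/\ i = p, j != q & dot x z = 0], [/\ i = p & j = q], [/\ i = q & j = p] |
      [/\ p != i, p != j, q != i & q != j]].
Proof.
move=> dA ij pq Ax Az x0 z0.
have [E|hc] := pselect (forall B D, star A i j x B -> star A p q z D -> B <> A -> D <> A -> has_square A B D); last by left.
right.
(* Whenever types share exactly one index [r], the stars contain exchanges with non-orthogonal
   vectors at [r], unless [r] is first in both and [x], [z] are orthogonal. *)
have key r s t y y' v w : r != s -> r != t -> s != t -> A r y -> A r y' -> A s v -> A t w ->
    y != 0 -> y' != 0 -> v != 0 -> w != 0 -> dot y y' != 0 ->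
    (forall B, exchange r s A B y v -> star A i j x B) ->
    (forall D, exchange r t A D y' w -> star A p q z D) -> False.
  move=> rs rt st Ay Ay' Av Aw y0 y'0 v0 w0 yy' h1 h2.
  have [B hB [nsB _]] := ex_exchange dA rs Ay Av y0 v0.
  have [D hD [nsD _]] := ex_exchange dA rt Ay' Aw y'0 w0.
  apply: (no_square hB hD st yy' nsB nsD); apply: E; [exact: h1|exact: h2| |].
    by case: hB => [[_ _ _ h] _ _ _ _] /esym.
  by case: hD => [[_ _ _ h] _ _ _ _] /esym.
have [yj Ayj yj0] := dec_neq0 dA j; have [yq Ayq yq0] := dec_neq0 dA q.
have [ip|ip] := eqVneq i p.
  subst p; have [jq|jq] := eqVneq j q; first by constructor 2.
  constructor 1; split=> //; apply/eqP; apply: contraT => xz; exfalso.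
  apply: (key i j q x z yj yq) => //; first by move=> B hB; right; exists yj.
  by move=> D hD; right; exists yq.
have [iq|iq] := eqVneq i q.
  subst q; have [jp|jp] := eqVneq j p; first by constructor 3.
  exfalso; apply: (key i j p x x yj z) => //; first by rewrite dot_eq0.
    by move=> B hB; right; exists yj.
  by move=> D hD; right; exists x; apply: exchange_sym.
have ji : j != i by rewrite eq_sym.
have [jp|jp] := eqVneq j p.
  subst p; exfalso; apply: (key j i q z z x yq) => //; first by rewrite dot_eq0.
    by move=> B hB; right; exists z; apply: exchange_sym.
  by move=> D hD; right; exists yq.
have [jq|jq] := eqVneq j q.
  subst q; exfalso; apply: (key j i p yj yj x z) => //; first by rewrite dot_eq0.
    by move=> B hB; right; exists yj; apply: exchange_sym.
  by move=> D hD; right; exists yj; apply: exchange_sym.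
by constructor 4.
Qed.

(** * The permutation of the eigenvalues *)

Implicit Types (F G : ('I_k -> set H) -> ('I_k -> set H)) (d : {perm 'I_k}) (I : pred 'I_k).

Definition adj_iso F G := [/\ forall A, is_decomp A -> is_decomp (F A), forall A, is_decomp A -> is_decomp (G A),
  forall A, is_decomp A -> G (F A) = A, forall A, is_decomp A -> F (G A) = A &
  forall A B, is_decomp A -> is_decomp B -> adj A B <-> adj (F A) (F B)].

Lemma adj_iso_sym F G : adj_iso F G -> adj_iso G F.
Proof.
move=> [h1 h2 h3 h4 h5]; split=> // A B dA dB.
by rewrite -{1}(h4 _ dA) -{1}(h4 _ dB) -h5 //; exact: h2.
Qed.

Definition star_image F A i j x p q u :=
  [/\ is_decomp A, i != j, A i x & x != 0] /\
  [/\ p != q, F A p u, u != 0 & F @` star A i j x = star (F A) p q u].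

Section Iso.
Variables (F G : ('I_k -> set H) -> ('I_k -> set H)) (hF : adj_iso F G).

Let dF A : is_decomp A -> is_decomp (F A). Proof. by case: hF => h _ _ _ _; exact: h. Qed.
Let dG A : is_decomp A -> is_decomp (G A). Proof. by case: hF => _ h _ _ _; exact: h. Qed.
Let FK A : is_decomp A -> G (F A) = A. Proof. by case: hF => _ _ h _ _; exact: h. Qed.
Let GK A : is_decomp A -> F (G A) = A. Proof. by case: hF => _ _ _ h _; exact: h. Qed.
Let aF A B : is_decomp A -> is_decomp B -> adj A B <-> adj (F A) (F B). Proof. by case: hF => _ _ _ _; apply. Qed.

Lemma iso_adj_eq A B : is_decomp A -> is_decomp B -> adj_eq A B <-> adj_eq (F A) (F B).
Proof.
move=> dA dB; split=> -[e|h].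
- by left; rewrite e.
- by right; exact/(aF dA dB).
- by left; rewrite -(FK dA) -(FK dB) e.
- by right; exact/(aF dA dB).
Qed.

Lemma iso_clique Q : clique Q -> clique (F @` Q).
Proof.
move=> [A [B [D [AB AD BD -> hcl]]]]; have [dA dB] := adj_dec AB; have [_ dD] := adj_dec AD.
exists (F A), (F B), (F D); split; [exact/(aF dA dB)|exact/(aF dA dD)|exact/(aF dB dD)| |].
  apply/seteqP; split=> [_ [E [dE h1 h2 h3] <-]|E [dE h1 h2 h3]].
    by split; [exact: dF|exact/(iso_adj_eq dE dA)|exact/(iso_adj_eq dE dB)|exact/(iso_adj_eq dE dD)].
  exists (G E); last exact: GK.
  have dGE := dG dE.
  by split; [| apply/(iso_adj_eq dGE dA)|apply/(iso_adj_eq dGE dB)|apply/(iso_adj_eq dGE dD)]; rewrite ?GK.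
move=> _ _ [E hE <-] [E' hE' <-]; case: (hE) (hE') => dE _ _ _ [dE' _ _ _].
exact/(iso_adj_eq dE dE')/hcl.
Qed.

Lemma ex_star_image A i j x : is_decomp A -> i != j -> A i x -> x != 0 -> exists p q u, star_image F A i j x p q u.
Proof.
move=> dA ij Ax x0.
have FA : (F @` star A i j x) (F A) by exists A => //; left.
have [p [q [u [pq Au u0 E]]]] := clique_star (iso_clique (star_clique dA ij Ax x0)) (dF dA) FA.
by exists p, q, u.
Qed.

Lemma star_dec A i j x B : is_decomp A -> star A i j x B -> is_decomp B.
Proof. by move=> dA [->//|[y /exchange_dec[]]]. Qed.

Lemma star_image_inv A i j x p q u : star_image F A i j x p q u -> star_image G (F A) p q u i j x.
Proof.
move=> [[dA ij Ax x0] [pq Au u0 E]]; split; split=> //; rewrite ?FK //; first exact: dF.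
rewrite -E; apply/seteqP; split=> [_ [_ [B SB <-] <-]|B SB].
  by rewrite FK //; apply: star_dec SB.
have dB := star_dec dA SB.
by exists (F B); [exists B|exact: FK].
Qed.

Lemma iso_neq A B : is_decomp A -> is_decomp B -> B <> A -> F B <> F A.
Proof. by move=> dA dB ne e; apply: ne; rewrite -(FK dA) -(FK dB) e. Qed.

Lemma img_star_inj A i j x i' j' x' : is_decomp A ->
  F @` star A i j x = F @` star A i' j' x' -> star A i j x = star A i' j' x'.
Proof.
move=> dA e; apply/seteqP; split=> B SB; have dB := star_dec dA SB.
  have : (F @` star A i j x) (F B) by exists B.
  rewrite e => -[D SD eD]; have dD := star_dec dA SD.
  by rewrite -(FK dB) -eD (FK dD).
have : (F @` star A i' j' x') (F B) by exists B.
rewrite -e => -[D SD eD]; have dD := star_dec dA SD.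
by rewrite -(FK dB) -eD (FK dD).
Qed.

(** Stars of reversed type at [A] meet in a second vertex, so their images do as well and have equal
    or reversed types. Equal types would make the images equal, hence the stars. *)
Lemma star_image_opp A i j x p q u y p' q' u' :
  star_image F A i j x p q u -> star_image F A j i y p' q' u' -> p' = q /\ q' = p.
Proof.
move=> [[dA ij Ax x0] [pq Au u0 E]] [[_ ji Ay y0] [pq' Au' u'0 E']].
have [B [nBA S1 S2]] := star_meet dA ij Ax Ay x0 y0.
have S1' : star (F A) p q u (F B) by rewrite -E; exists B.
have S2' : star (F A) p' q' u' (F B) by rewrite -E'; exists B.
case: (star_cap S1' S2' (iso_neq dA (star_dec dA S1) nBA)) => [[pp qq uu]|[-> ->]] //.
subst p' q'; rewrite (star_parallel _ _ _ uu) -E' in E.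
case: (star_inj dA ij Ax x0 (img_star_inj dA E)) => e.
by rewrite e eqxx in ij.
Qed.

(** Both stars are compared with a single star of the reversed type. *)
Lemma star_image_indep A i j x p q u x' p' q' u' :
  star_image F A i j x p q u -> star_image F A i j x' p' q' u' -> p = p' /\ q = q'.
Proof.
move=> h h'; case: (h) => [[dA ij Ax x0] _].
have [y Ay y0] := dec_neq0 dA j.
have ji : j != i by rewrite eq_sym.
have [p1 [q1 [u1 h1]]] := ex_star_image dA ji Ay y0.
by have [-> ->] := star_image_opp h1 h; have [-> ->] := star_image_opp h1 h'.
Qed.

Lemma iso_square A B D : is_decomp A -> is_decomp B -> is_decomp D -> has_square A B D -> has_square (F A) (F B) (F D).
Proof.
move=> dA dB dD [E [dE nEA BE DE]]; exists (F E); split; [exact: dF|exact: iso_neq|exact/(aF dB dE)|exact/(aF dD dE)].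
Qed.

End Iso.

Section Iso2.
Variables (F G : ('I_k -> set H) -> ('I_k -> set H)) (hF : adj_iso F G).
Let hG := adj_iso_sym hF.
Let dF A : is_decomp A -> is_decomp (F A). Proof. by case: hF => h _ _ _ _; exact: h. Qed.
Let FK A : is_decomp A -> G (F A) = A. Proof. by case: hF => _ _ h _ _; exact: h. Qed.

Lemma star_image_inj A i j x p q u i' j' x' u' :
  star_image F A i j x p q u -> star_image F A i' j' x' p q u' -> i = i' /\ j = j'.
Proof. by move=> /(star_image_inv hF) h /(star_image_inv hF) h'; exact: (star_image_indep hG h h'). Qed.

Lemma has_square_img A i j x l z p q u p' q' u' :
  star_image F A i j x p q u -> star_image F A i l z p' q' u' ->
  (forall B D, star A i j x B -> star A i l z D -> B <> A -> D <> A -> has_square A B D) ->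
  (forall B D, star (F A) p q u B -> star (F A) p' q' u' D -> B <> F A -> D <> F A -> has_square (F A) B D).
Proof.
move=> [[dA ij Ax x0] [pq Au u0 <-]] [[_ il Az z0] [pq' Au' u'0 <-]] h.
move=> _ _ [B SB <-] [D SD <-] nB nD.
apply: (iso_square hF) => //; [exact: star_dec SB|exact: star_dec SD|apply: h => //].
  by move=> e; apply: nB; rewrite e.
by move=> e; apply: nD; rewrite e.
Qed.

Lemma star_square_perp A i j l x z : j != l -> dot x z = 0 ->
  forall B D, star A i j x B -> star A i l z D -> B <> A -> D <> A -> has_square A B D.
Proof. by move=> jl xz B D [->//|[y hB]] [->//|[w hD]] _ _; apply: (has_square_perp hB hD). Qed.

(** With [z1] orthogonal to [x], all pairs from the two stars complete to squares, and so do their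
    images. Apart from [p = p'], [star_no_square] then leaves reversed and disjoint types to be
    excluded. *)
Lemma star_image_fst A i j x p q u l z p' q' u' :
  star_image F A i j x p q u -> star_image F A i l z p' q' u' -> j != l -> p = p'.
Proof.
move=> h h' jl; case: (h) => [[dA ij Ax x0] _]; case: (h') => [[_ il _ _] _].
have [z1 [Az1 z10 xz1]] := dec_ex1 dA i x.
have [p1 [q1 [u1 h1]]] := ex_star_image hF dA il Az1 z10.
have [e1 e2] := star_image_indep hF h' h1; subst p1 q1.
case: (h) => [_ [pq FAu u0 _]]; case: (h1) => [_ [pq' FAu1 u10 _]].
have hc := has_square_img h h1 (star_square_perp jl (dot_sym0 xz1)).
case: (star_no_square (dF dA) pq pq' FAu FAu1 u0 u10) => [//|] [[]|[]|[pE qE]|[pi line_proj qi qj]] //.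
  (* The star [(j, i, y)] already has the reversed type as image, and types are mapped
     injectively. *)
  subst p' q'; have [y Ay y0] := dec_neq0 dA j; have ji : j != i by rewrite eq_sym.
  have [p2 [q2 [u2 h2]]] := ex_star_image hF dA ji Ay y0.
  have [e1 e2] := star_image_opp hF h h2; subst p2 q2.
  by have [e _] := star_image_inj h2 h1; rewrite e eqxx in ij.
(* disjoint types commute, whereas the types {i,j} and {i,l} do not *)
have [p3 [q3 [u3 h3]]] := ex_star_image hF dA il Ax x0.
have [e1 e2] := star_image_indep hF h' h3; subst p3 q3.
case: (star_no_square dA ij il Ax Ax x0 x0) => [[]|].
  move=> B D SB SD nB nD.
  rewrite -(FK dA) -(FK (star_dec dA SB)) -(FK (star_dec dA SD)).
  have dB := star_dec dA SB; have dD := star_dec dA SD.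
  apply: (iso_square hG); [exact: dF|exact: dF|exact: dF|].
  have : star (F A) p q u (F B) by case: h => _ [_ _ _ <-]; exists B.
  have : star (F A) p' q' u3 (F D) by case: h3 => _ [_ _ _ <-]; exists D.
  move=> [e|[w hD]]; first by case: (iso_neq hF dA dD nD).
  move=> [e|[w' hB]]; first by case: (iso_neq hF dA dB nB).
  exact: (has_square_disj hB hD).
move=> [[_ _ /eqP]|[_ e]|[e _]|[]]; rewrite ?dot_eq0 ?(negPf x0) //.
- by rewrite e eqxx in jl.
- by rewrite e eqxx in il.
- by rewrite eqxx.
Qed.

Definition is_type_perm d A := forall i j x p q u, star_image F A i j x p q u -> p = d i /\ q = d j.

(** [star_image_fst] makes the image of the first index a function of that index; the second index
    is the first one of a reversed star. *)
Lemma ex_type_perm A : is_decomp A -> exists d, is_type_perm d A.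
Proof.
move=> dA.
have h i : exists p, forall j x p' q u, star_image F A i j x p' q u -> p' = p.
  have [j0 [j0i _]] := ex_third i i k_gt2; have [x Ax x0] := dec_neq0 dA i.
  rewrite eq_sym in j0i; have [p [q [u h0]]] := ex_star_image hF dA j0i Ax x0.
  exists p => j x' p' q' u' h'; have [jj|jj] := eqVneq j j0.
    by subst j; case: (star_image_indep hF h' h0).
  exact: (star_image_fst h' h0 jj).
have [f hf] := choice h.
have hf2 i j x p q u : star_image F A i j x p q u -> p = f i /\ q = f j.
  move=> hl; split; first exact: hf hl.
  case: (hl) => [[_ ij _ _] _]; have [y Ay y0] := dec_neq0 dA j.
  rewrite eq_sym in ij; have [p1 [q1 [u1 h1]]] := ex_star_image hF dA ij Ay y0.
  by have [<- _] := star_image_opp hF hl h1; apply: hf h1.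
have fI : injective f.
  move=> i j fij; apply/eqP; apply: contraT => ij; have [x Ax x0] := dec_neq0 dA i.
  have [p [q [u h0]]] := ex_star_image hF dA ij Ax x0; have [pE qE] := hf2 _ _ _ _ _ _ h0.
  by case: h0 => _ [+ _ _ _]; rewrite pE qE fij eqxx.
by exists (perm fI) => i j x p q u /hf2; rewrite !permE.
Qed.

(** One star contains both [A] and [B] and has type [(i, j)] at either of them; its image is one
    star, with the same type at [F A] and at [F B]. *)
Lemma type_perm_exchange d d' i j A B x y : is_type_perm d A -> is_type_perm d' B -> exchange i j A B x y -> d i = d' i.
Proof.
move=> hd hd' hr; have [dA dB] := exchange_dec hr; case: (hr) => [[_ _ ij nAB] [Ax Ay x0 y0] _ _ _].
have [x' [Bx' x'0 E]] := star_move hr.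
have [p [q [u hl]]] := ex_star_image hF dA ij Ax x0; have [p' [q' [u' hl']]] := ex_star_image hF dB ij Bx' x'0.
have [<- _] := hd _ _ _ _ _ _ hl; have [<- _] := hd' _ _ _ _ _ _ hl'.
case: hl hl' => [_ [pq FAu u0 e]] [_ [pq' FBu' u'0 e']].
rewrite E e in e'; have : star (F A) p q u (F B) by rewrite -e; exists B => //; right; exists y.
move=> [eq|[v /(star_move)[u2 [FBu2 u20 E2]]]].
  by case: nAB; rewrite -(FK dA) -(FK dB) eq.
by rewrite -E2 in e'; case: (star_inj (dF dB) pq FBu2 u20 e').
Qed.

Lemma type_perm_adj d A B : is_type_perm d A -> adj A B -> is_type_perm d B.
Proof.
move=> hd [j [l [x [y hr]]]]; have [dA dB] := exchange_dec hr; have [d' hd'] := ex_type_perm dB.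
suff e : d = d' by rewrite e.
apply/permP => i; have [->|ij] := eqVneq i j; first exact: type_perm_exchange hd hd' hr.
have [->|il] := eqVneq i l; first exact: type_perm_exchange hd hd' (exchange_sym hr).
(* exchanging the [j]-vector with an [i]-vector before and after the move only uses types
   containing [i] *)
have [c [e [c0 e0 cc ee]]] := exchange_unit hr; have hr' := exchange_scale c0 e0 hr.
have [a [b [ab b0 E]]] := exchangeP hr' cc ee.
case: hr' => [[_ _ jl _] [Ax Ay x0 y0] _ _ _].
have [z1 Az1 z10] := dec_neq0 dA i; have [f f0 ff] := normalize dot z10.
have Az := submodZ f (submod_dec dA i) Az1; set x1 := c *: x in Ax x0 cc E; set y1 := e *: y in Ay y0 ee E.
set z := f *: z1 in Az ff; have ji : j != i by rewrite eq_sym.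
(* Parameters 0 and 1 interchange [x1] and [z] up to sign, which puts [x1] into the [i]-th space. *)
have s1 : 0 * 0^* + 1 * 1^* = 1 :> C by rewrite conjC1 mul0r add0r mulr1.
have r1 := exchange_rot dA ji Ax Az cc ff s1 (oner_neq0 _).
have dA1 := proj2 (exchange_dec r1); set A1 := act _ A in r1 dA1.
have A1x : A1 i x1.
  have := rotA_y 0 1 dA ji Ax Az ff; rewrite conjC0 conjC1 scale0r addr0 scaleN1r.
  by move=> /(submodN (submod_dec dA1 i)); rewrite opprK.
have A1y : A1 l y1 by rewrite /A1 (rotA_out _ _ dA Ax Az) // eq_sym.
have r2 := exchange_rot dA1 il A1x A1y cc ee ab b0.
have r3 := exchange_act (rotA dA jl Ax Ay cc ee ab) r1; rewrite -E in r3.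
have [d1 hd1] := ex_type_perm dA1; have [d2 hd2] := ex_type_perm (proj2 (exchange_dec r2)).
rewrite (type_perm_exchange hd hd1 (exchange_sym r1)) (type_perm_exchange hd1 hd2 r2).
by rewrite (type_perm_exchange hd' hd2 (exchange_sym r3)).
Qed.

Lemma type_perm_inv d A : is_decomp A -> is_type_perm d A ->
  forall i j x p q u, star_image G (F A) i j x p q u -> p = (d^-1)%g i /\ q = (d^-1)%g j.
Proof.
move=> dA hd i j x p q u /(star_image_inv hG); rewrite FK // => /hd[-> ->].
by rewrite !permK.
Qed.

Lemma exchange_img d i j A B x y : is_type_perm d A -> exchange i j A B x y ->
  exists u v, exchange (d i) (d j) (F A) (F B) u v.
Proof.
move=> hd hr; have [dA dB] := exchange_dec hr; case: (hr) => [[_ _ ij nAB] [Ax Ay x0 y0] _ _ _].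
have [p [q [u hl]]] := ex_star_image hF dA ij Ax x0; have [e1 e2] := hd _ _ _ _ _ _ hl; subst p q.
case: hl => _ [_ _ _ e]; have : star (F A) (d i) (d j) u (F B).
  by rewrite -e; exists B => //; right; exists y.
move=> [eq|[v h]]; last by exists u, v.
by case: nAB; rewrite -(FK dA) -(FK dB) eq.
Qed.

(** For stars with the same first index and different second ones, squares exist throughout exactly
    when the vectors are orthogonal, so orthogonality inside one eigenspace is carried over. *)
Lemma star_image_perp A i j l x z p q q' u u' : star_image F A i j x p q u -> star_image F A i l z p q' u' -> j != l ->
  dot x z = 0 -> dot u u' = 0.
Proof.
move=> h h' jl xz; case: (h) (h') => [[dA _ _ _] [pq FAu u0 _]] [_ [pq' FAu' u'0 _]].
have hc := has_square_img h h' (star_square_perp jl xz).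
case: (star_no_square (dF dA) pq pq' FAu FAu' u0 u'0) => [//|] [[]|[_ qq]|[e]|[]] //.
- by subst q'; case: (star_image_inj h h') => _ e; rewrite e eqxx in jl.
- by rewrite -e eqxx in pq'.
- by rewrite eqxx.
Qed.

End Iso2.

(** The images under [phi] of a basis of [A i] separate the points of the image eigenspace: a vector
    orthogonal to all of them comes from a star whose vector is orthogonal to the basis. Second
    index [j] for the basis and [l] for the other vector make [star_image_perp] applicable. *)
Lemma type_perm_dim_le F G d A i m : adj_iso F G -> is_decomp A -> is_type_perm F d A -> n i = Some m ->
  exists2 m', n (d i) = Some m' & (m' <= m)%N.
Proof.
move=> hF dA hd ni; have hG := adj_iso_sym hF.
have dFA : is_decomp (F A) by case: hF => h _ _ _ _; exact: h.
have fA : fdim m (A i) by have := dec_dim dA i; rewrite ni.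
have [us [us_m usA hus]] := fdim_basis fA.
have [j [ji _]] := ex_third i i k_gt2; have [l [li lj]] := ex_third i j k_gt2.
rewrite eq_sym in ji; rewrite eq_sym in li; rewrite eq_sym in lj.
pose phi x := xget 0 [set u | star_image F A i j x (d i) (d j) u].
have hphi x : A i x -> x != 0 -> star_image F A i j x (d i) (d j) (phi x).
  move=> Ax x0; have [p [q [u hl]]] := ex_star_image hF dA ji Ax x0.
  by have [e1 e2] := hd _ _ _ _ _ _ hl; subst p q; apply: (xgetPex 0); exists u.
have [z' FAz' hz'|m' m'm fm'] := fdim_of_sep (dot := dot) (us := map phi us) (submod_dec dFA (d i)).
  apply/eqP; apply: contraT => z'0.
  have dil : d i != d l by rewrite (inj_eq perm_inj).
  have [p [q [z hl]]] := ex_star_image hG dFA dil FAz' z'0.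
  have [e1 e2] := type_perm_inv hF dA hd hl; rewrite !permK in e1 e2; subst p q.
  have [[_ _ _ _] [_ Gz z0 _]] := hl.
  have FKA : G (F A) = A by case: hF => _ _ h _ _; apply: h.
  rewrite FKA in Gz.
  suff : dot z z = 0 by move/dotxx0 => e; rewrite e eqxx in z0.
  apply: hus Gz => u uus; have [->|u0] := eqVneq u 0; first by rewrite dot0r.
  have h1 := star_image_inv hF (hphi _ (usA _ uus) u0).
  have dlj : d j != d l by rewrite (inj_eq perm_inj).
  apply: dot_sym0; apply: (star_image_perp hG h1 hl dlj).
  by apply: dot_sym0; apply: hz'; apply: map_f.
exists m'; last by rewrite size_map us_m in m'm.
have := dec_dim dFA (d i); rewrite /has_dim; case: (n (d i)) => [m2 f2|/(_ _ fm')] //.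
by rewrite (fdim_uniq f2 fm').
Qed.

Lemma type_perm_dim F G d A i : adj_iso F G -> is_decomp A -> is_type_perm F d A -> n (d i) = n i.
Proof.
move=> hF dA hd; have hG := adj_iso_sym hF; have dFA : is_decomp (F A) by case: hF => h _ _ _ _; exact: h.
have hd' : is_type_perm G (d^-1)%g (F A) by exact: (type_perm_inv hF dA hd).
case ni : (n i) => [m|].
  have [m' e m'm] := type_perm_dim_le hF dA hd ni; rewrite e.
  have [m2 e2 m2m] := type_perm_dim_le hG dFA hd' e; move: e2; rewrite permK ni => -[e2].
  by congr Some; apply/eqP; rewrite eqn_leq m'm e2 m2m.
case ndi : (n (d i)) => [m|] //.
by have [m' + _] := type_perm_dim_le hG dFA hd' ndi; rewrite permK ni.
Qed.

(** * Connectivity *)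

(** Chains of exchanges that leave the spaces with index in [I] fixed at every step. *)
Inductive reach I A : ('I_k -> set H) -> Prop :=
| reach_refl : reach I A A
| reach_step B D i j x y : reach I A B -> ~~ I i -> ~~ I j -> exchange i j B D x y -> reach I A D.

Lemma reach_trans I A B D : reach I A B -> reach I B D -> reach I A D.
Proof. by move=> h; elim=> // B' D' i j x y _ h' Ii Ij hr; apply: reach_step hr. Qed.

Lemma reach_mono I (J : pred 'I_k) A B : {subset I <= J} -> reach J A B -> reach I A B.
Proof.
move=> IJ; elim=> [|B' D' i j x y _ h Ii Ij hr]; first exact: reach_refl.
by apply: (reach_step h) hr; [apply: contra Ii => /IJ|apply: contra Ij => /IJ].
Qed.

Lemma reach_dec I A B : is_decomp A -> reach I A B -> is_decomp B.
Proof. by move=> dA; elim=> // B' D' i j x y _ _ _ _ /exchange_dec[]. Qed.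

Lemma reach_fix I A B t : reach I A B -> I t -> B t = A t.
Proof.
move=> h It; elim: h => // B' D' i j x y _ <- Ii Ij hr.
by apply: (exchange_out hr); [apply: contraNneq Ii => <-|apply: contraNneq Ij => <-].
Qed.

(** With [reach_full] this makes all decompositions unitarily conjugate, which [all_dec] uses to
    find their operators. *)
Lemma reach_unitary I A B : is_decomp A -> reach I A B -> exists2 U, unitary U & B = act U A.
Proof.
move=> dA; elim=> [|B' D' i j x y _ [U hU ->] _ _ hr].
  exists idfun; first exact: unitary_id.
  by apply: funext => t; rewrite /act image_id.
have [c [e [c0 e0 cc ee]]] := exchange_unit hr; have hr' := exchange_scale c0 e0 hr.
have [a [b [ab b0 ->]]] := exchangeP hr' cc ee.
case: hr' => [[dA' _ ij _] [Ax Ay x0 y0] _ _ _].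
exists (rot (c *: x) (e *: y) a b \o U).
  exact: (unitary_comp (rotA dA' ij Ax Ay cc ee ab) hU).
by apply: funext => t; rewrite /act image_comp.
Qed.

Lemma ex_exchange_mem i j A x y e f : is_decomp A -> i != j -> A i x -> A j y -> x != 0 -> y != 0 -> f != 0 ->
  exists2 B, exchange i j A B x y & B i (e *: x + f *: y).
Proof.
move=> dA ij Ax Ay x0 y0 f0; have [c c0 cc] := normalize dot x0; have [d d0 dd] := normalize dot y0.
have lA t := submod_dec dA t.
have Acx := submodZ c (lA i) Ax; have Ady := submodZ d (lA j) Ay.
set v := e *: x + f *: y.
have xy := dec_orth dA ij Ax Ay.
have v0 : v != 0.
  apply/negP => /eqP /(congr1 (fun v => dot v y)); rewrite /v !dotE xy mulr0 add0r => /eqP.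
  by rewrite mulf_eq0 dot_eq0 (negPf f0) (negPf y0).
have [g g0 gg] := normalize dot v0.
have gE : g *: v = (g * e / c) *: (c *: x) + (g * f / d) *: (d *: y).
  by rewrite scalerDr !scalerA !divfK.
have cxdy := dec_orth dA ij Acx Ady.
have ab : (g * e / c) * (g * e / c)^* + (g * f / d) * (g * f / d)^* = 1.
  rewrite -gg gE; move: (c *: x) (d *: y) cc dd cxdy => x1 y1 cc dd xy1.
  by rewrite !dotE cc dd xy1 (dot_sym0 xy1); ring.
have b0 : g * f / d != 0 by rewrite !mulf_neq0 ?invr_eq0.
have hr := exchange_rot dA ij Acx Ady cc dd ab b0.
exists (act (rot (c *: x) (d *: y) (g * e / c) (g * f / d)) A).
  by have := exchange_scale (invr_neq0 c0) (invr_neq0 d0) hr; rewrite !scalerA !mulVf // !scale1r.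
apply: (submodZV (submod_dec (proj2 (exchange_dec hr)) i) g0); rewrite gE.
exact: (rotA_x _ _ dA ij Acx Ady cc).
Qed.

(** Induction on the number of indices other than [t] at which [y] has a nonzero component. The
    space [D], already in place, survives because the vector turned at [t] is orthogonal to it. *)
Lemma reach_vector I A t y (D : set H) : is_decomp A -> ~~ I t -> y != 0 ->
  (forall s, I s -> forall v, A s v -> dot y v = 0) ->
  D `<=` A t -> (forall v, D v -> dot y v = 0) ->
  (exists u, [/\ A t u, u != 0 & forall v, D v -> dot u v = 0]) ->
  exists B, [/\ reach I A B, B t y & D `<=` B t].
Proof.
pose S A := [pred s | (s != t) && (pr A y s != 0)].
move=> dA It y0; move: {2}#|_| (leqnn #|S A|) => m; elim: m A dA => [|m IH] A dA hm hI hD yD [u [Au u0 uD]].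
  exists A; split=> //; first exact: reach_refl.
  rewrite (pr_sum dA y) (bigD1 t) //= big1 ?addr0; first exact: (pr_in dA).
  move=> s st; move: hm; rewrite leqn0 => /eqP/card0_eq/(_ s); rewrite !inE st /=.
  by move/negbT; rewrite negbK => /eqP.
have [/existsP[s /andP[st ys0]]|/existsPn nS] := boolP [exists s, S A s]; last first.
  exists A; split=> //; first exact: reach_refl.
  rewrite (pr_sum dA y) (bigD1 t) //= big1 ?addr0; first exact: (pr_in dA).
  by move=> s st; have := nS s; rewrite /= st /= negbK => /eqP.
have nI r : pr A y r != 0 -> ~~ I r.
  by move=> yr; apply: contra yr => Ir; apply/eqP/(pr_eq0 dA)/hI.
have [/existsP[s' /andP[s's /andP[s't ys'0]]]|/existsPn nS] := boolP [exists s', (s' != s) && S A s'].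
  (* Two components are merged: the rotation puts their sum into the [s]-th space, and the component
     at [s'] disappears. *)
  have ss' : s != s' by rewrite eq_sym.
  have [B hr] := ex_exchange_mem 1 dA ss' (pr_in dA y s) (pr_in dA y s') ys0 ys'0 (oner_neq0 _).
  rewrite !scale1r => Bs; have [_ dB] := exchange_dec hr.
  have Bt : B t = A t by apply: (exchange_out hr); rewrite eq_sym.
  have prr r : r != s -> r != s' -> pr B y r = pr A y r.
    move=> rs rs'; apply: (pr_uniq dB); rewrite (exchange_out hr) //; first exact: (pr_in dA).
    by move=> w Aw; rewrite dotDl dotNl (dot_pr dA _ Aw) subrr.
  have prs' : pr B y s' = 0.
    apply: (pr_eq0 dB) => w Bw; rewrite (pr_sum dA y) (bigD1 s) //= (bigD1 s') //= addrA.
    rewrite dotDl (dec_orth dB ss' Bs Bw) add0r dot_suml big1 // => r /andP[rs rs'].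
    apply: (dec_orth dB rs') Bw; rewrite (exchange_out hr) //; exact: (pr_in dA).
  have hm' : (#|S B| <= m)%N.
    rewrite -ltnS; apply: leq_trans hm; apply: proper_card; apply/properP; split.
      apply/fintype.subsetP => r; rewrite !inE => /andP[rt]; rewrite rt.
      have [->|rs'] := eqVneq r s'; first by rewrite prs' eqxx.
      by have [->|rs] := eqVneq r s; rewrite /= ?ys0 ?(prr _ rs rs').
    by exists s'; rewrite !inE ?s't ?prs' ?eqxx.
  have hI' r : I r -> forall v, B r v -> dot y v = 0.
    move=> Ir; have rs : r != s by apply: contraTneq Ir => ->; apply: nI.
    have rs' : r != s' by apply: contraTneq Ir => ->; apply: nI.
    by rewrite (exchange_out hr rs rs'); apply: hI.
  rewrite -Bt in hD Au.
  have [|B' [h1 h2 h3]] := IH B dB hm' hI' hD yD; first by exists u.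
  exists B'; split=> //; apply: reach_trans h1.
  exact: (reach_step (reach_refl _ _) (nI _ ys0) (nI _ ys'0) hr).
have yE : y = pr A y t + pr A y s.
  rewrite {1}(pr_sum dA y) (bigD1 t) //= (bigD1 s) //= big1 ?addr0 // => r /andP[rt rs].
  by have := nS r; rewrite rs /= rt /= negbK => /eqP.
have ts : t != s by rewrite eq_sym.
have DB x B : exchange t s A B x (pr A y s) -> (forall v, D v -> dot x v = 0) -> D `<=` B t.
  move=> [_ _ _ h _] hx v Dv; apply: h; split; first exact: hD.
  by apply: dot_sym0; apply: hx.
(* If [y] has no component at [t], the vector [u] is turned out of the [t]-th space to make room for
   it. *)
have [yt|yt] := eqVneq (pr A y t) 0.
  have [B hr Bt] := ex_exchange_mem 0 dA ts Au (pr_in dA y s) u0 ys0 (oner_neq0 _).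
  exists B; split; last exact: DB hr uD.
    exact: (reach_step (reach_refl _ _) It (nI _ ys0) hr).
  by rewrite yE yt add0r; move: Bt; rewrite scale0r scale1r add0r.
have [B hr Bt] := ex_exchange_mem 1 dA ts (pr_in dA y t) (pr_in dA y s) yt ys0 (oner_neq0 _).
exists B; split.
- exact: (reach_step (reach_refl _ _) It (nI _ ys0) hr).
- by rewrite yE; move: Bt; rewrite !scale1r.
- by apply: DB hr _ => v Dv; rewrite -(dot_pr dA) ?yD //; apply: hD.
Qed.

(** [X] is brought in one orthogonal vector at a time; [D], of dimension [p], is the part already
    contained in the current [t]-th space, and [q] counts the missing dimensions. *)
Lemma reach_space I A t X m : is_decomp A -> ~~ I t -> n t = Some m -> fdim m X ->
  (forall s, I s -> forall x v, X x -> A s v -> dot x v = 0) ->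
  exists2 B, reach I A B & B t = X.
Proof.
move=> dA It nt fX hI.
suff key (q p : nat) (D : set H) A' : is_decomp A' -> (p + q)%N = m -> reach I A A' -> fdim p D -> D `<=` A' t -> D `<=` X ->
    exists2 B, reach I A B & B t = X.
  have f0 : fdim 0 [set 0] by [].
  apply: (key m 0%N _ A dA (add0n m) (reach_refl _ _) f0) => _ ->.
    exact: submod0 (submod_dec dA t).
  exact: submod0 (submod_fdim fX).
elim: q p D A' => [|q IH] p D A' dA' pq hA' fD DA DX.
  rewrite addn0 in pq; subst p; exists A' => //.
  have fA : fdim m (A' t) by have := dec_dim dA' t; rewrite nt.
  by rewrite -(fdim_sub_eq fD fA DA) (fdim_sub_eq fD fX DX).
have pm : (p < m)%N by rewrite -pq addnS ltnS leq_addr.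
have fA : fdim m (A' t) by have := dec_dim dA' t; rewrite nt.
have [us [us_p _ hus]] := fdim_basis fD.
have [|y [Xy y0 yus]] := @ex_perp _ _ dot X us (submod_fdim fX).
  by move=> m' fm'; rewrite us_p (fdim_uniq fm' fX).
have [|u [Au u0 uus]] := @ex_perp _ _ dot (A' t) us (submod_fdim fA).
  by move=> m' fm'; rewrite us_p (fdim_uniq fm' fA).
have [|||B [h1 h2 h3]] := @reach_vector I A' t y D dA' It y0 _ DA.
- by move=> s Is v; rewrite (reach_fix hA' Is); apply: hI.
- exact: hus.
- by exists u; split=> //; apply: hus.
have nD : ~ D y by move=> /(hus _ yus)/dotxx0 e; rewrite e eqxx in y0.
have fD' := fdim_add_line fD nD.
apply: (IH p.+1 (add_line D y) B) => //.
- exact: reach_dec h1.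
- by rewrite addSnnS.
- exact: reach_trans h1.
- by apply: add_line_min => //; exact: (submod_dec (reach_dec dA' h1) t).
- by apply: add_line_min => //; exact: submod_fdim fX.
Qed.

(** A finite-dimensional space outside [I] is adjusted by [reach_space] and its index added to [I].
    Once no such index is left, at most one space is free, and it is the complement of the
    others. *)
Lemma reach_full I A B : is_decomp A -> is_decomp B -> (forall s, I s -> A s = B s) -> reach I A B.
Proof.
move=> dA dB; move: {2}#|_| (leqnn #|predC I|) => m; elim: m I A dA => [|m IH] I A dA hm hI.
  suff -> : A = B by exact: reach_refl.
  apply: funext => t; apply: hI; move: hm; rewrite leqn0 => /eqP/card0_eq/(_ t).
  by rewrite !inE => /negbT; rewrite negbK.
have [[t [It [q nt]]]|nex] := pselect (exists t, ~~ I t /\ exists m0 : nat, n t = Some m0).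
  have fB : fdim q (B t) by have := dec_dim dB t; rewrite nt.
  have [|A' hA' A't] := reach_space dA It nt fB.
    move=> s Is x v Bx; rewrite hI // => Bv; apply: (dec_orth dB) Bx Bv.
    by apply: contraNneq It => ->.
  apply: (reach_trans hA'); apply: (reach_mono (J := predU1 t I)).
    by move=> s Is; rewrite !inE; apply/orP; right.
  apply: IH; first exact: reach_dec hA'.
    rewrite -ltnS; apply: leq_trans hm; apply: proper_card; apply/properP; split.
      by apply/fintype.subsetP => s; rewrite !inE negb_or => /andP[].
    by exists t; rewrite !inE ?eqxx.
  move=> s /orP[/eqP -> //|Is]; by rewrite (reach_fix hA' Is) hI.
suff -> : A = B by exact: reach_refl.
have [[t It]|nI] := pselect (exists t, ~~ I t); last first.
  by apply: funext => t; apply: hI; apply: contrapT => h; apply: nI; exists t; apply/negP.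
apply: (dec_eq (j := t) dA dB) => s st; apply: hI; apply: contraT => Is.
have inf r : ~~ I r -> n r = None.
  by move=> Ir; case nr: (n r) => [q|//]; case: nex; exists r; split=> //; exists q.
by rewrite (n_inf (inf _ It) (inf _ Is)) eqxx in st.
Qed.

Section Induced.
Variables (F G : ('I_k -> set H) -> ('I_k -> set H)) (hF : adj_iso F G) (d : {perm 'I_k}).

Lemma reach_type_perm I A B : is_type_perm F d A -> reach I A B ->
  is_type_perm F d B /\ forall t, I t -> F B (d t) = F A (d t).
Proof.
move=> hd; elim=> // B' D' i j x y _ [hB hI] Ii Ij hr; split.
  by apply: (type_perm_adj hF hB); exists i, j, x, y.
move=> t It; have [u [v hr']] := exchange_img hF hB hr; rewrite (exchange_out hr') ?hI //.
  by rewrite (inj_eq perm_inj); apply: contraNneq Ii => <-.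
by rewrite (inj_eq perm_inj); apply: contraNneq Ij => <-.
Qed.

Lemma type_perm_all A B : is_decomp A -> is_decomp B -> is_type_perm F d A -> is_type_perm F d B.
Proof.
move=> dA dB hd; have h : reach pred0 A B by apply: reach_full.
by case: (reach_type_perm hd h).
Qed.

(** A chain that avoids [t] is mapped to a chain that avoids [d t]. *)
Lemma reach_img A B t : is_decomp A -> is_decomp B -> is_type_perm F d A -> A t = B t -> F A (d t) = F B (d t).
Proof.
move=> dA dB hd e; have h : reach (pred1 t) A B by apply: reach_full => // s /eqP ->.
by have [_ /(_ t)->] := reach_type_perm hd h; rewrite //=.
Qed.

End Induced.

End Decompositions.

(** * Descent from subspaces to points *)

Section Descent.
Context {C : numClosedFieldType} {H : lmodType C} (dot : {dot H for conjC}).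
Implicit Types (X Y Z S P W : set H) (x y z u v w : H) (g h s : set H -> set H).
Local Notation perp := (perp dot).
Local Notation fdim := (fdim dot).

Definition orthp X Y := forall x y, X x -> Y y -> dot x y = 0.

Lemma orthp_sym X Y : orthp X Y -> orthp Y X.
Proof. by move=> h y x Yy Xx; apply: dot_sym0; apply: h. Qed.

Lemma submod_orthp Y : submod [set v | forall y, Y y -> dot v y = 0].
Proof.
split=> [y _|a u v hu hv y Yy]; first by rewrite dot0l.
by rewrite dotDl dotZl hu // hv // mulr0 addr0.
Qed.

(** Says that [H] has dimension at least [N], in a form that includes infinite dimension. *)
Definition big_dim N := forall us : seq H, (size us < N)%N ->
  exists2 w, w != 0 & forall u, u \in us -> dot w u = 0.

Lemma big_dim_le N N' : (N <= N')%N -> big_dim N' -> big_dim N.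
Proof. by move=> NN h us us_N; apply: h; apply: leq_trans NN. Qed.

Lemma ex_ext N p q r Z Y : big_dim N -> fdim p Z -> fdim q Y -> orthp Y Z -> (q <= r)%N -> (p + r <= N)%N ->
  exists Y', [/\ fdim r Y', Y `<=` Y' & orthp Y' Z].
Proof.
move=> hN fZ + + qr; rewrite -(subnK qr); move: (r - q)%N => e {qr r}.
elim: e q Y => [|e IH] q Y fY YZ pN; first by exists Y; rewrite add0n; split.
have [us [us_p _ hus]] := fdim_basis fZ; have [vs [vs_q _ hvs]] := fdim_basis fY.
have [|w w0 hw] := hN (us ++ vs).
  by rewrite size_cat us_p vs_q (leq_trans _ pN) // addSn addnS ltnS leq_add2l leq_addl.
have wZ x : Z x -> dot w x = 0 by apply: hus => u uu; apply: hw; rewrite mem_cat uu.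
have wY x : Y x -> dot w x = 0 by apply: hvs => u uu; apply: hw; rewrite mem_cat uu orbT.
have nYw : ~ Y w by move=> /wY/dotxx0 w0'; rewrite w0' eqxx in w0.
have [||Y' [f1 f2 f3]] := IH q.+1 (add_line Y w) (fdim_add_line fY nYw).
- by move=> _ z [u [c [Yu ->]]] Zz; rewrite dotDl YZ // dotZl wZ // mulr0 addr0.
- by rewrite addnS -addSn.
rewrite addSnnS; exists Y'; split=> //; exact: subset_trans (@sub_add_line _ _ _ _) f2.
Qed.

(** If a vector of [P] has a nonzero component [w] orthogonal to [X], the line of [w] extends to an
    [r]-dimensional space orthogonal to [X] but not to [P]. *)
Lemma sub_orth N m r X P : big_dim N -> (0 < r)%N -> (m + r <= N)%N -> fdim m X ->
  (forall Y, fdim r Y -> orthp X Y -> orthp P Y) -> P `<=` X.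
Proof.
move=> hN r0 mN fX h x Px; have [p Xp hp] := fdim_proj x fX.
have [e|w0] := eqVneq (x - p) 0; first by rewrite (subr0_eq e).
have [|Y [fY wY YX]] := @ex_ext N m 1 r X _ hN fX (fdim_line _ w0) _ r0 mN.
  by move=> _ z [a _ <-] Xz; rewrite dotZl hp ?mulr0.
have Yw : Y (x - p) by apply: wY; exists 1 => //; rewrite scale1r.
have := h _ fY (orthp_sym YX) _ _ Px Yw.
rewrite -{1}[x](subrK p) dotDl [dot p _](dot_sym0 (hp _ Xp)) addr0 => /dotxx0 e.
by rewrite e eqxx in w0.
Qed.

Lemma fdim_perp_gen m X z v : fdim m.+1 X -> X v -> dot v z != 0 -> fdim m (perp X z).
Proof.
move=> fX Xv vz; have [p Xp hp] := fdim_proj z fX.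
have e u : X u -> dot u z = dot u p.
  move=> Xu; rewrite -{1}[z](subrK p) dotDr [dot u (z - p)](dot_sym0 (hp _ Xu)) add0r //.
have p0 : p != 0 by apply: contraNneq vz => p0; rewrite e // p0 dot0r.
rewrite (_ : perp X z = perp X p); first exact: fdim_perp.
by apply/seteqP; split=> u [Xu]; [rewrite e|rewrite -e].
Qed.

Lemma ex_notin m X1 X2 : fdim m X1 -> fdim m X2 -> X1 <> X2 -> exists2 v, X2 v & ~ X1 v.
Proof.
move=> f1 f2 ne; apply: contrapT => nex; apply: ne; apply/esym; apply: (fdim_sub_eq f2 f1) => v Xv.
by apply: contrapT => nv; apply: nex; exists v.
Qed.

Lemma join_min m X1 X2 Z W : fdim m X1 -> fdim m X2 -> X1 <> X2 -> fdim m.+1 Z ->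
  X1 `<=` Z -> X2 `<=` Z -> submod W -> X1 `<=` W -> X2 `<=` W -> Z `<=` W.
Proof.
move=> f1 f2 ne fZ h1 h2 lW w1 w2; have [v Xv nv] := ex_notin f1 f2 ne.
rewrite -(fdim_sub_eq (fdim_add_line f1 nv) fZ).
  by apply: add_line_min => //; apply: w2.
by apply: add_line_min; [exact: submod_fdim fZ| |exact: h2].
Qed.

Lemma fdim_meet m X1 X2 Z : fdim m.+1 X1 -> fdim m.+1 X2 -> X1 <> X2 -> fdim m.+2 Z ->
  X1 `<=` Z -> X2 `<=` Z -> fdim m (X1 `&` X2).
Proof.
move=> f1 f2 ne fZ h1 h2; have [v Xv nv] := ex_notin f1 f2 ne.
have [p Xp hp] := fdim_proj v f1; set z := v - p in hp.
have z0 : z != 0 by rewrite subr_eq0; apply/eqP => e; apply: nv; rewrite e.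
have Zz : Z z by apply: submodB (submod_fdim fZ) (h2 _ Xv) (h1 _ Xp).
have E : X1 = perp Z z.
  apply: (fdim_sub_eq f1 (fdim_perp fZ Zz z0)) => u Xu; split; first exact: h1.
  by apply: dot_sym0; apply: hp.
have -> : X1 `&` X2 = perp X2 z.
  apply/seteqP; split=> u [Xu Xu']; first by split=> //; rewrite E in Xu; case: Xu.
  by split=> //; rewrite E; split=> //; apply: h2.
apply: (fdim_perp_gen f2 Xv).
by rewrite -[v](subrK p) dotDl -/z [dot p z](dot_sym0 (hp _ Xp)) addr0 dot_eq0.
Qed.

(** Three pairwise adjacent spaces have a common hyperplane or a common span of dimension [m.+2]: if
    [X3] meets [X1] and [X2] in different hyperplanes, these span [X3], which then lies in [Z]. *)
Lemma meet_sub m X1 X2 X3 Z Z1 Z2 : fdim m.+1 X1 -> fdim m.+1 X2 -> fdim m.+1 X3 ->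
  X1 <> X2 -> X1 <> X3 -> X2 <> X3 -> fdim m.+2 Z -> X1 `<=` Z -> X2 `<=` Z ->
  fdim m.+2 Z1 -> X1 `<=` Z1 -> X3 `<=` Z1 -> fdim m.+2 Z2 -> X2 `<=` Z2 -> X3 `<=` Z2 ->
  ~ (X3 `<=` Z) -> X1 `&` X2 `<=` X3.
Proof.
move=> f1 f2 f3 n12 n13 n23 fZ a1 a2 fZ1 b1 b3 fZ2 c2 c3 nZ.
have m12 := fdim_meet f1 f2 n12 fZ a1 a2; have m13 := fdim_meet f1 f3 n13 fZ1 b1 b3.
have m23 := fdim_meet f2 f3 n23 fZ2 c2 c3.
have [e|ne] := pselect (X1 `&` X3 = X2 `&` X3).
  suff <- : X1 `&` X3 = X1 `&` X2 by move=> v [].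
  apply: (fdim_sub_eq m13 m12) => v hv; have := hv; rewrite e => -[h _].
  by case: hv => h' _; split.
case: nZ; have [v Xv nv] := ex_notin m13 m23 ne.
rewrite -(fdim_sub_eq (fdim_add_line m13 nv) f3).
  by apply: add_line_min; [exact: submod_fdim fZ|move=> w [/a1]|case: Xv => /a2].
by apply: add_line_min; [exact: submod_fdim f3|move=> w []|case: Xv].
Qed.

Definition fdim_bij m g g' := [/\ forall X, fdim m X -> fdim m (g X), forall X, fdim m X -> fdim m (g' X),
  forall X, fdim m X -> g' (g X) = X & forall X, fdim m X -> g (g' X) = X].

Lemma fdim_bij_sym m g g' : fdim_bij m g g' -> fdim_bij m g' g.
Proof. by case. Qed.

Definition orth_compat m r g h := forall X Y, fdim m X -> fdim r Y -> orthp X Y <-> orthp (g X) (h Y).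

Lemma orth_compat_sym m r g h : orth_compat m r g h -> orth_compat r m h g.
Proof.
move=> c X Y fX fY; split=> /orthp_sym; first by move/(c _ _ fY fX)/orthp_sym.
by move/(c _ _ fY fX)/orthp_sym.
Qed.

Lemma orth_compat_inv m r g g' h h' : fdim_bij m g g' -> fdim_bij r h h' -> orth_compat m r g h -> orth_compat m r g' h'.
Proof.
move=> [g1 g2 g3 g4] [h1 h2 h3 h4] c X Y fX fY.
by rewrite (c _ _ (g2 _ fX) (h2 _ fY)) g4 // h4.
Qed.

(* For [S] of dimension [m], the candidate for the image of [S] under the map that [g] induces on
   [m]-dimensional spaces. *)
Definition pencil_core m g S : set H := [set v | forall X, fdim m.+1 X -> S `<=` X -> g X v].

Section Step.
Variables (m r N : nat) (g g' h h' : set H -> set H).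
Hypotheses (hg : fdim_bij m.+1 g g') (hh : fdim_bij r h h') (c : orth_compat m.+1 r g h).
Hypotheses (r0 : (0 < r)%N) (hN : big_dim N) (mN : (m.+2 + r <= N)%N).

(** A substitute for [X] lying in [X1 + X2] that the pair [g], [h] preserves. *)
Definition orth_closure X1 X2 X := forall Y, fdim r Y -> orthp X1 Y -> orthp X2 Y -> orthp X Y.

Lemma orth_closure_sub X1 X2 X Z : fdim m.+2 Z -> X1 `<=` Z -> X2 `<=` Z -> orth_closure X1 X2 X -> X `<=` Z.
Proof.
move=> fZ h1 h2 hX; apply: (sub_orth hN r0 mN fZ) => Y fY ZY; apply: hX => // x y Xx; apply: ZY.
  exact: h1.
exact: h2.
Qed.

Lemma sub_orth_closure X1 X2 X Z : fdim m.+1 X1 -> fdim m.+1 X2 -> X1 <> X2 -> fdim m.+2 Z ->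
  X1 `<=` Z -> X2 `<=` Z -> X `<=` Z -> orth_closure X1 X2 X.
Proof.
move=> f1 f2 ne fZ h1 h2 hX Y fY o1 o2 x y Xx Yy.
have := join_min f1 f2 ne fZ h1 h2 (submod_orthp Y).
by move=> /(_ (fun x Xx y Yy => o1 x y Xx Yy) (fun x Xx y Yy => o2 x y Xx Yy))/(_ _ (hX _ Xx))/(_ _ Yy).
Qed.

Definition in_extension X1 X2 := exists Z, [/\ fdim m.+2 Z, X1 `<=` Z & X2 `<=` Z].

(* This expresses through orthogonality alone, hence invariantly, that [X1 + X2] has dimension at
   most [m.+2]. *)
Definition minimal X1 X2 := forall X3 X4, fdim m.+1 X3 -> fdim m.+1 X4 ->
  orth_closure X1 X2 X3 -> orth_closure X1 X2 X4 -> X3 <> X4 -> orth_closure X3 X4 X1 /\ orth_closure X3 X4 X2.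

Lemma in_extension_minimal X1 X2 : in_extension X1 X2 -> minimal X1 X2.
Proof.
move=> [Z [fZ h1 h2]] X3 X4 f3 f4 /(orth_closure_sub fZ h1 h2) h3 /(orth_closure_sub fZ h1 h2) h4 n34.
by split; apply: (sub_orth_closure f3 f4 n34 fZ h3 h4).
Qed.

(** Minimality is applied to [X1] and the space spanned by a hyperplane of [X1] and a vector [v] of
    [X2] outside [X1]: [X2] lies in their closure, hence in [add_line X1 v]. *)
Lemma minimal_in_extension X1 X2 : fdim m.+1 X1 -> fdim m.+1 X2 -> X1 <> X2 ->
  minimal X1 X2 -> in_extension X1 X2.
Proof.
move=> f1 f2 ne hm; have [v Xv nv] := ex_notin f1 f2 ne.
case: (f1) => lX [u [Xu u0 fu]].
have nv' : ~ perp X1 u v by move=> [].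
have fX4 := fdim_add_line fu nv'; have fZ := fdim_add_line f1 nv.
have h1 : X1 `<=` add_line X1 v by exact: sub_add_line.
have h4 : add_line (perp X1 u) v `<=` add_line X1 v.
  by apply: add_line_min; [exact: submod_fdim fZ|move=> w [/h1]|exact: mem_add_line].
have n4 : X1 <> add_line (perp X1 u) v.
  by move=> e; apply: nv; rewrite e; apply: mem_add_line; exact: submod_fdim fu.
exists (add_line X1 v); split=> //.
case: (hm _ _ f1 fX4 _ _ n4) => [Y _ //|Y fY o1 o2|_]; last exact: orth_closure_sub fZ h1 h4.
move=> _ y [w [e [[Xw _] ->]]] Yy.
by rewrite dotDl o1 // dotZl o2 // mulr0 addr0.
Qed.

Lemma orth_closure_img X1 X2 X : fdim m.+1 X1 -> fdim m.+1 X2 -> fdim m.+1 X ->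
  orth_closure X1 X2 X <-> orth_closure (g X1) (g X2) (g X).
Proof.
case: hh => h1 h2 h3 h4 f1 f2 fX; split=> hX Y fY o1 o2.
  have fY' := h2 _ fY; rewrite -(h4 _ fY) in o1 o2 *; apply/(c fX fY').
  by apply: hX => //; [exact/(c f1 fY')|exact/(c f2 fY')].
by apply/(c fX fY); apply: hX; [exact: h1|exact/(c f1 fY)|exact/(c f2 fY)].
Qed.

Lemma img_inj X1 X2 : fdim m.+1 X1 -> fdim m.+1 X2 -> X1 <> X2 -> g X1 <> g X2.
Proof. by case: hg => _ _ k _ f1 f2 ne e; apply: ne; rewrite -(k _ f1) -(k _ f2) e. Qed.

Lemma in_extension_img X1 X2 : fdim m.+1 X1 -> fdim m.+1 X2 -> X1 <> X2 ->
  in_extension X1 X2 -> in_extension (g X1) (g X2).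
Proof.
case: (hg) => g1 g2 g3 g4 f1 f2 ne /in_extension_minimal hm.
apply: minimal_in_extension; [exact: g1|exact: g1|exact: img_inj|] => X3 X4 f3 f4 c3 c4 n34.
have [f3' f4'] := (g2 _ f3, g2 _ f4); rewrite -(g4 _ f3) -(g4 _ f4).
have [|||k1 k2] := hm _ _ f3' f4'.
- by apply/(orth_closure_img f1 f2 f3'); rewrite g4.
- by apply/(orth_closure_img f1 f2 f4'); rewrite g4.
- by move=> e; apply: n34; rewrite -(g4 _ f3) -(g4 _ f4) e.
by split; [apply/(orth_closure_img f3' f4' f1)|apply/(orth_closure_img f3' f4' f2)].
Qed.

Lemma pencil_in_extension S X1 X2 : fdim m S -> fdim m.+1 X1 -> fdim m.+1 X2 -> X1 <> X2 ->
  S `<=` X1 -> S `<=` X2 -> in_extension X1 X2.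
Proof.
move=> fS f1 f2 ne h1 h2; have [v Xv nv] := ex_notin f1 f2 ne.
have fZ := fdim_add_line f1 nv; exists (add_line X1 v); split=> //; first exact: sub_add_line.
have nSv : ~ S v by move=> /h1.
rewrite -(fdim_sub_eq (fdim_add_line fS nSv) f2); last exact: add_line_min (submod_fdim f2) h2 Xv.
apply: add_line_min; [exact: submod_fdim fZ| |by apply: mem_add_line; exact: submod_fdim f1].
by move=> u /h1; apply: sub_add_line.
Qed.

(** The spaces through [S] are pairwise adjacent, and so are their images. By [meet_sub] a third
    image contains the intersection of two of them, unless it lies in their span; by [inZ] that
    happens only if it does so before applying [g]. *)
Lemma pencil_core_meet S X1 X2 : fdim m S -> fdim m.+1 X1 -> fdim m.+1 X2 -> X1 <> X2 ->
  S `<=` X1 -> S `<=` X2 -> pencil_core m g S = g X1 `&` g X2 /\ fdim m (g X1 `&` g X2).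
Proof.
case: (hg) => g1 g2 g3 g4 fS f1 f2 n12 h1 h2.
have adjg X X' : fdim m.+1 X -> fdim m.+1 X' -> X <> X' -> S `<=` X -> S `<=` X' ->
    in_extension (g X) (g X').
  by move=> fX fX' ne hX hX'; apply: in_extension_img => //; exact: pencil_in_extension hX hX'.
have inZ X X' X3 Z Z' : fdim m.+1 X -> fdim m.+1 X' -> X <> X' -> fdim m.+1 X3 ->
    fdim m.+2 Z -> X `<=` Z -> X' `<=` Z -> fdim m.+2 Z' -> g X `<=` Z' -> g X' `<=` Z' ->
    g X3 `<=` Z' -> X3 `<=` Z.
  move=> fX fX' ne f3 fZ hX hX' fZ' kX kX' k3; apply: (orth_closure_sub fZ hX hX'); apply/(orth_closure_img fX fX' f3).
  by apply: sub_orth_closure fZ' kX kX' k3; [exact: g1|exact: g1|exact: img_inj].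
have [Z [fZ z1 z2]] := pencil_in_extension fS f1 f2 n12 h1 h2.
have [Z' [fZ' z1' z2']] := adjg _ _ f1 f2 n12 h1 h2.
split; last by apply: fdim_meet fZ' z1' z2'; [exact: g1|exact: g1|exact: img_inj].
apply/seteqP; split=> [v hv|v vI X3 f3 h3]; first by split; apply: hv.
have [<-|n13] := pselect (X1 = X3); first by case: vI.
have [<-|n23] := pselect (X2 = X3); first by case: vI.
have noZ X X' X4 W : fdim m.+1 X -> fdim m.+1 X' -> fdim m.+1 X4 -> S `<=` X -> S `<=` X' -> S `<=` X4 ->
    X <> X' -> X <> X4 -> X' <> X4 -> fdim m.+2 W -> X `<=` W -> X' `<=` W -> ~ (X4 `<=` W) ->
    g X `&` g X' `<=` g X4.
  move=> fX fX' f4 hX hX' h4 n n' n'' fW w1 w2 nW.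
  have [W' [fW' w1' w2']] := adjg _ _ fX fX' n hX hX'.
  have [W1 [fW1 w11 w12]] := adjg _ _ fX f4 n' hX h4.
  have [W2 [fW2 w21 w22]] := adjg _ _ fX' f4 n'' hX' h4.
  apply: (meet_sub (g1 _ fX) (g1 _ fX') (g1 _ f4) _ _ _ fW' w1' w2' fW1 w11 w12 fW2 w21 w22);
    try exact: img_inj.
  by move=> k4; apply: nW; apply: (inZ _ _ _ _ _ fX fX' n f4 fW w1 w2 fW' w1' w2' k4).
have [h3Z|nZ] := pselect (X3 `<=` Z); last first.
  exact: (noZ X1 X2 X3 Z).
(* [X3] lies in the span [Z] of [X1] and [X2]. An auxiliary [X4] through [S] and a vector [w]
   orthogonal to [Z] is compared with [X1] and [X2] first, and then [X3] with [X1] and [X4]. *)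
have [us [us_m _ hus]] := fdim_basis fZ.
have [|w w0 hw] := hN (us := us).
  by rewrite us_m (leq_trans _ mN) // -addn1 leq_add2l.
have wZ := hus _ hw.
have nZw : ~ Z w by move=> /wZ/dotxx0 e; rewrite e eqxx in w0.
have nSw : ~ S w by move=> /h1/z1.
have f4 := fdim_add_line fS nSw; set X4 := add_line S w in f4.
have w4 : X4 w by apply: mem_add_line; exact: submod_fdim fS.
have h4 : S `<=` X4 by exact: sub_add_line.
have n4 X : X `<=` Z -> X <> X4 by move=> hX e; apply: nZw; apply: hX; rewrite e.
have vI4 : g X4 v.
  apply: (noZ X1 X2 X4 Z) => //; [exact: n4|exact: n4|by move=> /(_ _ w4)].
have n1w : ~ X1 w by move=> /z1.
have fW := fdim_add_line f1 n1w; have lW := submod_fdim fW.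
apply: (noZ X1 X4 X3 (add_line X1 w)) => //; first exact: n4.
- by move=> /esym; apply: n4.
- exact: sub_add_line.
- apply: add_line_min => //; last by apply: mem_add_line; exact: submod_fdim f1.
  by move=> u /h1; apply: sub_add_line.
- move=> hW; apply: n13; apply/esym; apply: (fdim_sub_eq f3 f1) => x X3x.
  have [u [e [Xu xE]]] := hW _ X3x; have := wZ _ (h3Z _ X3x).
  rewrite xE dotDr wZ ?add0r ?dotZr; last exact: z1.
  move/eqP; rewrite mulf_eq0 dot_eq0 (negPf w0) orbF conjC_eq0 => /eqP ->.
  by rewrite scale0r addr0.
- by case: vI.
Qed.

Lemma ex_pencil S : fdim m S -> exists X1 X2, [/\ fdim m.+1 X1, fdim m.+1 X2, X1 <> X2, S `<=` X1 & S `<=` X2].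
Proof.
move=> fS; have mN' : (m.+1 < N)%N by apply: leq_trans mN; rewrite leq_addr.
have [us [us_m _ hus]] := fdim_basis fS.
have [|w w0 hw] := hN (us := us); first by rewrite us_m; apply: ltn_trans mN'.
have [|v v0 hv] := hN (us := w :: us); first by rewrite /= us_m.
have nSw : ~ S w by move=> /(hus _ hw)/dotxx0 e; rewrite e eqxx in w0.
have vS := hus v (fun u uu => hv u (mem_behead (s := w :: us) uu)).
have nSv : ~ S v by move=> /vS/dotxx0 e; rewrite e eqxx in v0.
exists (add_line S w), (add_line S v); split; try exact: fdim_add_line; try exact: sub_add_line.
move=> e; have : add_line S v w by rewrite -e; apply: mem_add_line; exact: submod_fdim fS.
move=> [u [a [Su wE]]]; have := hv w (mem_head _ _); rewrite wE dotDr vS // add0r dotZr.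
move/eqP; rewrite mulf_eq0 dot_eq0 (negPf v0) orbF conjC_eq0 => /eqP a0.
by apply: nSw; rewrite wE a0 scale0r addr0.
Qed.

Lemma pencil_core_fdim S : fdim m S -> fdim m (pencil_core m g S).
Proof. by move=> fS; have [X1 [X2 [f1 f2 n h1 h2]]] := ex_pencil fS; have [->] := pencil_core_meet fS f1 f2 n h1 h2. Qed.

Lemma pencil_core_orth S Y : fdim m S -> fdim r Y -> orthp S Y -> orthp (pencil_core m g S) (h Y).
Proof.
move=> fS fY SY; have [|X [fX SX XY]] := @ex_ext N r m m.+1 Y S hN fY fS SY (leqnSn m).
  by rewrite addnC (leq_trans _ mN) // leq_add2r.
by move=> x y /(_ _ fX SX); apply: (proj1 (c fX fY) XY).
Qed.

End Step.

Lemma pencil_coreK m r N g g' h h' S : fdim_bij m.+1 g g' -> fdim_bij r h h' -> orth_compat m.+1 r g h ->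
  (0 < r)%N -> big_dim N -> (m.+2 + r <= N)%N -> fdim m S -> pencil_core m g' (pencil_core m g S) = S.
Proof.
move=> hg hh c r0 hN mN fS; have [X1 [X2 [f1 f2 n h1 h2]]] := ex_pencil hN mN fS.
have [e fe] := pencil_core_meet hg hh c r0 hN mN fS f1 f2 n h1 h2.
have n' := img_inj hg f1 f2 n; case: (hg) => g1 g2 g3 g4.
have [||-> _] := pencil_core_meet (fdim_bij_sym hg) (fdim_bij_sym hh) (orth_compat_inv hg hh c) r0 hN mN (pencil_core_fdim hg hh c r0 hN mN fS) (g1 _ f1) (g1 _ f2) n'.
- by rewrite e => v [].
- by rewrite e => v [].
rewrite !g3 //; have [Z [fZ z1 z2]] := pencil_in_extension fS f1 f2 n h1 h2.
apply/esym; apply: (fdim_sub_eq fS (fdim_meet f1 f2 n fZ z1 z2)) => v Sv.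
by split; [exact: h1|exact: h2].
Qed.

Lemma to_points m r N g g' h h' : fdim_bij m.+1 g g' -> fdim_bij r h h' -> orth_compat m.+1 r g h ->
  (0 < r)%N -> big_dim N -> (m.+2 + r <= N)%N ->
  exists p p', fdim_bij 1 p p' /\ orth_compat 1 r p h.
Proof.
elim: m g g' => [|m IH] g g' hg hh c r0 hN mN; first by exists g, g'.
have c' := orth_compat_inv hg hh c; have hg' := fdim_bij_sym hg; have hh' := fdim_bij_sym hh.
apply: (IH (pencil_core m.+1 g) (pencil_core m.+1 g')) => //.
- split=> S fS.
  + exact: (pencil_core_fdim hg hh c r0 hN mN fS).
  + exact: (pencil_core_fdim hg' hh' c' r0 hN mN fS).
  + exact: (pencil_coreK hg hh c r0 hN mN fS).
  + exact: (pencil_coreK hg' hh' c' r0 hN mN fS).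
- move=> S Y fS fY; split; first exact: (pencil_core_orth c hN mN fS fY).
  have fgS := pencil_core_fdim hg hh c r0 hN mN fS; case: (hh) => hh1 _ hh3 _.
  move=> /(pencil_core_orth c' hN mN fgS (hh1 _ fY)).
  by rewrite (pencil_coreK hg hh c r0 hN mN fS) hh3.
- by apply: leq_trans mN; rewrite addSn.
Qed.

(** By [sub_orth], inclusion is expressed by orthogonality to [r]-dimensional spaces, on which [g]
    and [p] are both compatible with [h]. *)
Lemma points_sub m r N g g' h h' p p' P X : fdim_bij m g g' -> fdim_bij r h h' -> orth_compat m r g h ->
  fdim_bij 1 p p' -> orth_compat 1 r p h -> (0 < r)%N -> big_dim N -> (m + r <= N)%N ->
  fdim 1 P -> fdim m X -> P `<=` X <-> p P `<=` g X.
Proof.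
move=> hg hh c hp c1 r0 hN mN fP fX; case: (hg) (hh) => g1 _ _ _ [h1 h2 h3 h4].
split=> PX; apply: (sub_orth hN r0 mN _).
- exact: g1.
- move=> Y fY; have fY' := h2 _ fY; rewrite -(h4 _ fY) => /(c _ _ fX fY') XY.
  by apply/(c1 _ _ fP fY') => x y /PX; apply: XY.
- exact: fX.
- move=> Y fY /(c _ _ fX fY) XY; apply/(c1 _ _ fP fY) => x y /PX; exact: XY.
Qed.

End Descent.

(** * Orthogonality preserving maps of points *)

Section Uhlhorn.
Context {C : numClosedFieldType} {H : lmodType C} (dot : {dot H for conjC}).
Implicit Types (x y z u v w : H) (a b c : C).
Local Notation line_proj := (line_proj dot).

Lemma line_proj_perp0 x v : dot (v - line_proj x v) x = 0.
Proof. by have [->|x0] := eqVneq x 0; [rewrite dot0r|apply: line_proj_perp]. Qed.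

(** Gram-Schmidt without case distinctions: [line_proj] at the zero vector is zero, so [p] and [q]
    may be dependent or vanish. *)
Lemma span2 p q r : (forall v, dot v p = 0 -> dot v q = 0 -> dot v r = 0) ->
  exists a b, r = a *: p + b *: q.
Proof.
move=> h; set q1 := q - line_proj p q; set r1 := r - line_proj p r.
have q1p : dot q1 p = 0 by apply: line_proj_perp0.
have r1p : dot r1 p = 0 by apply: line_proj_perp0.
have q1E : q = q1 + line_proj p q by rewrite subrK.
have r1E : r = r1 + line_proj p r by rewrite subrK.
clearbody q1 r1; set r2 := r1 - line_proj q1 r1.
have r2q1 : dot r2 q1 = 0 by apply: line_proj_perp0.
have r2p : dot r2 p = 0 by rewrite /r2 /line_proj !dotE r1p q1p mulr0 subrr.
have r2E : r1 = r2 + line_proj q1 r1 by rewrite subrK.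
clearbody r2; have r2q : dot r2 q = 0.
  by rewrite q1E dotDr r2q1 /line_proj dotZr r2p mulr0 addr0.
have r20 : r2 = 0.
  apply: (dotxx0 (dot := dot)); have := h _ r2p r2q.
  by rewrite {1}r1E {1}r2E /line_proj !dotE r2p r2q1 !mulr0 !addr0.
rewrite r20 add0r in r2E.
exists (dot r p / dot p p - dot r1 q1 / dot q1 q1 * (dot q p / dot p p)), (dot r1 q1 / dot q1 q1).
rewrite {1}r1E {1}r2E /line_proj; apply: (@dot_ext _ _ dot) => z.
have e : dot q z = dot q1 z + dot q p / dot p p * dot p z by rewrite {1}q1E dotDl dotZl.
rewrite !dotE e; ring.
Qed.

Variable phi : H -> H.
Hypotheses (phi0 : forall x, (phi x == 0) = (x == 0))
  (phi_dot : forall x y, dot x y = 0 <-> dot (phi x) (phi y) = 0)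
  (phi_surj : forall y, y != 0 -> exists2 x, x != 0 & parallel (phi x) y)
  (big : big_dim dot 4).

(** The span of two vectors is their double orthogonal complement, which [phi] respects because it
    is onto up to scalars. *)
Lemma phi_span x y a b : exists a' b', phi (a *: x + b *: y) = a' *: phi x + b' *: phi y.
Proof.
apply: span2 => v vx vy; have [->|v0] := eqVneq v 0; first by rewrite dot0l.
have [u u0 [c c0 vE]] := phi_surj v0; move: vx vy; rewrite vE !dotZl.
have z0 p : c * p = 0 -> p = 0 by move/eqP; rewrite mulf_eq0 (negPf c0) => /eqP.
by move=> /z0/(proj2 (phi_dot _ _)) ux /z0/(proj2 (phi_dot _ _)) uy; rewrite (proj1 (phi_dot _ _)) ?mulr0 // !dotE ux uy !mulr0 addr0.
Qed.

Lemma phi_parallel x y : x != 0 -> parallel x y -> parallel (phi x) (phi y).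
Proof.
move=> x0 [c c0 ->]; have [a [b]] := phi_span x 0 c 0.
rewrite scaler0 addr0; have /eqP -> : phi 0 == 0 by rewrite phi0.
rewrite scaler0 addr0 => e; exists a => //; apply: contraTneq c0 => a0.
by move/eqP: e; rewrite a0 scale0r phi0 scaler_eq0 (negPf x0) orbF => /eqP ->; rewrite eqxx.
Qed.

Variables (e e' : H).
Hypotheses (ee : dot e e = 1) (ee' : dot e' e' = 1) (e_par : parallel (phi e) e').

Let e'0 : e' != 0. Proof. by rewrite -(dot_eq0 dot) ee' oner_eq0. Qed.

Lemma phi_e x : dot (phi x) e' = 0 <-> dot x e = 0.
Proof.
case: e_par => c c0 ->; rewrite dotZr; split=> [/eqP|/(proj1 (phi_dot _ _)) ->]; last by rewrite mulr0.
by rewrite mulf_eq0 conjC_eq0 (negPf c0) => /eqP/(proj2 (phi_dot _ _)).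
Qed.

(** A line not orthogonal to [e] has a unique representative [e + v] with [v] orthogonal to [e]; [T]
    is [phi] in these affine charts at [e] and [e']. *)
Lemma ex_T : exists T : H -> H, forall v, dot v e = 0 ->
  dot (T v) e' = 0 /\ parallel (e' + T v) (phi (e + v)).
Proof.
exists (fun v => (dot (phi (e + v)) e')^-1 *: phi (e + v) - e') => v ve.
have h : dot (phi (e + v)) e' != 0.
  by apply/eqP => /phi_e/eqP; rewrite dotDl ee ve addr0 oner_eq0.
split; first by rewrite !dotE mulVf // ee' subrr.
by exists (dot (phi (e + v)) e') => //; rewrite [e' + _]addrC subrK scalerA mulfV // scale1r.
Qed.

Variables (T : H -> H) (hT : forall v, dot v e = 0 ->
  dot (T v) e' = 0 /\ parallel (e' + T v) (phi (e + v))).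

Lemma T_perp v : dot v e = 0 -> dot (T v) e' = 0.
Proof. by move/hT => []. Qed.

Lemma phi_T v : dot v e = 0 -> parallel (e' + T v) (phi (e + v)).
Proof. by move/hT => []. Qed.

Lemma T_uniq v u : dot v e = 0 -> dot u e' = 0 -> parallel (e' + u) (phi (e + v)) -> T v = u.
Proof.
move=> ve ue [c c0 hc]; have [d d0 hd] := phi_T ve.
have E : d *: (e' + T v) = c *: (e' + u) by rewrite -hd.
have dc : d = c.
  have := congr1 (fun x => dot x e') E.
  by rewrite !dotE ee' (T_perp ve) ue !addr0 !mulr1.
apply: (addrI e'); rewrite -[LHS]scale1r -[RHS]scale1r -(mulVf d0) -!scalerA E {1 2}dc //.
by rewrite dc.
Qed.

Lemma T0 : T 0 = 0.
Proof.
by apply: T_uniq; rewrite ?dot0l // !addr0; case: e_par => c c0 ->; exists c^-1; rewrite ?invr_neq0 // scalerA mulVf // scale1r.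
Qed.

(** Since [e] and [e'] are unit vectors, this is orthogonality of [e + v] and [e + w]. *)
Lemma T_m1 v w : dot v e = 0 -> dot w e = 0 -> dot v w = -1 <-> dot (T v) (T w) = -1.
Proof.
move=> ve we; have [c c0 hc] := phi_T ve; have [d d0 hd] := phi_T we.
have := phi_dot (e + v) (e + w); rewrite hc hd !dotE ee ee' ve (dot_sym0 we) (T_perp ve) (dot_sym0 (T_perp we)).
rewrite !addr0 !add0r => h.
have k1 : 1 + dot v w = 0 <-> dot v w = -1.
  by split=> [/eqP|->]; rewrite ?subrr // addrC addr_eq0 => /eqP.
have k2 : c * (d^* * (1 + dot (T v) (T w))) = 0 <-> dot (T v) (T w) = -1.
  split=> [/eqP|->]; last by rewrite subrr !mulr0.
  by rewrite !mulf_eq0 conjC_eq0 (negPf c0) (negPf d0) /= addrC addr_eq0 => /eqP.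
rewrite -k1 -k2 h; rewrite (_ : c * _ = c * (d^* * (1 + dot (T v) (T w)))) //; ring.
Qed.

(** [v] is the difference of [e + v] and [e], so [phi v] lies in the span of [e' + T v] and [e'];
    being orthogonal to [e'], it is a multiple of [T v]. *)
Lemma phi_T0 v : dot v e = 0 -> v != 0 -> parallel (T v) (phi v).
Proof.
move=> ve v0; have [a [b hab]] := phi_span (e + v) e 1 (-1).
rewrite scale1r scaleN1r addrAC addrN add0r in hab.
have [c c0 hc] := phi_T ve; have [d d0 hd] := parallel_sym e_par.
rewrite hc hd !scalerA in hab.
have := proj2 (phi_e v) ve; rewrite {1}hab !dotE ee' (T_perp ve) addr0 !mulr1 => /eqP.
rewrite addrC addr_eq0 => /eqP h.
have E : phi v = (a * c) *: T v by rewrite hab h scalerDr addrAC scaleNr addrN add0r.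
exists (a * c); last exact: E.
apply/negP => /eqP ac0; move: v0.
by rewrite -phi0 E ac0 scale0r eqxx.
Qed.

Lemma T_eq0 v : dot v e = 0 -> (T v == 0) = (v == 0).
Proof.
move=> ve; have [->|v0] := eqVneq v 0; first by rewrite T0 eqxx.
have [c c0 hc] := phi_T0 ve v0; apply: contra_neqF v0 => /eqP h.
by apply/eqP; rewrite -phi0 hc h scaler0.
Qed.

Lemma T_dot0 v w : dot v e = 0 -> dot w e = 0 -> dot v w = 0 <-> dot (T v) (T w) = 0.
Proof.
move=> ve we; have [->|v0] := eqVneq v 0; first by rewrite T0 !dot0l.
have [->|w0] := eqVneq w 0; first by rewrite T0 !dot0r.
have [c c0 hc] := phi_T0 ve v0; have [d d0 hd] := phi_T0 we w0.
rewrite phi_dot hc hd !dotE; split=> [/eqP|->]; last by rewrite !mulr0.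
by rewrite !mulf_eq0 conjC_eq0 (negPf c0) (negPf d0) => /eqP.
Qed.

Lemma T_surj u : dot u e' = 0 -> exists2 v, dot v e = 0 & T v = u.
Proof.
move=> ue; have eu0 : e' + u != 0.
  apply/negP => /eqP /(congr1 (fun x => dot x e')); rewrite dotDl ee' ue addr0 dot0l => /eqP.
  by rewrite oner_eq0.
have [x x0 hx] := phi_surj eu0; have xe : dot x e != 0.
  apply/eqP => /phi_e xe; case: hx => c c0 /(congr1 (fun x => dot x e')).
  by rewrite dotDl ee' ue addr0 dotZl xe mulr0 => /eqP; rewrite oner_eq0.
set v := (dot x e)^-1 *: x - e.
have ve : dot v e = 0 by rewrite /v !dotE mulVf // ee subrr.
exists v => //; apply: T_uniq => //.
have : parallel x (e + v) by exists (dot x e)^-1; rewrite ?invr_neq0 // /v addrC subrK.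
move=> /(phi_parallel x0)[c c0 ->]; case: (parallel_sym hx) => d d0 ->.
by exists (c * d); rewrite ?mulf_neq0 // scalerA.
Qed.

(** Splitting [e + v + w] as [(e + v) + w] leaves only the coefficient of [T w] unknown, splitting
    it as [(e + w) + v] only that of [T v]; orthogonality of the images compares the two. *)
Lemma T_orthD v w : dot v e = 0 -> dot w e = 0 -> dot v w = 0 -> T (v + w) = T v + T w.
Proof.
move=> ve we vw; have [->|v0] := eqVneq v 0; first by rewrite T0 !add0r.
have [->|w0] := eqVneq w 0; first by rewrite T0 !addr0.
have vwe : dot (v + w) e = 0 by rewrite dotDl ve we addr0.
have key x y : dot x e = 0 -> dot y e = 0 -> y != 0 -> exists b, T (x + y) = T x + b *: T y.
  move=> xe ye y0; have [a [b]] := phi_span (e + x) y 1 1; rewrite !scale1r -addrA.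
  have xye : dot (x + y) e = 0 by rewrite dotDl xe ye addr0.
  have [c c0 ->] := phi_T xye; have [d d0 ->] := phi_T xe; have [f f0 ->] := phi_T0 ye y0.
  rewrite !scalerA => E; have := congr1 (fun x => dot x e') E.
  rewrite !dotE ee' !T_perp // !mulr0 !addr0 !mulr1 => ca.
  exists (c^-1 * (b * f)); apply: (addrI e'); apply: (scalerI c0).
  by rewrite E -ca; apply: (@dot_ext _ _ dot) => z; rewrite !dotE; field.
have [b E] := key _ _ ve we w0; have [a E'] := key _ _ we ve v0.
have TT := proj1 (T_dot0 ve we) vw.
have : b = 1.
  have := congr1 (fun x => dot x (T w)) E; rewrite addrC E' !dotE TT mulr0 addr0 add0r.
  by move/eqP; rewrite -{1}[dot _ _]mul1r (inj_eq (mulIf _)) ?dot_eq0 ?T_eq0 // => /eqP.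
by move=> b1; rewrite E b1 scale1r.
Qed.

Lemma T_scale c v : dot v e = 0 -> exists b, T (c *: v) = b *: T v.
Proof.
move=> ve; have [->|v0] := eqVneq v 0; first by exists 0; rewrite scaler0 T0 scaler0.
have cve : dot (c *: v) e = 0 by rewrite dotZl ve mulr0.
have [c0|c0] := eqVneq c 0; first by exists 0; rewrite c0 !scale0r T0.
have cv0 : c *: v != 0 by rewrite scaler_eq0 negb_or c0.
have [a a0 h] := phi_T0 ve v0; have [b b0] := phi_T0 cve cv0.
have [|d d0 ->] := @phi_parallel v (c *: v) v0; first by exists c.
rewrite h scalerA => E; exists (b^-1 * (d * a)); rewrite -scalerA E scalerA mulVf // scale1r //.
Qed.

Lemma ex_perp3 u v w : exists x, [/\ x != 0, dot x u = 0, dot x v = 0 & dot x w = 0].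
Proof.
have [//|x x0 h] := big (us := [:: u; v; w]); exists x; split=> //; apply: h; rewrite !inE eqxx ?orbT //.
Qed.

(** For orthogonal [u] and [w], scaling [u + w] forces equal factors. Any [v] is linked to the
    reference vector [v0] through a vector orthogonal to [e], [v0] and [v], which exists in
    dimension 4. *)
Lemma ex_sigma : exists s : C -> C, forall c v, dot v e = 0 -> T (c *: v) = s c *: T v.
Proof.
have [v0 [v00 v0e _ _]] := ex_perp3 e e e.
have [s hs] := choice (fun c => T_scale c v0e).
exists s => c; suff h u w : dot u e = 0 -> dot w e = 0 -> u != 0 -> dot u w = 0 ->
    T (c *: u) = s c *: T u -> T (c *: w) = s c *: T w.
  move=> v ve; have [u [u0 ue uv0 uv]] := ex_perp3 e v0 v.
  apply: (h _ _ ue ve u0 uv); apply: (h _ _ v0e ue v00 (dot_sym0 uv0) (hs c)).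
move=> ue we u0 uw hu; have [->|w0] := eqVneq w 0; first by rewrite scaler0 T0 scaler0.
have [a ha] := T_scale c we.
have uwe : dot (u + w) e = 0 by rewrite dotDl ue we addr0.
have [b] := T_scale c uwe; rewrite scalerDr !T_orthD ?dotZl ?dotZr ?ue ?we ?uw ?mulr0 //.
rewrite hu ha => E; have TT := proj1 (T_dot0 ue we) uw; have TT' := dot_sym0 TT.
have e1 : s c = b.
  have := congr1 (fun x => dot x (T u)) E; rewrite !dotE TT' mulr0 !addr0 => /(mulIf _) -> //.
  by rewrite dot_eq0 T_eq0.
have e2 : a = b.
  have := congr1 (fun x => dot x (T w)) E; rewrite !dotE TT mulr0 !add0r => /(mulIf _) -> //.
  by rewrite dot_eq0 T_eq0.
by rewrite e2 e1.
Qed.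

Section Sigma.
Variables (s : C -> C) (hs : forall c v, dot v e = 0 -> T (c *: v) = s c *: T v).

Let ex0 : exists v, [/\ v != 0, dot v e = 0 & T v != 0].
Proof. by have [v [v0 ve _ _]] := ex_perp3 e e e; exists v; rewrite T_eq0. Qed.

Lemma sigma1 : s 1 = 1.
Proof.
have [v [v0 ve Tv]] := ex0; have := hs 1 ve; rewrite scale1r -{1}[T v]scale1r => /eqP.
by rewrite -subr_eq0 -scalerBl scaler_eq0 (negPf Tv) orbF subr_eq0 => /eqP.
Qed.

Lemma sigmaM a b : s (a * b) = s a * s b.
Proof.
have [v [v0 ve Tv]] := ex0; have bve : dot (b *: v) e = 0 by rewrite dotZl ve mulr0.
have := hs (a * b) ve; rewrite -scalerA hs // hs // scalerA => /eqP.
by rewrite -subr_eq0 -scalerBl scaler_eq0 (negPf Tv) orbF subr_eq0 => /eqP.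
Qed.

(** [T] is so far additive on orthogonal pairs only, so [a v] and [b v] are made orthogonal by
    adding multiples of a second vector [u]; the coefficient of [T v] is then compared. *)
Lemma sigmaD a b : s (a + b) = s a + s b.
Proof.
have [v [v0 ve Tv]] := ex0; have [u [u0 ue uv _]] := ex_perp3 e v v.
have Tu : T u != 0 by rewrite T_eq0.
have vu := dot_sym0 uv; have TT := proj1 (T_dot0 ue ve) uv.
have he (x y : C) : dot (x *: v + y *: u) e = 0 by rewrite !dotE ue ve !mulr0 addr0.
have TE (x y : C) : T (x *: v + y *: u) = s x *: T v + s y *: T u.
  by rewrite T_orthD ?hs // !dotE ?ue ?ve ?vu ?mulr0.
(* [c] makes [a v + u] and [b v + c u] orthogonal *)
pose c := - (a * b^* * dot v v / dot u u)^*.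
have o : dot (a *: v + 1 *: u) (b *: v + c *: u) = 0.
  rewrite !dotE uv vu /c rmorphN /= conjCK !mulr0 addr0 add0r mul1r mulNr divfK ?dot_eq0 //.
  by rewrite mulrA subrr.
have := T_orthD (he a 1) (he b c) o.
have -> : a *: v + 1 *: u + (b *: v + c *: u) = (a + b) *: v + (1 + c) *: u.
  by apply: (@dot_ext _ _ dot) => z; rewrite !dotE; ring.
rewrite !TE => /(congr1 (fun x => dot x (T v))); rewrite !dotE TT !mulr0 !addr0 -mulrDl.
by move/(mulIf _) -> => //; rewrite dot_eq0.
Qed.

Lemma T_add v w : dot v e = 0 -> dot w e = 0 -> T (v + w) = T v + T w.
Proof.
move=> ve we; have [->|v0] := eqVneq v 0; first by rewrite T0 !add0r.
set a := dot w v / dot v v; set r := w - a *: v.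
have rv : dot r v = 0 by apply: line_proj_perp0.
have re : dot r e = 0 by rewrite /r !dotE ve we mulr0 subrr.
have wE : w = a *: v + r by rewrite addrC subrK.
clearbody r.
have av (x : C) : dot (x *: v) e = 0 by rewrite dotZl ve mulr0.
have vr (x : C) : dot (x *: v) r = 0 by rewrite dotZl (dot_sym0 rv) mulr0.
have -> : v + w = (1 + a) *: v + r by rewrite {1}wE addrA scalerDl scale1r.
rewrite T_orthD // hs // sigmaD sigma1 [in RHS]wE T_orthD // (hs a ve).
by rewrite addrA scalerDl scale1r.
Qed.

Lemma sigma0 : s 0 = 0.
Proof. by apply: (addrI (s 0)); rewrite -sigmaD !addr0. Qed.

Lemma sigmaN a : s (- a) = - s a.
Proof. by apply: (addrI (s a)); rewrite -sigmaD !subrr sigma0. Qed.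

Lemma sigmaV a : a != 0 -> s a^-1 = (s a)^-1.
Proof.
move=> a0; have := sigmaM a a^-1; rewrite mulfV // sigma1 => h.
have sa0 : s a != 0 by apply: contra_eq_neq h => ->; rewrite mul0r oner_eq0.
by apply: (mulfI sa0); rewrite -h mulfV.
Qed.

(** A nonzero inner product is rescaled to [-1] in the second argument, where [T_m1] applies. *)
Lemma T_dot_conj v w : dot v e = 0 -> dot w e = 0 -> dot (T v) (T w) = (s (dot v w)^*)^*.
Proof.
move=> ve we; have [vw|vw] := eqVneq (dot v w) 0.
  by rewrite (proj1 (T_dot0 ve we) vw) vw conjC0 sigma0 conjC0.
set t := (dot v w)^*; have t0 : t != 0 by rewrite conjC_eq0.
have tw : dot (- t^-1 *: w) e = 0 by rewrite dotZl we mulr0.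
have : dot v (- t^-1 *: w) = -1.
  by rewrite dotZr rmorphN fmorphV /= conjCK mulNr mulVf.
move/(T_m1 ve tw); rewrite hs // dotZr sigmaN sigmaV // rmorphN fmorphV /= mulNr => /eqP.
rewrite eqr_opp => /eqP h; have st0 : (s t)^* != 0.
  by apply: contra_eq_neq h => ->; rewrite invr0 mul0r eq_sym oner_eq0.
by rewrite -[LHS]mul1r -(mulfV st0) -mulrA h mulr1.
Qed.

(** Hermitian symmetry of [dot], applied to [T_dot_conj] in both orders. *)
Lemma sigma_conj a : s a^* = (s a)^*.
Proof.
have [v [v0 ve Tv]] := ex0; pose w := (a / dot v v) *: v.
have we : dot w e = 0 by rewrite dotZl ve mulr0.
have wv : dot w v = a by rewrite dotZl divfK // dot_eq0.
have := dotC dot (T v) (T w); rewrite !T_dot_conj // (dotC dot w v) wv !conjCK => <-.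
by rewrite conjCK.
Qed.

Lemma T_dot v w : dot v e = 0 -> dot w e = 0 -> dot (T v) (T w) = s (dot v w).
Proof. by move=> ve we; rewrite T_dot_conj // sigma_conj conjCK. Qed.

Definition extU x := s (dot x e) *: e' + T (x - dot x e *: e).

Let rest x : dot (x - dot x e *: e) e = 0. Proof. by rewrite !dotE ee mulr1 subrr. Qed.

Lemma extU_lin a x y : extU (a *: x + y) = s a *: extU x + extU y.
Proof.
have re z (c : C) : dot (c *: (z - dot z e *: e)) e = 0 by rewrite dotZl rest mulr0.
rewrite /extU; have -> : a *: x + y - dot (a *: x + y) e *: e =
    a *: (x - dot x e *: e) + (y - dot y e *: e).
  by apply: (@dot_ext _ _ dot) => z; rewrite !dotE; ring.
rewrite (T_add (re x a) (rest y)) (hs a (rest x)) dotDl dotZl sigmaD sigmaM.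
by apply: (@dot_ext _ _ dot) => z; rewrite !dotE; ring.
Qed.

Lemma extU_dot x y : dot (extU x) (extU y) = s (dot x y).
Proof.
rewrite /extU !dotDl !dotDr !dotZl !dotZr ee' T_perp // (dot_sym0 (T_perp (rest y))) T_dot //.
rewrite -sigma_conj !mulr0 addr0 add0r mulr1 -sigmaM -sigmaD; congr s.
by rewrite !dotE ee [dot e y](dotC dot y e); ring.
Qed.

Lemma extU_parallel x : x != 0 -> parallel (extU x) (phi x).
Proof.
move=> x0; have [xe|xe] := eqVneq (dot x e) 0.
  by rewrite /extU xe sigma0 !scale0r add0r subr0; apply: phi_T0.
set a := dot x e in xe *; set v := a^-1 *: (x - a *: e).
have ve : dot v e = 0 by rewrite dotZl rest mulr0.
have xE : x = a *: (e + v) by rewrite /v scalerDr scalerA mulfV // scale1r addrC subrK.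
have sa0 : s a != 0.
  apply/negP => /eqP sa0; have := sigmaM a a^-1; rewrite mulfV // sigma1 sa0 mul0r => /eqP.
  by rewrite oner_eq0.
have -> : extU x = s a *: (e' + T v).
  rewrite /extU -/a (_ : x - a *: e = a *: v) ?hs ?scalerDr //.
  by rewrite /v scalerA mulfV // scale1r.
have op_horner0 : e + v != 0 by apply: contraNneq x0 => e0'; rewrite xE e0' scaler0.
have [c c0 hc] := phi_T ve; have [|d d0 hd] := @phi_parallel (e + v) x op_horner0; first by exists a.
exists (d * c / s a); first by rewrite !mulf_neq0 ?invr_eq0.
by rewrite hd hc !scalerA divfK.
Qed.

Lemma extU_surj y : (forall b, exists a, s a = b) -> exists x, extU x = y.
Proof.
have ye : dot (y - dot y e' *: e') e' = 0 by rewrite !dotE ee' mulr1 subrr.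
move=> ss; have [v ve Tv] := T_surj ye.
have [a sa] := ss (dot y e'); exists (a *: e + v).
have -> : extU (a *: e + v) = s a *: e' + T v.
  rewrite /extU !dotE ee ve addr0 mulr1; congr (_ + T _).
  by rewrite addrAC addrN add0r.
by rewrite Tv sa addrC subrK.
Qed.

End Sigma.

End Uhlhorn.

(** * Ring endomorphisms of the real and the complex numbers *)

Section RealEndo.
Variable R : realType.

Lemma real_endo_id (f : R -> R) : (forall x y, f (x + y) = f x + f y) ->
  (forall x y, f (x * y) = f x * f y) -> f 1 = 1 -> forall x, f x = x.
Proof.
move=> fD fM f1; have f0 : f 0 = 0 by apply: (addrI (f 0)); rewrite -fD !addr0.
have fN x : f (- x) = - f x by apply: (addrI (f x)); rewrite -fD !subrr f0.
have fn m : f m%:R = m%:R by elim: m => [|m IH]; rewrite ?f0 // -natr1 fD IH f1.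
have fpos x : 0 <= x -> 0 <= f x by move=> /sqr_sqrtr <-; rewrite expr2 fM -expr2 sqr_ge0.
have fle x y : x <= y -> f x <= f y by rewrite -subr_ge0 => /fpos; rewrite fD fN subr_ge0.
suff h x : 0 <= x -> f x = x.
  move=> x; have [/h //|x0] := leP 0 x.
  have nx : 0 <= - x by rewrite oppr_ge0 ltW.
  by apply: oppr_inj; rewrite -fN h.
move=> x0; apply/eqP; rewrite -subr_eq0; apply: contraT => d0.
(* [f] is monotone, as it preserves squares, and fixes the integers; so [m x] and its image lie in
   the same unit interval, for every [m]. *)
have bound m : `|m%:R * (f x - x)| <= 1.
  have mx : 0 <= m%:R * x by rewrite mulr_ge0.
  have /andP[t1 t2] := truncn_itv mx.
  have := fle _ _ t1; have := fle _ _ (ltW t2); rewrite !fn fM fn => k2 k1.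
  rewrite mulrBr ler_norml; move: t2 k2; rewrite -natr1 => t2 k2.
  by apply/andP; split; lra.
have dp : 0 < `|f x - x| by rewrite normr_gt0.
have := bound (truncn (`|f x - x|^-1)).+1; rewrite normrM ger0_norm // leNgt.
by rewrite -ltr_pdivrMr // mul1r truncnS_gt.
Qed.

(** Commuting with conjugation makes [s] map reals to reals, hence fix them; the image of the
    imaginary unit is a square root of -1. *)
Lemma complex_endo (s : R[i] -> R[i]) : (forall x y, s (x + y) = s x + s y) ->
  (forall x y, s (x * y) = s x * s y) -> s 1 = 1 -> (forall x, s (conjC x) = conjC (s x)) ->
  s =1 id \/ s =1 conjC.
Proof.
move=> sD sM s1 sJ.
have sR r : s r%:C = (complex.Re (s r%:C))%:C.
  rewrite RRe_real // CrealE; have := sJ r%:C; rewrite [conjC r%:C](_ : _ = r%:C).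
    by move=> /esym/eqP.
  by rewrite -[LHS]/(conjc r%:C) conjc_real.
have h : forall r, complex.Re (s r%:C) = r.
  apply: real_endo_id.
  - by move=> x y; rewrite rmorphD sD raddfD.
  - by move=> x y; rewrite rmorphM sM {1}(sR x) {1}(sR y) -rmorphM.
  - by rewrite rmorph1 s1.
have sC r : s r%:C = r%:C by rewrite sR h.
have e1 : (-1)%:C = -1 :> R[i] by rewrite rmorphN rmorph1.
have si : s 'i%C * s 'i%C = -1 by rewrite -sM -expr2 sqr_i -e1 sC.
have : (s 'i%C - 'i%C) * (s 'i%C + 'i%C) = 0.
  by rewrite -subr_sqr !expr2 si -expr2 sqr_i subrr.
move/eqP; rewrite mulf_eq0 subr_eq0 addr_eq0 => /orP[/eqP e|/eqP e]; [left|right] => x.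
  by rewrite [x in LHS]complexE sD sM e !sC -complexE.
rewrite [x in LHS]complexE sD sM e !sC; case: x => x y /=.
by rewrite -[RHS]/(conjc _) /=; simpc.
Qed.

End RealEndo.

(** * Automorphisms of the graph of decompositions *)

Section Points.
Context {C : numClosedFieldType} {H : lmodType C} (dot : {dot H for conjC}).
Context {k : nat} (n : 'I_k -> option nat).
Hypothesis n_inf : forall i j, n i = None -> n j = None -> i = j.
Hypothesis n_gt1 : forall i m, n i = Some m -> (1 < m)%N.
Hypothesis k_gt2 : (2 < k)%N.
Implicit Types (X Y Z M P : set H) (x y z u v w : H) (A B D E : 'I_k -> set H) (i j l s t : 'I_k).
Implicit Types (F G : ('I_k -> set H) -> ('I_k -> set H)) (d : {perm 'I_k}).
Local Notation is_decomp := (is_decomp dot n).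
Local Notation fdim := (fdim dot).
Local Notation adj_iso := (adj_iso dot n).
Local Notation is_type_perm := (is_type_perm dot n).
Local Notation orthp := (orthp dot).

Lemma fdim_join p q X Y : fdim p X -> fdim q Y -> orthp X Y ->
  exists Z, [/\ fdim (p + q) Z, X `<=` Z, Y `<=` Z &
    forall v, (forall x, X x -> dot v x = 0) -> (forall y, Y y -> dot v y = 0) -> forall z, Z z -> dot v z = 0].
Proof.
move=> fX; elim: q Y => [|q IH] Y fY XY.
  rewrite addn0; exists X; split=> // y.
  by rewrite fY => ->; apply: submod0 (submod_fdim fX).
case: (fY) => lY [y [Yy y0 fy]].
have [|Z [fZ XZ YZ hZ]] := IH _ fy; first by move=> x z Xx [Yz _]; apply: XY.
have yZ z : Z z -> dot y z = 0.
  move=> Zz; apply: (hZ y) Zz => [x Xx|w [_ wy]]; by apply: dot_sym0 => //; apply: XY.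
have nZy : ~ Z y by move=> /yZ/dotxx0 e; rewrite e eqxx in y0.
have lZ := submod_fdim fZ; rewrite addnS; exists (add_line Z y); split.
- exact: fdim_add_line.
- by move=> x /XZ Zx; apply: sub_add_line.
- move=> z Yz; have [w pw ->] := perpP dot lY Yy y0 Yz.
  apply: (submodD (submod_add_line y lZ)); last by apply: sub_add_line; apply: YZ.
  by apply: (submodZ _ (submod_add_line y lZ)); apply: mem_add_line.
- move=> v hX hY _ [z [c [Zz ->]]]; rewrite dotDr dotZr (hY _ Yy) mulr0 addr0.
  by apply: hZ => // w [Yw _]; apply: hY.
Qed.

(** A third space contributes two orthogonal vectors; this is the room that the descent needs for
    its auxiliary vectors. *)
Lemma dec_big A i j m r : is_decomp A -> i != j -> n i = Some m -> n j = Some r -> big_dim dot (m + r).+2.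
Proof.
move=> dA ij ni nj us us_s.
have fi : fdim m (A i) by have := dec_dim dA i; rewrite ni.
have fj : fdim r (A j) by have := dec_dim dA j; rewrite nj.
have [|Z [fZ h1 h2 hZ]] := fdim_join fi fj; first by move=> x y; exact: (dec_orth dA ij).
have [l [li lj]] := ex_third i j k_gt2.
have [u Au u0] := dec_neq0 n_gt1 dA l; have [v [Av v0 vu]] := dec_ex1 n_gt1 dA l u.
have lZ w : A l w -> forall z, Z z -> dot w z = 0.
  by move=> Aw; apply: hZ => x; [apply: (dec_orth dA li)|apply: (dec_orth dA lj)].
have nu : ~ Z u by move=> /(lZ _ Au)/dotxx0 e; rewrite e eqxx in u0.
have fZ1 := fdim_add_line fZ nu.
have nv : ~ add_line Z u v.
  move=> [z [c [Zz e]]]; have := lZ _ Av _ Zz; move: v0; rewrite -(dot_eq0 dot).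
  by rewrite {2}e dotDr dotZr vu mulr0 addr0 => /negP h h'; apply: h; apply/eqP.
have fZ2 := fdim_add_line fZ1 nv.
have [|w [_ w0 hw]] := @ex_perp _ _ dot (add_line (add_line Z u) v) us (submod_fdim fZ2).
  by move=> p fp; rewrite (fdim_uniq fp fZ2).
by exists w.
Qed.

Definition typed_iso F G d := adj_iso F G /\ forall A, is_decomp A -> is_type_perm F d A.

Lemma typed_iso_sym F G d : typed_iso F G d -> typed_iso G F (d^-1)%g.
Proof.
move=> [hF hd]; split; first exact: adj_iso_sym.
move=> A dA; case: (hF) => _ dG _ GK _; have dGA := dG _ dA.
by rewrite -[X in is_type_perm _ _ X](GK _ dA); apply: (type_perm_inv hF dGA (hd _ dGA)).
Qed.

(** By [reach_img] the value does not depend on the decomposition [A] through which it is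
    computed. *)
Definition space_img F d t X : set H := xget set0 [set Y | exists A, [/\ is_decomp A, A t = X & Y = F A (d t)]].

Section Img.
Variables (F G : ('I_k -> set H) -> ('I_k -> set H)) (d : {perm 'I_k}) (hF : typed_iso F G d).

Lemma typed_iso_dec A : is_decomp A -> is_decomp (F A).
Proof. by move=> dA; case: hF => -[h _ _ _ _] _; apply: h. Qed.

Lemma space_imgE t A : is_decomp A -> space_img F d t (A t) = F A (d t).
Proof.
move=> dA; rewrite /space_img; case: xgetP => [Y -> [B [dB BA ->]]|/(_ (F A (d t)))]; last by case; exists A.
case: hF => hF' hd; exact: (reach_img n_inf n_gt1 k_gt2 hF' dB dA (hd _ dB) BA).
Qed.

Lemma ex_dec1 A0 t m X : is_decomp A0 -> n t = Some m -> fdim m X -> exists2 A, is_decomp A & A t = X.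
Proof.
move=> dA0 nt fX; have [||A hA At] := reach_space (I := pred0) dA0 _ nt fX => //.
by exists A => //; apply: (reach_dec dA0 hA).
Qed.

Lemma ex_dec2 A0 i j m r X Y : is_decomp A0 -> i != j -> n i = Some m -> n j = Some r ->
  fdim m X -> fdim r Y -> orthp X Y -> exists A, [/\ is_decomp A, A i = X & A j = Y].
Proof.
move=> dA0 ij ni nj fX fY XY; have [A dA Ai] := ex_dec1 dA0 ni fX.
have [||B hB Bj] := reach_space (I := pred1 i) dA _ nj fY.
- by rewrite /= eq_sym.
- by move=> s /eqP -> y x Yy; rewrite Ai => Xx; apply: dot_sym0; apply: XY.
exists B; split=> //; first exact: (reach_dec dA hB).
by rewrite (reach_fix hB (t := i)) //= eqxx.
Qed.

Lemma typed_iso_dim A0 t : is_decomp A0 -> n (d t) = n t.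
Proof. by move=> dA0; case: hF => hF' hd; apply: (type_perm_dim n_inf n_gt1 k_gt2 t hF' dA0 (hd _ dA0)). Qed.

Lemma space_img_orth A0 i j m r X Y : is_decomp A0 -> i != j -> n i = Some m -> n j = Some r ->
  fdim m X -> fdim r Y -> orthp X Y -> orthp (space_img F d i X) (space_img F d j Y).
Proof.
move=> dA0 ij ni nj fX fY XY; have [A [dA <- <-]] := ex_dec2 dA0 ij ni nj fX fY XY.
rewrite !space_imgE // => x y; apply: (dec_orth (typed_iso_dec dA)); by rewrite (inj_eq perm_inj).
Qed.

End Img.

Section Img2.
Variables (F G : ('I_k -> set H) -> ('I_k -> set H)) (d : {perm 'I_k}) (hF : typed_iso F G d).
Variables (A0 : 'I_k -> set H) (dA0 : is_decomp A0).
Let hG := typed_iso_sym hF.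
Let imgF t := space_img F d t.
Let imgG t := space_img G (d^-1)%g (d t).

Let FK A : is_decomp A -> G (F A) = A. Proof. by case: hF => -[_ _ h _ _] _; apply: h. Qed.
Let GK A : is_decomp A -> F (G A) = A. Proof. by case: hF => -[_ _ _ h _] _; apply: h. Qed.

Lemma space_img_bij t m : n t = Some m -> fdim_bij dot m (imgF t) (imgG t).
Proof.
move=> nt; have ndt : n (d t) = Some m by rewrite (typed_iso_dim hF t dA0).
split=> X fX.
- have [A dA <-] := ex_dec1 dA0 nt fX; rewrite /imgF (space_imgE hF) //.
  by have := dec_dim (typed_iso_dec hF dA) (d t); rewrite ndt.
- have [A dA <-] := ex_dec1 dA0 ndt fX; rewrite /imgG (space_imgE hG) // permK.
  by have := dec_dim (typed_iso_dec hG dA) t; rewrite nt.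
- have [A dA <-] := ex_dec1 dA0 nt fX; rewrite /imgF /imgG (space_imgE hF) // (space_imgE hG) ?permK ?FK //.
  exact: typed_iso_dec hF _ dA.
- have [A dA <-] := ex_dec1 dA0 ndt fX; rewrite /imgF /imgG (space_imgE hG) // permK (space_imgE hF) ?GK //.
  exact: typed_iso_dec hG _ dA.
Qed.

Lemma space_img_compat i j m r : i != j -> n i = Some m -> n j = Some r -> orth_compat dot m r (imgF i) (imgF j).
Proof.
move=> ij ni nj X Y fX fY; split; first exact: (space_img_orth hF dA0 ij ni nj fX fY).
have [g1 g2 g3 g4] := space_img_bij ni; have [h1 h2 h3 h4] := space_img_bij nj.
have ndi : n (d i) = Some m by rewrite (typed_iso_dim hF i dA0).
have ndj : n (d j) = Some r by rewrite (typed_iso_dim hF j dA0).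
have dij : d i != d j by rewrite (inj_eq perm_inj).
move=> /(space_img_orth hG dA0 dij ndi ndj (g1 _ fX) (h1 _ fY)).
by rewrite -/(imgG i _) -/(imgG j _) g3 // h3.
Qed.

Definition line x : set H := [set a *: x | a in [set: C]].

Lemma line_orth x y : orthp (line x) (line y) <-> dot x y = 0.
Proof.
split=> [h|xy _ _ [a _ <-] [b _ <-]]; last by rewrite dotZl dotZr xy !mulr0.
by apply: h; exists 1; rewrite ?scale1r.
Qed.

Lemma line_sub x X : submod X -> line x `<=` X <-> X x.
Proof.
move=> lX; split=> [h|Xx _ [a _ <-]]; last exact: submodZ.
by apply: h; exists 1; rewrite ?scale1r.
Qed.

Lemma line_parallel x y : y != 0 -> line x = line y -> parallel x y.
Proof.
move=> y0 e; have : line y y by exists 1; rewrite ?scale1r.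
rewrite -e => -[a _ ay]; exists a => //; apply: contraNneq y0 => a0.
by rewrite -ay a0 scale0r.
Qed.

Lemma ex_dec_vector A l t x : is_decomp A -> l != t -> x != 0 -> (forall y, A l y -> dot x y = 0) ->
  exists B, [/\ is_decomp B, B l = A l & B t x].
Proof.
move=> dA lt x0 xA; have [u Au u0] := dec_neq0 n_gt1 dA t.
have It : ~~ pred1 l t by rewrite /= eq_sym.
have hI s : pred1 l s -> forall v, A s v -> dot x v = 0 by move=> /eqP ->.
have hD : set0 `<=` A t by move=> ? [].
have xD v : set0 v -> dot x v = 0 by case.
have hu : exists u, [/\ A t u, u != 0 & forall v, set0 v -> dot u v = 0] by exists u; split=> // ? [].
have [B [hB Bx _]] := reach_vector dA It x0 hI hD xD hu.
exists B; split=> //; first exact: (reach_dec dA hB).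
by rewrite (reach_fix hB (t := l)) //= eqxx.
Qed.

Section OnePoint.
Variables (i : 'I_k) (m : nat) (p p' : set H -> set H).
Hypotheses (ni : n i = Some m) (hp : fdim_bij dot 1 p p').
Hypothesis p_sub : forall P X, fdim 1 P -> fdim m X -> P `<=` X <-> p P `<=` imgF i X.

(** [x] is orthogonal to [A l] exactly when some decomposition with the same [l]-th space has [x] in
    its [i]-th one, and [F] and [p] preserve this. The index [l] may be the infinite one. *)
Lemma point_orth A l x y : is_decomp A -> l != i -> x != 0 -> y != 0 -> p (line x) = line y ->
  (forall z, A l z -> dot x z = 0) <-> (forall z, F A (d l) z -> dot y z = 0).
Proof.
move=> dA li x0 y0 pxy; have [hF' hd] := hF.
have fx : fdim 1 (line x) by exact: fdim_line.
have dli : d l != d i by rewrite (inj_eq perm_inj).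
split=> h.
  have [B [dB Bl Bx]] := ex_dec_vector dA li x0 h.
  have fB : fdim m (B i) by have := dec_dim dB i; rewrite ni.
  have dFB := typed_iso_dec hF dB.
  have : p (line x) `<=` imgF i (B i) by exact/(p_sub fx fB)/(line_sub x (submod_dec dB i)).
  rewrite pxy /imgF (space_imgE hF) // => /(line_sub _ (submod_dec dFB (d i))) Fy z.
  rewrite -(reach_img n_inf n_gt1 k_gt2 hF' dB dA (hd _ dB) Bl) => Fz.
  by apply: (dec_orth dFB _ Fy Fz); rewrite eq_sym.
have dFA := typed_iso_dec hF dA.
have [B' [dB' Bl By]] := ex_dec_vector dFA dli y0 h.
have dB := typed_iso_dec hG dB'; have BE := GK dB'; set B := G B' in dB BE.
rewrite -BE in Bl By.
have Bl' : B l = A l.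
  have [hG' hd'] := hG.
  have := reach_img n_inf n_gt1 k_gt2 hG' (typed_iso_dec hF dB) dFA (hd' _ (typed_iso_dec hF dB)) Bl.
  by rewrite permK !FK.
have fB : fdim m (B i) by have := dec_dim dB i; rewrite ni.
have : p (line x) `<=` imgF i (B i).
  by rewrite pxy /imgF (space_imgE hF) //; exact/(line_sub y (submod_dec (typed_iso_dec hF dB) (d i))).
move=> /(p_sub fx fB)/(line_sub _ (submod_dec dB i)) Bx z; rewrite -Bl' => Bz.
by apply: (dec_orth dB _ Bx Bz); rewrite eq_sym.
Qed.

End OnePoint.

(** If the images were different lines of [u] and [w], a decomposition could have its [l]-th space
    orthogonal to [u] but not to [w]. By [point_orth] at [i] and at [j], both conditions say that
    [x] is orthogonal to the [l]-th space of the preimage. *)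
Lemma points_eq i j m r p p' q q' :
  i != j -> n i = Some m -> n j = Some r -> fdim_bij dot 1 p p' -> fdim_bij dot 1 q q' ->
  (forall P X, fdim 1 P -> fdim m X -> P `<=` X <-> p P `<=` imgF i X) ->
  (forall P X, fdim 1 P -> fdim r X -> P `<=` X <-> q P `<=` imgF j X) ->
  forall P, fdim 1 P -> p P = q P.
Proof.
move=> ij ni nj hp hq hpi hqj P fP; have [x x0 PE] := fdim1P fP.
have [p1 _ _ _] := hp; have [q1 _ _ _] := hq.
have [u u0 pE] := fdim1P (p1 _ fP); have [w w0 qE] := fdim1P (q1 _ fP).
rewrite -/(line _) in PE pE qE.
have [[c c0 wu]|nuw] := pselect (parallel u w).
  rewrite pE qE wu; apply/seteqP; split=> _ [a _ <-].
    by exists (a / c) => //; rewrite scalerA divfK.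
  by exists (a * c) => //; rewrite scalerA.
exfalso; have [l [li lj]] := ex_third i j k_gt2.
have w'0 := not_parallel dot u0 w0 nuw; set w' := w - line_proj dot u w in w'0.
have w'u : dot w' u = 0 by exact: line_proj_perp.
have mN := dec_big dA0 ij ni nj.
have ndi : n (d i) = Some m by rewrite (typed_iso_dim hF i dA0).
have dli : d l != d i by rewrite (inj_eq perm_inj).
(* [X] contains [u] and is orthogonal to the part [w'] of [w] orthogonal to [u]; with [X] in place
   at [d i], the vector [w'] can be moved into the space at [d l]. *)
have [|||X [fX uX Xw]] := ex_ext (r := m) mN (fdim_line dot w'0) (fdim_line dot u0).
- by apply/line_orth; apply: dot_sym0.
- by apply: ltnW; apply: n_gt1 ni.
- by rewrite add1n ltnS leqW // leq_addr.
have [A1 dA1 A1i] := ex_dec1 dA0 ndi fX.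
have dil : d i != d l by rewrite eq_sym.
have [|A2 [dA2 A2i A2w]] := @ex_dec_vector A1 (d i) (d l) w' dA1 dil w'0.
  by rewrite A1i => z Xz; apply: dot_sym0; apply: Xw Xz _; exists 1; rewrite ?scale1r.
have dA := typed_iso_dec hG dA2; have AE := GK dA2; set A := G A2 in dA AE.
have h1 : forall z, F A (d l) z -> dot u z = 0.
  rewrite AE => z; apply: (dec_orth dA2) => //; first by rewrite eq_sym; exact: dli.
  by rewrite A2i A1i; apply: uX; exists 1; rewrite ?scale1r.
rewrite PE in pE qE.
move/(point_orth ni hpi dA li x0 u0 pE): h1 => /(point_orth nj hqj dA lj x0 w0 qE).
have wE : w = w' + line_proj dot u w by rewrite subrK.
rewrite AE => /(_ _ A2w) /dot_sym0; rewrite wE dotDr.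
by rewrite [dot w' (line_proj _ _ _)]dotZr w'u mulr0 addr0 => /dotxx0 e; rewrite e eqxx in w'0.
Qed.

Lemma ex_fin2 : exists i j m r, [/\ i != j, n i = Some m & n j = Some r].
Proof.
have [i [m ni]] : exists i m, n i = Some m.
  have o : 'I_k by apply: (Ordinal (n := k) (m := 0)); apply: leq_ltn_trans k_gt2.
  case no : (n o) => [m|]; first by exists o, m.
  have [l [lo _]] := ex_third o o k_gt2; case nl : (n l) => [m|]; first by exists l, m.
  by rewrite (n_inf no nl) eqxx in lo.
have [j [ji _]] := ex_third i i k_gt2; have [l [li lj]] := ex_third i j k_gt2.
rewrite eq_sym in ji; rewrite eq_sym in li; case nj : (n j) => [r|]; first by exists i, j, m, r.
case nl : (n l) => [r|]; first by exists i, l, m, r.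
by rewrite (n_inf nj nl) eqxx in lj.
Qed.

Lemma ex_phi : exists (phi : H -> H) (i : 'I_k), [/\ (forall x, (phi x == 0) = (x == 0)),
   (forall x y, dot x y = 0 <-> dot (phi x) (phi y) = 0),
   (forall y, y != 0 -> exists2 x, x != 0 & parallel (phi x) y) &
   forall A l x, is_decomp A -> l != i -> x != 0 ->
     (forall z, A l z -> dot x z = 0) <-> (forall z, F A (d l) z -> dot (phi x) z = 0)].
Proof.
have [i [j [m [r [ij ni nj]]]]] := ex_fin2.
have hN := dec_big dA0 ij ni nj.
have m1 := n_gt1 ni; have r1 := n_gt1 nj; have m0 := ltnW m1; have r0 := ltnW r1.
have bi := space_img_bij ni; have bj := space_img_bij nj; have cij := space_img_compat ij ni nj.
have [p [p' [hp cp]]] : exists p p', fdim_bij dot 1 p p' /\ orth_compat dot 1 r p (imgF j).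
  case: m ni m1 m0 hN bi cij => // m ni m1 m0 hN bi cij.
  by apply: (to_points bi bj cij r0 hN); rewrite !addSn.
have mrN : (m + r <= (m + r).+2)%N by rewrite !leqW.
have hpi := fun P X => points_sub (P := P) (X := X) bi bj cij hp cp r0 hN mrN.
(* The second descent is at [j], now against lines. As [q] agrees with [p], its compatibility with
   [p] says that [p] preserves orthogonality of lines. *)
have [q [q' [hq cq]]] : exists q q', fdim_bij dot 1 q q' /\ orth_compat dot 1 1 q p.
  case: r nj r1 r0 hN bj cp {cij mrN hpi} => // r nj r1 r0 hN bj cp.
  apply: (to_points bj hp (orth_compat_sym cp) isT hN).
  by rewrite addn1 addnS !ltnS leq_addl.
have rN : (r + 1 <= (m + r).+2)%N by rewrite addn1 ltnS leqW // leq_addl.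
have hqj := fun P X => points_sub (P := P) (X := X) bj hp (orth_compat_sym cp) hq cq isT hN rN.
have pq := points_eq ij ni nj hp hq hpi hqj.
have [p1 p2 p3 p4] := hp.
have h x : exists y, if x == 0 then y = 0 else y != 0 /\ p (line x) = line y.
  have [_|x0] := eqVneq x 0; first by exists 0.
  by have [y y0 e] := fdim1P (p1 _ (fdim_line dot x0)); exists y.
have [phi hphi] := choice h.
have phi0 x : (phi x == 0) = (x == 0).
  by have := hphi x; have [_ ->|_ [/negPf ->]] := eqVneq x 0; rewrite ?eqxx.
have phiE x : x != 0 -> p (line x) = line (phi x).
  by move=> x0; have := hphi x; rewrite (negPf x0) => -[].
have p00 : phi 0 = 0 by apply/eqP; rewrite phi0.
exists phi, i; split=> //.
- move=> x y; have [->|x0] := eqVneq x 0.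
    by rewrite p00 !dot0l.
  have [->|y0] := eqVneq y 0.
    by rewrite p00 !dot0r.
  rewrite -!line_orth -!phiE //; have fx := fdim_line dot x0; have fy := fdim_line dot y0.
  by rewrite (cq _ _ fx fy) -pq.
- move=> y y0; have fy := fdim_line dot y0; have [x x0 e] := fdim1P (p2 _ fy).
  exists x => //; apply: (line_parallel y0); rewrite -phiE // /line -e p4 //.
- move=> A l x dA li x0; apply: (point_orth ni hpi dA li x0); rewrite ?phi0 //.
  exact: phiE.
Qed.

End Img2.

End Points.

(** * The semilinear map behind an automorphism of the decompositions *)

Section Main.
Context {R : realType} {H : lmodType R[i]} (dot : {dot H for conjC}).
Context {k : nat} (n : 'I_k -> option nat).
Hypothesis n_inf : forall i j, n i = None -> n j = None -> i = j.
Hypothesis n_gt1 : forall i m, n i = Some m -> (1 < m)%N.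
Hypothesis k_gt2 : (2 < k)%N.
Local Notation is_decomp := (is_decomp dot n).

Definition semi_unitary (s : R[i] -> R[i]) (U : H -> H) :=
  [/\ forall a x y, U (a *: x + y) = s a *: U x + U y, forall y, exists x, U x = y &
    forall x y, dot (U x) (U y) = s (dot x y)].

Lemma dec_unitary F G A0 d : is_decomp A0 -> typed_iso dot n F G d -> exists s U,
  [/\ s =1 id \/ s =1 conjC, semi_unitary s U & forall A t, is_decomp A -> F A (d t) = U @` A t].
Proof.
move=> dA0 hF; have [phi [i [phi0 phi_dot phi_surj phi_orth]]] := ex_phi n_inf n_gt1 k_gt2 hF dA0.
have [i0 [j0 [m [r [ij ni nj]]]]] := ex_fin2 n_inf k_gt2.
have big : big_dim dot 4.
  apply: big_dim_le (dec_big n_gt1 k_gt2 dA0 ij ni nj).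
  by rewrite !ltnS (leq_trans _ (leq_add (n_gt1 ni) (n_gt1 nj))).
have [|x x0 _] := big [::]; first by [].
have [c c0 ee] := normalize dot x0; set e := c *: x in ee.
have e0 : phi e != 0 by rewrite phi0 -(dot_eq0 dot) ee oner_eq0.
have [c' c'0 ee'] := normalize dot e0; set e' := c' *: phi e in ee'.
have ep : parallel (phi e) e' by exists c'.
have [T hT] := ex_T phi_dot ee ee' ep.
have [s hs] := ex_sigma phi0 phi_dot phi_surj big ee' ep hT.
pose U := extU dot e e' T s.
have sD := sigmaD phi0 phi_dot phi_surj big ee' ep hT hs.
have sM := sigmaM phi0 phi_dot phi_surj big ee' ep hT hs.
have s1 := sigma1 phi0 phi_dot phi_surj big ee' ep hT hs.
have sJ := sigma_conj phi0 phi_dot phi_surj big ee ee' ep hT hs.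
have hU := extU_parallel phi0 phi_dot phi_surj big ee ee' ep hT hs.
have sE := complex_endo sD sM s1 sJ.
have ss b : exists a, s a = b.
  by case: sE => sE; [exists b|exists (conjC b)]; rewrite sE ?conjCK.
have Us y : exists x, U x = y by exact: (extU_surj phi0 phi_dot phi_surj ee ee' ep hT y ss).
have Ud x1 y : dot (U x1) (U y) = s (dot x1 y) by exact: (extU_dot phi0 phi_dot phi_surj big ee ee' ep hT hs).
have s0 a : s a = 0 -> a = 0.
  by case: sE => -> // /eqP; rewrite conjC_eq0 => /eqP.
have s00 : s 0 = 0 by case: sE => ->; rewrite ?conjC0.
have Ud0 x1 y : dot (U x1) (U y) = 0 <-> dot x1 y = 0.
  by rewrite Ud; split=> [/s0|->].
exists s, U; split=> //; first split=> //.
  exact: (extU_lin phi0 phi_dot phi_surj big ee ee' ep hT hs).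
have orth A l x1 : is_decomp A -> l != i ->
    (forall z, A l z -> dot x1 z = 0) <-> (forall z, F A (d l) z -> dot (U x1) z = 0).
  move=> dA li; have [->|x10] := eqVneq x1 0.
    have -> : U 0 = 0 by apply: (dotxx0 (dot := dot)); rewrite Ud dot0l s00.
    by split=> _ z _; rewrite dot0l.
  have [b b0 pU] := hU _ x10; rewrite (phi_orth _ _ _ dA li x10) pU; split=> h z /h; rewrite dotZl.
    by move/eqP; rewrite mulf_eq0 (negPf b0) => /eqP.
  by move=> ->; rewrite mulr0.
(* Membership is tested against vectors orthogonal to the [l]-th space, which [orth] matches on both
   sides. *)
have off A l : is_decomp A -> l != i -> F A (d l) = U @` A l.
  move=> dA li; have dFA := typed_iso_dec hF dA; apply/seteqP; split=> [y Fy|_ [x1 Ax <-]].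
    have [x1 xy] := Us y; exists x1 => //; apply: (dec_mem dA) => t z tl Az.
    apply/Ud0; rewrite xy; apply: dot_sym0; apply: (proj1 (orth A l z dA li)) => // z' Az'.
    exact: (dec_orth dA tl Az Az').
  apply: (dec_mem dFA) => t y tl Fy; have [z zy] := Us y; rewrite -zy.
  apply/Ud0; apply: dot_sym0; apply: (proj2 (orth A l z dA li)) => // z' Fz'.
  by rewrite zy; exact: (dec_orth dFA tl Fy Fz').
(* The [i]-th space is the orthogonal complement of the others, whose images are known by [off]. *)
move=> A t dA; have [->|/(off _ _ dA) //] := eqVneq t i.
have dFA := typed_iso_dec hF dA; apply/seteqP; split=> [y Fy|_ [x1 Ax <-]].
  have [x1 xy] := Us y; exists x1 => //; apply: (dec_mem dA) => l z li Az.
  apply/Ud0; rewrite xy; have : F A (d l) (U z) by rewrite off //; exists z.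
  by move=> Fz; apply: (dec_orth dFA _ Fy Fz); rewrite (inj_eq perm_inj) eq_sym.
apply: (dec_mem dFA) => l' y l'i; rewrite -[l'](permKV d) in l'i *.
rewrite (inj_eq perm_inj) in l'i.
rewrite off // => -[z Az <-]; apply/Ud0; by apply: (dec_orth dA _ Ax Az); rewrite eq_sym.
Qed.

End Main.

(** * Operators and their eigenspaces *)

Section Hdim.
Context {R : realType} {H : completeNormedModType R[i]} (dot : {dot H for conjC}).
Implicit Types (X : set H) (x y z u v w : H).
Local Notation fdim := (fdim dot).

Lemma basis_fdim m X (e : 'I_m -> H) : subspace_basis X e -> fdim m X.
Proof.
elim: m X e => [|m IH] X e [ind ->].
  apply/seteqP; split=> [_ [c _ <-]|_ ->]; first by rewrite big_ord0.
  by exists (fun=> 0) => //; rewrite big_ord0.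
set e' := fun i : 'I_m => e (widen_ord (leqnSn m) i).
set X' := [set \sum_i c i *: e' i | c in [set: 'I_m -> R[i]]].
have sumE (c : 'I_m.+1 -> R[i]) : \sum_i c i *: e i =
    \sum_i c (widen_ord (leqnSn m) i) *: e' i + c ord_max *: e ord_max.
  by rewrite big_ord_recr.
pose ext (c : 'I_m -> R[i]) b (i : 'I_m.+1) := if unlift ord_max i is Some j then c j else b.
have extw c b (i : 'I_m) : ext c b (widen_ord (leqnSn m) i) = c i.
  by rewrite /ext (_ : widen_ord _ i = lift ord_max i) ?liftK //; apply: val_inj; rewrite /= /bump leqNgt ltn_ord.
have extm c b : ext c b ord_max = b by rewrite /ext unlift_none.
have sumext c b : \sum_i ext c b i *: e i = \sum_i c i *: e' i + b *: e ord_max.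
  by rewrite sumE extm; congr (_ + _); apply: eq_bigr => i _; rewrite extw.
have fX' : fdim m X'.
  apply: (IH X' e'); split=> // c c0 i; rewrite -(extw c 0 i); apply: ind.
  by rewrite sumext c0 scale0r addr0.
have nX' : ~ X' (e ord_max).
  move=> [c _ hc]; have h1 : \sum_i ext (fun i => - c i) 1 i *: e i = 0.
    rewrite sumext scale1r -hc; apply/eqP; rewrite addr_eq0 -sumrN.
    by apply/eqP; apply: eq_bigr => i _; rewrite scaleNr.
  by have := ind _ h1 ord_max; rewrite extm => /eqP; rewrite oner_eq0.
have := fdim_add_line fX' nX'; congr (fdim _ _); apply/seteqP; split.
  by move=> _ [_ [b [[c _ <-] ->]]]; exists (ext c b).
move=> _ [c _ <-]; rewrite sumE; exists (\sum_i c (widen_ord (leqnSn m) i) *: e' i), (c ord_max).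
by split=> //; exists (fun i => c (widen_ord (leqnSn m) i)).
Qed.

Lemma fdim_has_basis m X : fdim m X -> exists e : 'I_m -> H, subspace_basis X e.
Proof.
elim: m X => [|m IH] X fX.
  exists (fun=> 0); split; first by move=> c _ [].
  rewrite fX; apply/seteqP; split=> [_ ->|_ [c _ <-]]; last by rewrite big_ord0.
  by exists (fun=> 0) => //; rewrite big_ord0.
case: (fX) => lX [x [Xx x0 fx]]; have [e [ind eX]] := IH _ fx.
have pe i : perp dot X x (e i).
  rewrite eX; exists (fun j => (j == i)%:R) => //.
  by rewrite (bigD1 i) //= eqxx scale1r big1 ?addr0 // => j /negPf ->; rewrite scale0r.
pose e1 (i : 'I_m.+1) := if unlift ord0 i is Some j then e j else x.
have e10 : e1 ord0 = x by rewrite /e1 unlift_none.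
have e1l i : e1 (lift ord0 i) = e i by rewrite /e1 liftK.
exists e1; split=> [c|].
  rewrite big_ord_recl e10 => hc.
  have c0 : c ord0 = 0.
    have := congr1 (fun v => dot v x) hc; rewrite dotDl dotZl dot0l dot_suml big1 ?addr0.
      by move/eqP; rewrite mulf_eq0 dot_eq0 (negPf x0) orbF => /eqP.
    by move=> i _; rewrite e1l dotZl (proj2 (pe i)) mulr0.
  rewrite c0 scale0r add0r in hc; move=> i; case: (unliftP ord0 i) => [j|] -> //.
  by apply: (ind (fun j => c (lift ord0 j))); rewrite -[RHS]hc; apply: eq_bigr => i' _; rewrite e1l.
apply/seteqP; split=> [v Xv|_ [c _ <-]].
  have [w pw ->] := perpP dot lX Xx x0 Xv; rewrite eX in pw; case: pw => c _ <-.
  exists (fun i => if unlift ord0 i is Some j then c j else dot v x / dot x x) => //.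
  rewrite big_ord_recl e10 unlift_none; congr (_ + _).
  by apply: eq_bigr => i _; rewrite e1l liftK.
apply: submod_sum => // i _; apply: submodZ => //; case: (unliftP ord0 i) => [j|] ->; rewrite ?e10 ?e1l //.
by case: (pe j).
Qed.

Lemma hdimP X m : hdim X = Some m <-> fdim m X.
Proof.
rewrite /hdim; split.
  by case: xgetP => // d -> [p [e [-> he]]] [<-]; apply: basis_fdim he.
move=> fX; case: xgetP => [d -> [p [e [-> he]]]|/(_ (Some m))].
  by rewrite (fdim_uniq fX (basis_fdim he)).
by have [e he] := fdim_has_basis fX; case; exists m, e.
Qed.

Lemma hdim_has_dim X d : hdim X = d -> has_dim dot d X.
Proof.
case: d => [m|] h; first exact/hdimP.
by move=> m /hdimP; rewrite h.
Qed.

Lemma has_dim_hdim X d : has_dim dot d X -> hdim X = d.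
Proof.
case: d => [m /hdimP //|h]; case e: (hdim X) => [m|//].
by case: (h m); apply/hdimP.
Qed.

End Hdim.

Section Eigen.
Context {R : realType} {H : completeNormedModType R[i]} (dot : {dot H for conjC}).
Context {k : nat} (a : 'I_k -> R) (n : 'I_k -> enat).
Hypothesis a_inj : injective a.
Implicit Types (X : set H) (x y u v w : H) (z : R[i]) (A B : H -> H).
Local Notation fdim := (fdim dot).

Definition eigenspaces A : 'I_k -> set H := fun t => eigensubspace A (a t)%:C.

Lemma aC_inj s t : ((a s)%:C == (a t)%:C :> R[i]) = (s == t).
Proof. by apply/eqP/eqP => [[/a_inj]|->]. Qed.

Lemma aC_conj t : conjC (a t)%:C = (a t)%:C :> R[i].
Proof. exact: conjc_real. Qed.

Section OneOp.
Variable A : H -> H.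
Hypothesis hA : grassmannian dot a n A.

Lemma op_linear : linear A. Proof. by case: hA => -[]. Qed.

Let lA := op_linear.

Lemma opD x y : A (x + y) = A x + A y.
Proof. by have := lA 1 x y; rewrite !scale1r. Qed.

Lemma op0 : A 0 = 0.
Proof. by apply: (addrI (A 0)); rewrite -opD !addr0. Qed.

Lemma opZ c x : A (c *: x) = c *: A x.
Proof. by have := lA c x 0; rewrite !addr0 op0 addr0. Qed.

Lemma opN x : A (- x) = - A x.
Proof. by rewrite -scaleN1r opZ scaleN1r. Qed.

Lemma op_sum (I : finType) (F : I -> H) : A (\sum_i F i) = \sum_i A (F i).
Proof. by apply: (big_morph A opD op0). Qed.

Lemma op_sa x y : dot (A x) y = dot x (A y). Proof. by case: hA => _ h _ _ _; apply: h. Qed.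

Lemma submod_eig t : submod (eigenspaces A t).
Proof.
split=> [|c x y hx hy]; first by rewrite /eigenspaces /eigensubspace /= op0 scaler0.
by rewrite /eigenspaces /eigensubspace /= opD opZ hx hy scalerDr !scalerA mulrC.
Qed.

Lemma eig_orth s t x y : s != t -> eigenspaces A s x -> eigenspaces A t y -> dot x y = 0.
Proof.
move=> st hx hy; have := op_sa x y; rewrite hx hy dotZl dotZr.
rewrite aC_conj => /eqP; rewrite -subr_eq0 -mulrBl mulf_eq0 subr_eq0 aC_inj (negPf st) => /eqP.
by [].
Qed.

Lemma eigval_in z u : A u = z *: u -> u != 0 -> exists t, z = (a t)%:C.
Proof.
move=> hu u0; have : spectrum A z.
  move=> [S _ [SK _]]; have := SK u; rewrite hu subrr => S0.
  by have := SK 0; rewrite op0 scaler0 subrr S0 => e; rewrite e eqxx in u0.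
by case: hA => _ _ _ -> _ [t _ <-]; exists t.
Qed.

Definition eig_sum : set H := [set x | exists2 c : 'I_k -> H, (forall t, eigenspaces A t (c t)) & x = \sum_t c t].

(** The equation is solved on each eigenspace other than that of [z]. What remains, [w], lies in the
    range of [A - z] and satisfies [A w = z w], so for an eigenvalue [z] self-adjointness makes it
    orthogonal to itself; for other [z] it is an empty sum. *)
Lemma eig_sum_shift z y : eig_sum (A y - z *: y) -> eig_sum y.
Proof.
(* At an index with [a t = z] the inverse is 0, so that component is skipped. *)
move=> [c hc yE]; pose b t := ((a t)%:C - z)^-1.
set u := y - \sum_t b t *: c t.
pose w := \sum_t (if (a t)%:C == z then c t else 0).
have wE : A u - z *: u = w.
  set v := \sum_t b t *: c t in u *.
  transitivity ((A y - z *: y) - (A v - z *: v)).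
    by rewrite /u opD opN; apply: (@dot_ext _ _ dot) => x; rewrite !dotE; ring.
  rewrite yE /v op_sum scaler_sumr -!sumrB; apply: eq_bigr => t _.
  rewrite opZ hc; have [e|ne] := eqVneq (a t)%:C z.
    by rewrite /b e subrr invr0 !scale0r scaler0 !subr0.
  have nz : (a t)%:C - z != 0 by rewrite subr_eq0.
  by rewrite !scalerA -scalerBl [b t * _]mulrC -mulrBl /b mulfV // scale1r subrr.
have Aw : A w = z *: w.
  rewrite op_sum scaler_sumr; apply: eq_bigr => t _; case: eqP => [<-|_]; first exact: hc.
  by rewrite op0 scaler0.
have w0 : w = 0.
  have [[t zE]|nz] := pselect (exists t, z = (a t)%:C).
    apply: (dotxx0 (dot := dot)); rewrite -{1}wE dotDl dotNl op_sa Aw dotZl dotZr zE.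
    by rewrite aC_conj subrr.
  rewrite /w big1 // => t _; case: eqP => // e; by case: nz; exists t.
have Au : A u = z *: u by apply/eqP; rewrite -subr_eq0 wE w0.
have [c' hc' uE] : eig_sum u.
  have [->|u0] := eqVneq u 0; first by exists (fun=> 0); [move=> t; apply: submod0; exact: submod_eig|rewrite big1].
  have [t zE] := eigval_in Au u0.
  exists (fun s => if s == t then u else 0).
    by move=> s; case: eqP => [->|_]; [rewrite /eigenspaces /eigensubspace /= Au zE|apply: submod0; exact: submod_eig].
  by rewrite -big_mkcond /= big_pred1_eq.
exists (fun t => c' t + b t *: c t).
  by move=> t; apply: submodD; [exact: submod_eig|exact: hc'|apply: submodZ => //; exact: submod_eig].
by rewrite big_split /= -uE /u subrK.
Qed.

(** The polynomial [p] of the operator [A], applied to [y] by Horner's scheme. *)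
Definition op_horner (p : {poly R[i]}) y := foldr (fun c v => c *: y + A v) 0 p.

Lemma op_horner_cons c (p : {poly R[i]}) y : op_horner (p * 'X + c%:P) y = c *: y + A (op_horner p y).
Proof.
rewrite -cons_poly_def /op_horner polyseq_cons; case: nilP => [p0|//].
have -> : p = 0 by apply/eqP; rewrite -nil_poly p0.
rewrite polyseq0 /= op0 addr0 polyseqC; case: eqP => [->|_] /=; first by rewrite scale0r.
by rewrite op0 addr0.
Qed.

Lemma op_horner0 y : op_horner 0 y = 0. Proof. by rewrite /op_horner polyseq0. Qed.

Lemma op_hornerC c y : op_horner c%:P y = c *: y.
Proof. by have := op_horner_cons c 0 y; rewrite mul0r add0r op_horner0 op0 addr0. Qed.

Lemma op_hornerD p q y : op_horner (p + q) y = op_horner p y + op_horner q y.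
Proof.
elim/poly_ind: p q => [|p c IH] q; first by rewrite add0r op_horner0 add0r.
elim/poly_ind: q => [|q d _]; first by rewrite addr0 op_horner0 addr0.
by rewrite addrACA -mulrDl -polyCD !op_horner_cons IH opD scalerDl addrACA.
Qed.

Lemma op_hornerX p y : op_horner (p * 'X) y = A (op_horner p y).
Proof. by have := op_horner_cons 0 p y; rewrite polyC0 addr0 scale0r add0r. Qed.

Lemma op_hornerZ c p y : op_horner (c *: p) y = c *: op_horner p y.
Proof.
elim/poly_ind: p => [|p b IH]; first by rewrite scaler0 op_horner0 scaler0.
by rewrite scalerDr scalerAl -mul_polyC -polyCM !op_horner_cons IH opZ scalerDr scalerA.
Qed.

Lemma op_horner_Xsub z p y : op_horner (p * ('X - z%:P)) y = A (op_horner p y) - z *: op_horner p y.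
Proof. by rewrite mulrBr op_hornerD op_hornerX mulrC mul_polyC -scaleNr op_hornerZ scaleNr. Qed.

Lemma op_horner_eig_sum p y : p != 0 -> op_horner p y = 0 -> eig_sum y.
Proof.
move=> p0; have [r pE] := closed_field_poly_normal p.
rewrite pE op_hornerZ => /eqP; rewrite scaler_eq0 lead_coef_eq0 (negPf p0) /= => /eqP.
move=> e; have : eig_sum (op_horner (\prod_(z <- r) ('X - z%:P)) y).
  by rewrite e; exists (fun=> 0); [move=> t; apply: submod0; exact: submod_eig|rewrite big1].
elim: r {p p0 pE e} => [|z r IH]; first by rewrite big_nil -[1]/(1%:P) op_hornerC scale1r.
by rewrite big_cons mulrC op_horner_Xsub => /eig_sum_shift.
Qed.

(** [A] has finite rank, so some nonzero polynomial in [A] annihilates [A x]. It splits into linear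
    factors, which [eig_sum_shift] removes one by one. *)
Lemma op_eig_sum x : eig_sum x.
Proof.
have [m fM] : exists m, fdim m (range A).
  case: hA => _ _ + _ _; rewrite /operator_rank; case e : hdim => [m|//] _.
  by exists m; apply/hdimP.
(* The Krylov spaces of [A x]: without a linear dependence [S j] has dimension [j] for all [j], too
   large for the range of [A]. *)
pose S j := [set v | exists2 q : {poly R[i]}, (size q <= j)%N & v = op_horner q (A x)].
have [[j [q sq vE]]|nex] := pselect (exists j, S j (op_horner 'X^j (A x))).
  have p0 : 'X^j - q != 0.
    apply/negP; rewrite subr_eq0 => /eqP e; move: sq; by rewrite -e size_polyXn ltnn.
  have [c hc xE] : eig_sum (A x).
    apply: (op_horner_eig_sum p0); rewrite op_hornerD vE -scaleN1r op_hornerZ scaleN1r subrr //.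
  (* One more shift, by 0, leads from [A x] to [x]. *)
  apply: (@eig_sum_shift 0); rewrite scale0r subr0; by exists c.
have evr q : range A (op_horner q (A x)).
  elim/poly_ind: q => [|q c _]; first by exists 0 => //; rewrite op_horner0 op0.
  by rewrite op_horner_cons -opZ -opD; exists (c *: x + op_horner q (A x)).
have fS j : fdim j (S j).
  elim: j => [|j IH].
    apply/seteqP; split=> [_ [q q0 ->]|_ ->]; last by exists 0; rewrite ?size_poly0 ?op_horner0.
    by move: q0; rewrite leqn0 size_poly_eq0 => /eqP ->; rewrite op_horner0.
  have nS : ~ S j (op_horner 'X^j (A x)) by move=> h; apply: nex; exists j.
  have := fdim_add_line IH nS; congr (fdim _ _); apply/seteqP; split.
    move=> _ [_ [c [[q sq ->] ->]]]; exists (q + c *: 'X^j); last by rewrite op_hornerD op_hornerZ.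
    rewrite (leq_trans (size_polyD _ _)) // geq_max leqW //=.
    by rewrite (leq_trans (size_scale_leq _ _)) // size_polyXn.
  move=> _ [q sq ->]; exists (op_horner (q - q`_j *: 'X^j) (A x)), q`_j; split.
    exists (q - q`_j *: 'X^j) => //; apply/leq_sizeP => i ji.
    rewrite coefB coefZ coefXn; move: ji; rewrite leq_eqVlt => /orP[/eqP <-|ji].
      by rewrite eqxx mulr1 subrr.
    by rewrite gtn_eqF // mulr0 subr0 nth_default // (leq_trans sq).
  by rewrite -op_hornerZ -op_hornerD subrK.
have hS : S m.+1 `<=` range A by move=> _ [q _ ->]; exact: evr.
by have := fdim_sub_le (fS m.+1) fM hS; rewrite ltnn.
Qed.

Lemma eig_dec : is_decomp dot n (eigenspaces A).
Proof.
split; [exact: submod_eig|exact: eig_orth|exact: op_eig_sum|].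
by move=> t; apply: hdim_has_dim; case: hA => _ _ _ _; apply.
Qed.

End OneOp.

Lemma op_pr A x : grassmannian dot a n A -> A x = \sum_t (a t)%:C *: pr (eigenspaces A) x t.
Proof.
move=> hA; have dA := eig_dec hA; rewrite {1}(pr_sum dA x) (op_sum hA).
by apply: eq_bigr => t _; exact: (pr_in dA).
Qed.

Lemma eig_inj A B : grassmannian dot a n A -> grassmannian dot a n B -> eigenspaces A = eigenspaces B -> A = B.
Proof. by move=> hA hB e; apply: funext => x; rewrite (op_pr x hA) (op_pr x hB) e. Qed.

End Eigen.

Section Incl.
Context {C : numClosedFieldType} {H : lmodType C} (dot : {dot H for conjC}).
Context {k : nat} (n : 'I_k -> option nat).
Hypothesis n_inf : forall i j, n i = None -> n j = None -> i = j.
Implicit Types (A B : 'I_k -> set H).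
Local Notation is_decomp := (is_decomp dot n).

Lemma dec_sub_eq t A B m : is_decomp A -> is_decomp B -> n t = Some m -> A t `<=` B t -> A t = B t.
Proof.
move=> dA dB nt; have := dec_dim dA t; have := dec_dim dB t; rewrite nt => fB fA.
exact: fdim_sub_eq fA fB.
Qed.

(** Taking complements reverses the inclusion at [i]. If [n i] is finite, that inclusion is an
    equality; otherwise all the other spaces are finite-dimensional and theirs are. *)
Lemma dec_incl i A B : is_decomp A -> is_decomp B -> (forall t, t != i -> A t `<=` B t) -> A = B.
Proof.
move=> dA dB h; have Bi : B i `<=` A i.
  move=> v Bv; apply: (dec_mem dA) => s y si /(h _ si) By.
  by apply: (dec_orth dB _ Bv By); rewrite eq_sym.
case ni : (n i) => [m|].
  have e := dec_sub_eq dB dA ni Bi.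
  have sub t : A t `<=` B t by have [->|/h //] := eqVneq t i; rewrite e.
  apply: funext => t; apply/seteqP; split=> [|v Bv]; first exact: sub.
  apply: (dec_mem dA) => s y st /sub By; by apply: (dec_orth dB _ Bv By); rewrite eq_sym.
apply: (dec_eq (j := i) dA dB) => t ti; case nt : (n t) => [m|].
  exact: dec_sub_eq nt (h _ ti).
by rewrite (n_inf ni nt) eqxx in ti.
Qed.

End Incl.

(** * Adjacency of operators and of their decompositions *)

Section Operators.
Context {R : realType} {H : completeNormedModType R[i]} (dot : {dot H for conjC}).
Hypothesis norm_dot : forall x : H, `|x| ^+ 2 = dot x x.
Context {k : nat} (a : 'I_k -> R) (n : 'I_k -> enat).
Hypothesis a_inj : injective a.
Hypothesis n_inf : forall i j, n i = None -> n j = None -> i = j.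
Hypothesis n_gt1 : forall i m, n i = Some m -> (1 < m)%N.
Implicit Types (X M : set H) (x y u v w : H) (z : R[i]) (A B : H -> H).
Local Notation fdim := (fdim dot).
Local Notation eig := (eigenspaces a).
Local Notation grass := (grassmannian dot a n).

Lemma unitary_continuous U : unitary dot U -> continuous U.
Proof.
move=> hU x; have iso v : `|U v| = `|v|.
  apply/eqP; rewrite -(@eqrXn2 _ 2) //; apply/eqP.
  by rewrite !norm_dot; case: hU => _ _ ->.
apply/cvgrPdist_lt => e e0; near=> y.
have -> : U x - U y = U (x - y).
  by have [UD UZ] := unitaryE hU; rewrite UD -[- y]scaleN1r UZ scaleN1r.
rewrite iso; near: y; by apply: cvgr_dist_lt.
Unshelve. all: by end_near.
Qed.

Section Conj.
Variables (U V : H -> H) (hU : unitary dot U) (hV : unitary dot V) (UK : cancel U V) (VK : cancel V U).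

Lemma conj_bounded A : bounded_operator A -> bounded_operator (U \o A \o V).
Proof.
move=> [lA cA]; split.
  by move=> c x y; rewrite /= (unitary_lin hV) lA (unitary_lin hU).
move=> x; apply: continuous_comp; first exact: (unitary_continuous hV).
apply: continuous_comp; [exact: cA|exact: (unitary_continuous hU)].
Qed.

Lemma spectrum_conj_sub A : linear A -> spectrum (U \o A \o V) `<=` spectrum A.
Proof.
move=> lA z hz [S bS [SK KS]]; apply: hz; exists (U \o S \o V); first exact: conj_bounded.
have [UD UZ] := unitaryE hU.
have e x : (U \o A \o V) x - z *: x = U (A (V x) - z *: V x).
  by rewrite UD -[- (z *: V x)]scaleN1r UZ UZ VK scaleN1r.
split=> x; first by rewrite e /= UK SK VK.
by rewrite e /= UK KS VK.
Qed.

Lemma eig_conj A : eig (U \o A \o V) = act U (eig A).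
Proof.
have [UD UZ] := unitaryE hU; have [VD VZ] := unitaryE hV.
apply: funext => t; apply/seteqP; split=> [x|_ [x hx <-]]; rewrite /eigenspaces /eigensubspace /=.
  by move=> hx; exists (V x) => //=; rewrite -VZ -hx UK.
by rewrite UK hx UZ.
Qed.

End Conj.

Lemma conj_grass U V A : unitary dot U -> unitary dot V -> cancel U V -> cancel V U ->
  grass A -> grass (U \o A \o V).
Proof.
move=> hU hV UK VK hA; have [bA sA rA spA dA] := hA; have [lA _] := bA.
have dE := eig_dec a_inj hA.
split.
- exact: conj_bounded.
- move=> x y; case: hU => _ _ e; case: hV => _ _ e'.
  by rewrite -[y in LHS]VK e sA -[x in RHS]VK e.
- rewrite /operator_rank (_ : range _ = U @` range A).
    move: rA; rewrite /operator_rank; case rk : hdim => [m|//] _.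
    by have /(img_fdim hU)/hdimP -> := proj1 (hdimP dot _ _) rk.
  apply/seteqP; split=> [_ [x _ <-]|_ [_ [x _ <-] <-]]; first by exists (A (V x)) => //; exists (V x).
  by exists (U x) => //=; rewrite UK.
- rewrite -spA; apply/seteqP; split; first exact: spectrum_conj_sub.
  rewrite (_ : spectrum A = spectrum (V \o (U \o A \o V) \o U)).
    by apply: spectrum_conj_sub => //; case: (conj_bounded hU hV bA).
  by congr spectrum; apply: funext => x; rewrite /= !UK.
- move=> i; have := eig_conj hU hV UK VK A => /(congr1 (fun f => f i)).
  rewrite /eigenspaces => ->; apply: (has_dim_hdim (dot := dot)).
  exact: (dec_dim (act_dec hU dE) i).
Qed.

(** [D] is the image of the decomposition of [A0] under a unitary map; the conjugate of [A0]
    inherits boundedness, rank and spectrum. *)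
Lemma all_dec A0 D : grass A0 -> is_decomp dot n D -> exists2 A, grass A & eig A = D.
Proof.
move=> hA0 dD; have d0 := eig_dec a_inj hA0.
have [|U hU ->] := reach_unitary n_inf (I := pred0) d0 (reach_full n_inf d0 dD _) => //.
have [V [hV UV VU]] := unitary_inv hU.
exists (U \o A0 \o V); [exact: conj_grass|exact: eig_conj].
Qed.

Section Half.
Variables (A B : H -> H) (M : set H).
Hypotheses (hA : grass A) (hB : grass B) (fM : fdim 2 M) (nAB : A <> B)
  (AM : forall x, M x -> M (A x)) (AB : forall v, (forall x, M x -> dot v x = 0) -> A v = B v).

Let dA := eig_dec a_inj hA.
Let dB := eig_dec a_inj hB.

(** Let [p s] be the projection to [M] of the [s]-th component. Its defect as an eigenvector lies in
    [M] because [M] is invariant, and is orthogonal to [M] by self-adjointness, so the [p s] are the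
    components of [v]. *)
Lemma comp_in v t : M v -> M (pr (eig A) v t).
Proof.
move=> Mv; have lM := submod_fdim fM.
have [p hp] := choice (fun s => let: ex_intro2 p h1 h2 := fdim_proj (pr (eig A) v s) fM in ex_intro (fun p => M p /\ forall x, M x -> dot (pr (eig A) v s - p) x = 0) p (conj h1 h2)).
have Ep s : eig A s (p s).
  have [Mp pM] := hp s; set m := pr (eig A) v s - p s in pM.
  have vE : pr (eig A) v s = p s + m by rewrite addrC subrK.
  have Am x : M x -> dot (A m) x = 0 by move=> Mx; rewrite (op_sa hA); apply: pM; apply: AM.
  have e : A (p s) - (a s)%:C *: p s = - (A m - (a s)%:C *: m).
    have h : A (p s) + A m = (a s)%:C *: p s + (a s)%:C *: m.
      by rewrite -(opD hA) -scalerDr -vE; exact: (pr_in dA v s).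
    by apply/eqP; rewrite -subr_eq0 opprK addrACA h -opprD subrr.
  have Mq : M (A (p s) - (a s)%:C *: p s) by apply: (submodB lM); [exact: AM|exact: (submodZ _ lM)].
  rewrite /eig /eigensubspace /=; apply/eqP; rewrite -subr_eq0; apply/eqP.
  apply: (dotxx0 (dot := dot)); rewrite {1}e dotNl dotDl dotNl dotZl Am // pM //.
  by rewrite mulr0 subrr oppr0.
have vE : v = \sum_s p s.
  apply/eqP; rewrite -subr_eq0; apply/eqP; apply: (dotxx0 (dot := dot)).
  have Mq : M (v - \sum_s p s) by apply: (submodB lM) => //; apply: (submod_sum lM) => s _; case: (hp s).
  rewrite {1}[v](pr_sum dA) -sumrB dot_suml big1 // => s _; by case: (hp s) => _; apply.
suff -> : pr (eig A) v t = p t by case: (hp t).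
apply: (pr_uniq dA) => // y Ay; rewrite {1}vE (bigD1 t) //= addrAC subrr add0r dot_suml big1 // => s st.
exact: (dec_orth dA st (Ep s) Ay).
Qed.

Lemma half_exchange : exists i j x y, [/\ [/\ i != j, M x, M y, x != 0 & y != 0],
  [/\ eig A i x, eig A j y, perp dot (eig A i) x `<=` eig B i & perp dot (eig A j) y `<=` eig B j] &
  forall t, t != i -> t != j -> eig A t `<=` eig B t].
Proof.
have sub t v : eig A t v -> (forall x, M x -> dot v x = 0) -> eig B t v.
  by move=> Av vM; rewrite /eig /eigensubspace /= -(AB vM).
have excomp v : v != 0 -> exists t, pr (eig A) v t != 0.
  move=> v0; apply: contrapT => nex; case/negP: v0; rewrite (pr_sum dA v) big1 // => t _.
  by apply/eqP; apply: contraT => h; case: nex; exists t.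
have [lM [m [Mm m0 _]]] := fM; have [i x0] := excomp _ m0.
have Mx := comp_in i Mm; have Ax := pr_in dA m i; set x := pr (eig A) m i in x0 Mx Ax.
have [_ [y0 [[My0 y0x] y00 _]]] := fdim_perp fM Mx x0.
have [j yj0] := excomp _ y00.
have My := comp_in j My0; have Ay := pr_in dA y0 j; set y := pr (eig A) y0 j in yj0 My Ay.
have yx : dot y x = 0.
  have [ji|ji] := eqVneq j i; last exact: (dec_orth dA ji Ay Ax).
  by rewrite -y0x (dot_pr dA _ Ax) /y ji.
have f1 := fdim_perp fM Mx x0; have f0 := fdim_perp f1 (conj My yx) yj0.
have Mxy v : dot v x = 0 -> dot v y = 0 -> forall u, M u -> dot v u = 0.
  move=> vx vy u Mu; have [w pw ->] := perpP dot lM Mx x0 Mu.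
  have [w' pw' ->] := perpP dot (submod_fdim f1) (conj My yx) yj0 pw.
  have -> : w' = 0 by rewrite [LHS](_ : [set 0] w') // -[[set 0]]f0.
  by rewrite addr0 dotDr !dotZr vx vy !mulr0 addr0.
have [ij|ij] := eqVneq i j.
  exfalso; apply: nAB; apply: (eig_inj a_inj hA hB); apply: (dec_incl n_inf (i := i) dA dB) => t ti v Av.
  apply: (sub _ _ Av); apply: Mxy; first exact: (dec_orth dA ti Av Ax).
  by apply: (dec_orth dA ti Av); rewrite ij.
exists i, j, x, y; split=> //; first split=> //.
- by move=> v [Av vx]; apply: (sub _ _ Av); apply: Mxy => //; exact: (dec_orth dA ij Av Ay).
- have ji : j != i by rewrite eq_sym.
  by move=> v [Av vy]; apply: (sub _ _ Av); apply: Mxy => //; exact: (dec_orth dA ji Av Ax).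
- move=> t ti tj v Av; apply: (sub _ _ Av); apply: Mxy.
    exact: (dec_orth dA ti Av Ax).
  exact: (dec_orth dA tj Av Ay).
Qed.

End Half.

(** [half_exchange] is used in both directions, giving inclusions of eigenspaces off [i], [j] and
    off [p], [q]; they combine to equalities once these pairs of indices are known to agree. *)
Lemma adjacent_adj A B : grass A -> grass B -> adjacent_operators A B -> adj dot n (eig A) (eig B).
Proof.
move=> hA hB [rk iA iB _ _]; have dA := eig_dec a_inj hA; have dB := eig_dec a_inj hB.
have fM := proj1 (hdimP dot _ _) rk; set M := range (B \- A) in fM iA iB.
have sT x y : dot (B x - A x) y = dot x (B y - A y).
  by rewrite !dotE (op_sa hA) (op_sa hB).
have K v : (forall x, M x -> dot v x = 0) -> A v = B v.
  move=> h; apply/esym/eqP; rewrite -subr_eq0; apply/eqP; apply: (dotxx0 (dot := dot)).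
  by rewrite sT; apply: h; exists (B v - A v).
have nAB : A <> B.
  move=> e; have [_ [x [[y _ yx] x0 _]]] := fM; case/negP: x0; rewrite -yx /= e.
  by rewrite subrr.
have AM x : M x -> M (A x) by move=> Mx; apply: iA; exists x.
have BM x : M x -> M (B x) by move=> Mx; apply: iB; exists x.
have K' v : (forall x, M x -> dot v x = 0) -> B v = A v by move=> /K.
have nBA : B <> A by move/esym.
have MK x : M x -> A x = B x -> x = 0.
  move=> [y _ yx] e; apply: (dotxx0 (dot := dot)); rewrite -{1}yx /= sT.
  by rewrite e subrr dot0r.
have [i [j [x [y [[ij Mx My x0 y0] [Ax Ay hx hy] hAB]]]]] := half_exchange hA hB fM nAB AM K.
have [p [q [u [w [[pq Mu Mw u0 w0] [Bu Bw _ _] hBA]]]]] := half_exchange hB hA fM nBA BM K'.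
have nin t v : M v -> v != 0 -> eig A t v -> ~ eig B t v.
  by move=> Mv v0 Av Bv; case/negP: v0; apply/eqP; apply: MK => //; rewrite Av Bv.
(* At a finite index outside [p], [q] the eigenspaces coincide, but no nonzero vector of [M] is an
   eigenvector of both operators for one eigenvalue. *)
have inf1 t v : M v -> v != 0 -> eig A t v -> t != p -> t != q -> n t = None.
  move=> Mv v0 Av tp tq; case nt : (n t) => [m|//].
  have e := dec_sub_eq dB dA nt (hBA _ tp tq).
  by case: (nin _ _ Mv v0 Av); rewrite e.
have inf2 t v : M v -> v != 0 -> eig B t v -> t != i -> t != j -> n t = None.
  move=> Mv v0 Bv ti tj; case nt : (n t) => [m|//].
  have e := dec_sub_eq dA dB nt (hAB _ ti tj).
  by case: (nin t v Mv v0 _ Bv); rewrite e.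
(* A mismatch would produce two different infinite indices, one from [inf1] and one from [inf2]. *)
have key : (i = p \/ i = q) /\ (j = p \/ j = q).
  have [ip|ip] := eqVneq i p.
    split; first by left.
    have [jp|jp] := eqVneq j p; first by left.
    have [jq|jq] := eqVneq j q; first by right.
    have qi : q != i by rewrite eq_sym ip. 
    have qj : q != j by rewrite eq_sym.
    have e := n_inf (inf1 _ _ My y0 Ay jp jq) (inf2 _ _ Mw w0 Bw qi qj); by rewrite e eqxx in jq.
  have [iq|iq] := eqVneq i q.
    split; first by right.
    have [jp|jp] := eqVneq j p; first by left.
    have [jq|jq] := eqVneq j q; first by right.
    have pi : p != i by rewrite eq_sym. have pj : p != j by rewrite eq_sym.
    have e := n_inf (inf1 _ _ My y0 Ay jp jq) (inf2 _ _ Mu u0 Bu pi pj); by rewrite e eqxx in jp.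
  exfalso; have ni := inf1 _ _ Mx x0 Ax ip iq.
  have [pj|pj] := eqVneq p j.
    have qi : q != i by rewrite eq_sym. have qj : q != j by rewrite -pj eq_sym.
    have e := n_inf ni (inf2 _ _ Mw w0 Bw qi qj); by rewrite e eqxx in iq.
  have pi : p != i by rewrite eq_sym.
  have e := n_inf ni (inf2 _ _ Mu u0 Bu pi pj); by rewrite e eqxx in ip.
exists i, j, x, y; split=> //.
  by split=> // e; apply: nAB; exact: (eig_inj a_inj hA hB).
move=> t ti tj; apply/seteqP; split; last exact: hAB.
apply: hBA.
  by apply/eqP => tp; case: key => -[ip|iq] [jp|jq]; subst; rewrite ?eqxx in ij ti tj.
by apply/eqP => tp; case: key => -[ip|iq] [jp|jq]; subst; rewrite ?eqxx in ij ti tj.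
Qed.

(** [B - A] sends [x] to a multiple of [y'] and [y] to a multiple of [x'], both nonzero, and kills
    everything orthogonal to the plane; so its range is the plane and its kernel the complement. *)
Lemma adj_adjacent A B : grass A -> grass B -> adj dot n (eig A) (eig B) -> adjacent_operators A B.
Proof.
move=> hA hB [i [j [x1 [y1 hr1]]]]; have [e [f [e0 f0 xx yy]]] := exchange_unit hr1.
have hr := exchange_scale e0 f0 hr1; move: (e *: x1) (f *: y1) xx yy hr => x y xx yy hr {hr1 e0 f0 e f x1 y1}.
have [c [b [cb b0 E]]] := exchangeP n_inf hr xx yy.
case: (hr) => [[dA dB ij _] [Ax Ay x0 y0] hout hx hy].
have ji : j != i by rewrite eq_sym.
have xy := dec_orth dA ij Ax Ay; have yx := dot_sym0 xy.
set x' := c *: x + b *: y; set y' := - b^* *: x + c^* *: y.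
have Bx' : eig B i x' by rewrite E; exact: (rotA_x _ _ dA ij Ax Ay xx).
have By' : eig B j y' by rewrite E; exact: (rotA_y _ _ dA ij Ax Ay yy).
have xE : x = c^* *: x' - b *: y'.
  apply: (@dot_ext _ _ dot) => t; rewrite /x' /y' !dotE.
  transitivity ((c * c^* + b * b^*) * dot x t); first by rewrite cb mul1r.
  by ring.
have yE : y = b^* *: x' + c *: y'.
  apply: (@dot_ext _ _ dot) => t; rewrite /x' /y' !dotE.
  transitivity ((c * c^* + b * b^*) * dot y t); first by rewrite cb mul1r.
  by ring.
pose T := B \- A; pose r := (a i)%:C - (a j)%:C : R[i].
have r0 : r != 0 by rewrite subr_eq0 (aC_inj a_inj).
have TD u v : T (u + v) = T u + T v by rewrite /T /= (opD hA) (opD hB) opprD addrACA.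
have TZ z u : T (z *: u) = z *: T u by rewrite /T /= (opZ hA) (opZ hB) scalerBr.
have Tx : T x = (r * b) *: y'.
  rewrite /T /= Ax {1}xE (opD hB) (opN hB) !(opZ hB) Bx' By' [in X in _ - X]xE.
  by apply: (@dot_ext _ _ dot) => t; rewrite /r !dotE; ring.
have Ty : T y = (r * b^*) *: x'.
  rewrite /T /= Ay {1}yE (opD hB) !(opZ hB) Bx' By' [in X in _ - X]yE.
  by apply: (@dot_ext _ _ dot) => t; rewrite /r !dotE; ring.
have Tz v : dot v x = 0 -> dot v y = 0 -> T v = 0.
  move=> vx vy; rewrite /T /= (op_pr a_inj v hA) {1}[v](pr_sum dA) (op_sum hB) -sumrB big1 // => t _.
  have Bv : eig B t (pr (eig A) v t).
    have Av := pr_in dA v t; have [ti|ti] := eqVneq t i.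
      by subst t; apply: hx; split=> //; rewrite -(dot_pr dA).
    have [tj|tj] := eqVneq t j; last by rewrite hout.
    by subst t; apply: hy; split=> //; rewrite -(dot_pr dA).
  by rewrite Bv subrr.
pose M := [set z1 *: x + z2 *: y | z1 in [set: R[i]] & z2 in [set: R[i]]].
have Mxy z1 z2 : M (z1 *: x + z2 *: y) by exists z1 => //; exists z2.
have rM : range T = M.
  apply/seteqP; split=> [_ [v _ <-]|_ [z1 _ [z2 _ <-]]].
    pose v0 := v - dot v x *: x - dot v y *: y.
    have -> : v = (dot v x *: x + dot v y *: y) + v0.
      by apply: (@dot_ext _ _ dot) => t; rewrite /v0 !dotE; ring.
    rewrite TD [T v0]Tz ?addr0; first last.
    - by rewrite /v0 !dotE yy xy mulr0 subr0 mulr1 subrr.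
    - by rewrite /v0 !dotE xx yx mulr0 subr0 mulr1 subrr.
    rewrite TD !TZ Tx Ty /x' /y' !scalerDr !scalerA addrACA -!scalerDl; exact: Mxy.
  (* Preimages of [x] and [y] under [T], read off from [Tx], [Ty] and the expressions [xE], [yE]. *)
  exists (z1 *: (c^* / (r * b^*) *: y - (b / (r * b)) *: x) + z2 *: (b^* / (r * b^*) *: y + c / (r * b) *: x)) => //.
  have TN u : T (- u) = - T u by rewrite -scaleN1r TZ scaleN1r.
  have bc0 : b^* != 0 by rewrite conjC_eq0.
  rewrite TD !TZ !TD TN !TZ Tx Ty !scalerA !divfK ?mulf_neq0 //.
  by rewrite -xE -yE.
have fM : fdim 2 M.
  have fl := fdim_line dot x0.
  have ny : ~ [set z *: x | z in [set: R[i]]] y.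
    move=> [z _ zE]; move: y0; rewrite -(dot_eq0 dot) -{1}zE dotZl xy mulr0 eqxx //.
  have := fdim_add_line fl ny; congr (fdim _ _); apply/seteqP; split.
    by move=> _ [_ [z2 [[z1 _ <-] ->]]]; exact: Mxy.
  by move=> _ [z1 _ [z2 _ <-]]; exists (z1 *: x), z2; split=> //; exists z1.
have iA : invariant_under A M.
  move=> _ [_ [z1 _ [z2 _ <-]] <-]; rewrite (opD hA) !(opZ hA) Ax Ay !scalerA; exact: Mxy.
have BE v : B v = T v + A v by rewrite /T /= subrK.
have kT v : Defs.ker T v <-> dot v x = 0 /\ dot v y = 0.
  split=> [h|[]]; last exact: Tz.
  have sT u : dot v (T u) = 0.
    have := h; rewrite /Defs.ker /= => h'; rewrite /T /= dotDr dotNr -(op_sa hA) -(op_sa hB).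
    by rewrite -dotNl -dotDl -[B v - A v]/(T v) h' dot0l.
  have inM u : M u -> dot v u = 0 by rewrite -rM => -[u' _ <-].
  split; apply: inM; first by have := Mxy 1 0; rewrite scale1r scale0r addr0.
  by have := Mxy 0 1; rewrite scale1r scale0r add0r.
have kA : invariant_under A (Defs.ker T).
  move=> _ [v /kT[vx vy] <-]; apply/kT; rewrite !(op_sa hA) Ax Ay !dotZr vx vy !mulr0 //.
rewrite /adjacent_operators -/T rM; split=> //.
- by rewrite /operator_rank rM; apply/hdimP; exact: fM.
- move=> _ [v Mv <-]; rewrite BE; have lM := submod_fdim fM.
  by apply: (submodD lM); [rewrite -rM; exists v|apply: iA; exists v].
- move=> _ [v kv <-]; rewrite BE (_ : T v = 0) // add0r; apply: kA; by exists v.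
Qed.

End Operators.

(** * Automorphisms of the graph of operators *)

Section Final.
Context {R : realType} {H : completeNormedModType R[i]} (dot : {dot H for conjC}).
Hypothesis norm_dot : forall x : H, `|x| ^+ 2 = dot x x.
Context {k : nat} (a : 'I_k -> R) (n : 'I_k -> enat).
Hypothesis a_inj : injective a.
Hypothesis n_inf : forall i j, n i = None -> n j = None -> i = j.
Hypothesis n_gt1 : forall i m, n i = Some m -> (1 < m)%N.
Hypothesis k_gt2 : (2 < k)%N.
Implicit Types (X : set H) (x y u v w : H) (z : R[i]) (A B : H -> H) (s : R[i] -> R[i]).
Implicit Types (D : 'I_k -> set H).
Local Notation eig := (eigenspaces a).
Local Notation grass := (grassmannian dot a n).
Local Notation is_decomp := (is_decomp dot n).
Local Notation exchange := (exchange dot n).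

Lemma adjacent_eig A B i j x y : grass A -> grass B -> exchange i j (eig A) (eig B) x y ->
  adjacent_subspaces (eig A i) (eig B i).
Proof.
move=> hA hB hr.
have half A' B' u v : exchange i j (eig A') (eig B') u v -> hyperplane (eig A' i `&` eig B' i) (eig A' i).
  move=> h; case: (h) => [[dA' _ _ _] [Au _ u0 _] _ hu _]; split; first by move=> w [].
  exists u; split=> //.
    by move=> [_ /(exchange_meet n_inf h Au)[_ /eqP]]; rewrite dot_eq0 (negPf u0).
  move=> w Aw; have [w' pw e] := perpP dot (submod_dec dA' i) Au u0 Aw.
  exists w'; last by exists (dot w u / dot u u); rewrite {1}e addrC.
  by split; [case: pw|apply: hu].
split; last 2 first.
- exact: half hr.
- by have [u [v [h _]]] := exchange_back n_inf hr; rewrite setIC; apply: half h.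
- by case: hA hB => _ _ _ _ /(_ i) e [_ _ _ _ /(_ i)]; rewrite /eigenspaces e => ->.
Qed.

Lemma exchange_ij_adjacent A B i j x y : grass A -> grass B -> exchange i j (eig A) (eig B) x y ->
  ij_adjacent a i j A B.
Proof.
move=> hA hB hr t; have [->|ti] := eqVneq t i; first exact: adjacent_eig hr.
have [->|tj] /= := eqVneq t j; first exact: adjacent_eig (exchange_sym hr).
by apply/esym; exact: (exchange_out hr ti tj).
Qed.

Section Automorphism.
Variables (f : (H -> H) -> (H -> H)) (A0 : H -> H).
Hypotheses (hf : graph_automorphism grass adjacent_operators f) (hA0 : grass A0).

Let fG A : grass A -> grass (f A). Proof. by case: hf => -[h _ _] _; apply: h. Qed.
Let fI A B : grass A -> grass B -> f A = f B -> A = B.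
Proof. by case: hf => -[_ h _] _ hA hB; apply: h; rewrite inE. Qed.

Definition op_of_dec D := xget A0 [set A | grass A /\ eig A = D].
Definition op_preimage A := xget A0 [set B | grass B /\ f B = A].

Lemma op_of_decP D : is_decomp D -> grass (op_of_dec D) /\ eig (op_of_dec D) = D.
Proof.
move=> dD; rewrite /op_of_dec; case: xgetP => [A -> //|h].
by have [A hA e] := all_dec norm_dot a_inj n_inf hA0 dD; case: (h A).
Qed.

Lemma eigK A : grass A -> op_of_dec (eig A) = A.
Proof.
move=> hA; have [h1 h2] := op_of_decP (eig_dec a_inj hA); exact: (eig_inj a_inj h1 hA h2).
Qed.

Lemma op_preimageP A : grass A -> grass (op_preimage A) /\ f (op_preimage A) = A.
Proof.
move=> hA; rewrite /op_preimage; case: xgetP => [B -> //|h].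
by case: hf => -[_ _ /(_ _ hA)[B hB e]] _; case: (h B).
Qed.

Lemma op_preimageK A : grass A -> op_preimage (f A) = A.
Proof. by move=> hA; have [h1 h2] := op_preimageP (fG hA); apply: fI. Qed.

Definition decF D := eig (f (op_of_dec D)).
Definition decG D := eig (op_preimage (op_of_dec D)).

Lemma decF_eig A : grass A -> decF (eig A) = eig (f A).
Proof. by move=> hA; rewrite /decF eigK. Qed.

Lemma decG_eig A : grass A -> decG (eig A) = eig (op_preimage A).
Proof. by move=> hA; rewrite /decG eigK. Qed.

Lemma adj_operatorsP A B : grass A -> grass B -> adj dot n (eig A) (eig B) <-> adjacent_operators A B.
Proof.
move=> hA hB; split; first exact: (adj_adjacent a_inj n_inf).
exact: (adjacent_adj a_inj n_inf).
Qed.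

Lemma iso_dec : adj_iso dot n decF decG.
Proof.
split.
- by move=> D /op_of_decP[h _]; apply: (eig_dec a_inj); apply: fG.
- by move=> D /op_of_decP[h _]; apply: (eig_dec a_inj); case: (op_preimageP h).
- move=> D /op_of_decP[h e]; rewrite -[in RHS]e /decF decG_eig ?op_preimageK //; exact: fG.
- move=> D /op_of_decP[h e]; have [h1 h2] := op_preimageP h; by rewrite -[in RHS]e /decG decF_eig // h2.
- move=> D D' /op_of_decP[h e] /op_of_decP[h' e']; rewrite -{1}e -{1}e' adj_operatorsP // /decF adj_operatorsP; [|exact: fG|exact: fG].
  by case: hf => _; apply.
Qed.

Lemma automorphism_unitary : exists s U (d : {perm 'I_k}), [/\ s =1 id \/ s =1 conjC,
  semi_unitary dot s U, forall i, n (d i) = n i &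
  forall A i, grass A -> eig (f A) i = U @` eig A (d i)].
Proof.
have dA0 := eig_dec a_inj hA0; have hF := iso_dec.
have [d hd] := ex_type_perm n_inf n_gt1 k_gt2 hF dA0.
have hI : typed_iso dot n decF decG d.
  by split=> // D dD; apply: (type_perm_all n_inf n_gt1 k_gt2 hF dA0 dD hd).
have [s [U [sE hU FE]]] := dec_unitary n_inf n_gt1 k_gt2 dA0 hI.
(* [d] takes the index of a space to that of its image, whereas [permute] names the source for a
   given target. *)
exists s, U, (d^-1)%g; split=> //.
  by move=> i; exact: (typed_iso_dim n_inf n_gt1 k_gt2 (typed_iso_sym hI) i dA0).
move=> A i hA; have := FE (eig A) ((d^-1)%g i) (eig_dec a_inj hA).
by rewrite decF_eig // permKV.
Qed.

End Automorphism.

(** Multiplying [u] by the imaginary unit changes the sign of one side relative to the other, so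
    both vectors vanish. This settles the mixed cases of [adjoint], where its value comes from the
    clause for the other kind of semilinearity. *)
Lemma conj_rigid x v : (forall u, dot u x = conjC (dot u v)) -> v = x.
Proof.
move=> h; have i0 : 'i%C + 'i%C != 0 :> R[i].
  by apply/eqP => /(congr1 (@complex.Im R)) /= /eqP; rewrite -mulr2n pnatr_eq0.
have z u : dot u x = 0.
  have := h ('i%C *: u); rewrite !dotZl rmorphM /= -h.
  have -> : conjC 'i%C = - 'i%C :> R[i] by apply/eqP; rewrite -[conjC _]/(conjc _) eq_complex /= oppr0 !eqxx.
  move/eqP; rewrite mulNr -addr_eq0 -mulrDl mulf_eq0 (negPf i0) => /eqP //.
have -> : x = 0 by apply: dotxx0 (z x).
by apply: (dotxx0 (dot := dot)); rewrite -[LHS]conjCK -h z conjC0.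
Qed.

Lemma oproj_pr D x t : is_decomp D -> oproj dot (D t) x = pr D x t.
Proof.
move=> dD; rewrite /oproj; case: xgetP => [y -> [Dy h]|/(_ (pr D x t))]; first by apply/esym/(pr_uniq dD).
case; split; first exact: (pr_in dD).
by move=> y Dy; rewrite dotDl dotNl (dot_pr dD _ Dy) subrr.
Qed.

Section Semi.
Variables (s : R[i] -> R[i]) (U : H -> H).
Hypotheses (sE : s =1 id \/ s =1 conjC) (hU : semi_unitary dot s U).

Lemma semi0 z : s z = 0 -> z = 0.
Proof. by case: sE => -> // /eqP; rewrite conjC_eq0 => /eqP. Qed.

Lemma semi_real t : s (a t)%:C = (a t)%:C.
Proof. by case: sE => -> //; exact: aC_conj. Qed.

Lemma semiE : [/\ forall x y, U (x + y) = U x + U y, forall z x, U (z *: x) = s z *: U x & injective U].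
Proof.
case: hU => lU sU dU; have s1 : s 1 = 1 by case: sE => ->; rewrite ?conjC1.
have s0 : s 0 = 0 by case: sE => ->; rewrite ?conjC0.
have UD x y : U (x + y) = U x + U y by have := lU 1 x y; rewrite s1 !scale1r.
have U0 : U 0 = 0 by apply: (addrI (U 0)); rewrite -UD !addr0.
have UZ z x : U (z *: x) = s z *: U x by have := lU z x 0; rewrite !addr0 U0 addr0.
split=> // x y e; apply/eqP; rewrite -subr_eq0; apply/eqP; apply: (dotxx0 (dot := dot)); apply: semi0.
have sN1 : s (-1) = -1 by case: sE => -> //; rewrite rmorphN /= conjC1.
by rewrite -dU UD -scaleN1r UZ e sN1 scaleN1r subrr dot0l.
Qed.

Lemma semi_unitary_or : unitary_operator dot U \/ antiunitary_operator dot U.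
Proof.
case: (hU) => lU sU dU; have [_ _ Ui] := semiE.
have bU : bijective U.
  have [V hV] := choice sU; exists V => x; last exact: hV.
  by apply: Ui; rewrite hV.
case: sE => e; [left|right]; split=> //.
- by move=> z x y; rewrite lU e.
- by move=> x y; rewrite dU e.
- by move=> z x y; rewrite lU e.
- by move=> x y; rewrite dU e.
Qed.

Lemma adjoint_semi x : adjoint dot U (U x) = x.
Proof.
case: (hU) => lU sU dU; rewrite /adjoint; case: xgetP => [v _ hv|/(_ x)]; last first.
  case; case: sE => e; [left|right]; split.
  - by move=> z u w; rewrite lU e.
  - by move=> u; rewrite dU e.
  - by move=> z u w; rewrite lU e.
  - by move=> u; rewrite dU e.
have same : (forall u, dot u x = dot u v) -> v = x.
  by move=> h; apply: (@dot_ext _ _ dot) => z; rewrite dotC -h -dotC.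
case: sE hv => e [[_ h]|[_ h]].
- by apply: same => u; rewrite -h dU e.
- by apply: conj_rigid => u; rewrite -h dU e.
- by apply: conj_rigid => u; rewrite -h dU e conjCK.
- by apply: same => u; apply: (can_inj conjCK); rewrite -h dU e.
Qed.

Lemma permute_conj A A' (d : {perm 'I_k}) : grass A -> grass A' ->
  (forall i, eig A' i = U @` eig A (d i)) -> A' = U \o permute dot a d A \o adjoint dot U.
Proof.
move=> hA hA' e; have dA := eig_dec a_inj hA; have dA' := eig_dec a_inj hA'.
case: (hU) => lU sU dU; have [UD UZ Ui] := semiE.
have U0 : U 0 = 0 by apply: (addrI (U 0)); rewrite -UD !addr0.
apply: funext => y; have [x <-] := sU y; rewrite /= adjoint_semi /permute (op_pr a_inj _ hA').
rewrite (big_morph U UD U0); apply: eq_bigr => i _; rewrite UZ semi_real.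
rewrite -/(eig A (d i)) oproj_pr //; congr (_ *: _); apply: (pr_uniq dA').
  by rewrite e; exists (pr (eig A) x (d i)) => //; apply: (pr_in dA).
have s0 : s 0 = 0 by case: sE => ->; rewrite ?conjC0.
rewrite e => _ [v Av <-]; rewrite dotDl dotNl !dU (dot_pr dA _ Av) subrr //.
Qed.

End Semi.

Lemma permute1 A : grass A -> permute dot a 1 A = A.
Proof.
move=> hA; apply: funext => x; rewrite (op_pr a_inj _ hA) /permute.
by apply: eq_bigr => i _; rewrite perm1 -/(eig A i) oproj_pr //; exact: (eig_dec a_inj hA).
Qed.

(** If [d t] differs from [t], take [j] different from both: an exchange at [d t] and [j] changes
    the [t]-th eigenspace of the image, which preservation of the type keeps fixed. *)
Lemma types_perm1 (f : (H -> H) -> (H -> H)) A0 U (d : {perm 'I_k}) : grass A0 ->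
  preserves_types dot a n f -> injective U ->
  (forall A i, grass A -> eig (f A) i = U @` eig A (d i)) -> d = 1%g.
Proof.
move=> hA0 hf Ui fE; have dA0 := eig_dec a_inj hA0.
apply/permP => t; rewrite perm1; apply/eqP; apply: contraT => dt.
have [j [jd jt]] := ex_third (d t) t k_gt2; rewrite eq_sym in jd; rewrite eq_sym in jt; rewrite eq_sym in dt.
have [x Ax x0] := dec_neq0 n_gt1 dA0 (d t); have [y Ay y0] := dec_neq0 n_gt1 dA0 j.
have [D hr _] := ex_exchange dA0 jd Ax Ay x0 y0.
have [B hB DE] := all_dec norm_dot a_inj n_inf hA0 (proj2 (exchange_dec hr)); subst D.
have := hf _ _ jd _ _ hA0 hB (exchange_ij_adjacent hA0 hB hr) t.
rewrite (negPf dt) (negPf jt) /= -/(eig (f A0) t) -/(eig (f B) t) !fE // => e.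
case: (exchange_neqi n_inf hr); apply/seteqP; split=> v hv.
  have : (U @` eig A0 (d t)) (U v) by exists v.
  by rewrite e => -[w hw /Ui <-].
have : (U @` eig B (d t)) (U v) by exists v.
by rewrite -e => -[w hw /Ui <-].
Qed.

End Final.

Theorem theorem4 (R : realType) (H : completeNormedModType R[i])
    (dot : {dot H for conjC})
    (norm_dot : forall x : H, `|x| ^+ 2 = dot x x)
    (k : nat) (a : 'I_k -> R) (n : 'I_k -> enat)
    (a_inj : injective a)
    (n_infinite : forall i, n i = None -> a i = 0)
    (dimH : hdim [set: H] = \big[eaddn/Some 0%N]_(i < k) n i)
    (k_ge3 : (3 <= k)%N)
    (n_gt1 : forall i m, n i = Some m -> (1 < m)%N) :
  (forall f : (H -> H) -> (H -> H),
     graph_automorphism (grassmannian dot a n) adjacent_operators f ->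
     exists (U : H -> H) (delta : {perm 'I_k}),
       [/\ unitary_operator dot U \/ antiunitary_operator dot U,
           dim_preserving n delta &
           forall A, grassmannian dot a n A ->
             f A = U \o permute dot a delta A \o adjoint dot U]) /\
  (forall f : (H -> H) -> (H -> H),
     graph_automorphism (grassmannian dot a n) adjacent_operators f ->
     preserves_types dot a n f ->
     exists U : H -> H,
       (unitary_operator dot U \/ antiunitary_operator dot U) /\
       forall A, grassmannian dot a n A -> f A = U \o A \o adjoint dot U).
Proof.
have n_inf i j : n i = None -> n j = None -> i = j.
  by move=> /n_infinite ai /n_infinite aj; apply: a_inj; rewrite ai aj.
have idU : unitary_operator dot idfun by exact: unitary_id.
(* For an empty Grassmannian the formula for [f A] is vacuous, and the identity serves as [U]. *)
split=> f hf; have [[A0 hA0]|nG] := pselect (exists A, grassmannian dot a n A).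
- have [s [U [d [sE hU nd fE]]]] := automorphism_unitary norm_dot a_inj n_inf n_gt1 k_ge3 hf hA0.
  exists U, d; split=> //; first exact: semi_unitary_or sE hU.
  move=> A hA; apply: (permute_conj a_inj sE hU hA) => [|i]; last exact: fE.
  by case: hf => -[h _ _] _; apply: h.
- exists idfun, 1%g; split; [by left|by move=> i; rewrite perm1|].
  by move=> A hA; case: nG; exists A.
- move=> ht; have [s [U [d [sE hU nd fE]]]] := automorphism_unitary norm_dot a_inj n_inf n_gt1 k_ge3 hf hA0.
  exists U; split; first exact: semi_unitary_or sE hU.
  have [_ _ Ui] := semiE sE hU.
  have d1 := types_perm1 norm_dot a_inj n_inf n_gt1 k_ge3 hA0 ht Ui fE.
  move=> A hA; rewrite -[A in RHS](permute1 a_inj hA) -d1.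
  apply: (permute_conj a_inj sE hU hA) => [|i]; last exact: fE.
  by case: hf => -[h _ _] _; apply: h.
- move=> _; exists idfun; split; first by left.
  by move=> A hA; case: nG; exists A.
Qed.
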